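(* Let $\delta:\mathcal{T}^\infty\to\mathcal{T}^\infty$ be a derivation, i.e. a (not assumed continuous) linear map with $\delta(ab)=a\delta(b)+\delta(a)b$ for all $a,b\in\mathcal{T}^\infty$. Then $\delta$ is continuous and there exists a unique function $F\in C^\infty(\mathbb{R}/\mathbb{Z})$ such that $$\delta=\delta_F+\tilde\delta,$$ where $\delta_F(a)=[T(F_+)\mathbb{K}+\mathbb{K}T(F_-),a]$ and $\tilde\delta:\mathcal{T}^\infty\to\mathcal{K}^\infty$ is an inner derivation.
   Context: $H$ is a separable infinite-dimensional complex Hilbert space with a fixed orthonormal basis $\{E_k\}_{k\ge0}$; $P_{k,l}$ is the operator with $P_{k,l}E_l=E_k$ and $P_{k,l}E_m=0$ for $m\ne l$. A family of complex numbers is rapidly decaying (RD) if it remains bounded after multiplication by any polynomial in its indices. $\mathcal{K}^\infty$ (smooth compact operators) is the set of operators $c=\sum_{k,l\ge0}c_{k,l}P_{k,l}$ with $\{c_{k,l}\}$ RD, with the Fréchet topology of rapidly decaying matrices (e.g. given by the seminorms $\sup_{k,l}(1+k)^M(1+l)^N|c_{k,l}|$). $U$ is the unilateral shift $UE_k=E_{k+1}$ and $\mathbb{K}$ is the unbounded diagonal operator $\mathbb{K}E_k=kE_k$. For $f\in C^\infty(\mathbb{R}/\mathbb{Z})$ with Fourier series $f(x)=\sum_{n\in\mathbb{Z}}f_ne^{2\pi inx}$, the Toeplitz operator is $T(f)=\sum_{n\ge0}f_nU^n+\sum_{n<0}f_n(U^* )^{-n}$. The smooth Toeplitz algebra is $\mathcal{T}^\infty=\{T(f)+c: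 f\in C^\infty(\mathbb{R}/\mathbb{Z}),\ c\in\mathcal{K}^\infty\}$; the decomposition $T(f)+c$ is unique, and $\mathcal{T}^\infty\cong C^\infty(\mathbb{R}/\mathbb{Z})\oplus\mathcal{K}^\infty$ carries the product Fréchet topology. It is an algebra and $\mathcal{K}^\infty$ is an ideal in it. For $F=\sum_nF_ne^{2\pi inx}\in C^\infty(\mathbb{R}/\mathbb{Z})$, put $F_+(x)=\sum_{n\ge0}F_ne^{2\pi inx}$ and $F_-(x)=\sum_{n<0}F_ne^{2\pi inx}$. The commutator defining $\delta_F(a)$ is computed on the dense space of vectors $\sum_kx_kE_k$ with $\{x_k\}$ RD (which is preserved by $\mathbb{K}$, by all $T(f)$ with $f$ smooth and by $\mathcal{K}^\infty$), and $\delta_F$ is a derivation of $\mathcal{T}^\infty$. A derivation is inner if it has the form $a\mapsto[\alpha,a]$ for some $\alpha\in\mathcal{T}^\infty$. *)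

(* Defs.v *)
From mathcomp Require Import all_boot all_order all_algebra.
From mathcomp Require Import complex.
From mathcomp Require Import all_classical all_reals all_analysis.

Set Implicit Arguments.
Unset Strict Implicit.
Unset Printing Implicit Defensive.

Import Order.TTheory GRing.Theory Num.Theory.
Import numFieldNormedType.Exports.

Local Open Scope classical_set_scope.
Local Open Scope complex_scope.
Local Open Scope ring_scope.

(* The sum of a convergent series; a default value if the series diverges. *)
Definition nsum (K : numFieldType) (V : normedModType K) (u : nat -> V) : V :=
  limn (series u).

(* R[i]^o is R[i] equipped with the topology of its modulus. *)
Definition csum (R : realType) (u : nat -> R[i]) : R[i] :=
  nsum (u : nat -> R[i]^o).

Section RapidDecay.
Variable R : realType.

Definition rapid_decay (x : nat -> R[i]) : Prop :=
  forall p : {poly R[i]}, exists B : R[i],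
    forall k, `|p.[k%:R] * x k| <= B.

Definition rapid_decay2 (c : nat -> nat -> R[i]) : Prop :=
  forall p : {poly {poly R[i]}}, exists B : R[i],
    forall k l, `|p.[k%:R, l%:R] * c k l| <= B.

Definition decay_seminorm (M N : nat) (c : nat -> nat -> R[i]) : R :=
  sup [set complex.Re `|(1 + kl.1%:R) ^+ M * (1 + kl.2%:R) ^+ N * c kl.1 kl.2|
      | kl in [set: nat * nat]].

End RapidDecay.

(* Functions on R/Z are represented by 1-periodic functions on R. *)
Section Circle.
Variable R : realType.
Implicit Types f F : R -> R[i].

Definition smooth_circle f : Prop :=
  (forall x, f (x + 1) = f x) /\
  (forall n x, derivable (derive1n n (fun y => complex.Re (f y))) x 1 /\
               derivable (derive1n n (fun y => complex.Im (f y))) x 1).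

Definition cderive1n n f (x : R) : R[i] :=
  derive1n n (fun y => complex.Re (f y)) x +i*
  derive1n n (fun y => complex.Im (f y)) x.

Definition smooth_seminorm (n : nat) f : R :=
  sup [set complex.Re `|cderive1n n f x| | x in [set: R]].

Definition cexp2pi (n : int) (x : R) : R[i] :=
  cos (2 * pi * n%:~R * x) +i* sin (2 * pi * n%:~R * x).

Definition fourier f (n : int) : R[i] :=
  (\int[lebesgue_measure]_(x in `[0, 1]) complex.Re (f x * cexp2pi (- n) x)) +i*
  (\int[lebesgue_measure]_(x in `[0, 1]) complex.Im (f x * cexp2pi (- n) x)).

Definition fourier_plus F (x : R) : R[i] :=
  csum (fun n : nat => fourier F n%:Z * cexp2pi n%:Z x).

Definition fourier_minus F (x : R) : R[i] :=
  csum (fun n : nat => fourier F (- n.+1%:Z) * cexp2pi (- n.+1%:Z) x).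

End Circle.

(* ip is linear in its first argument and conjugate-linear in its second. *)
Section Toeplitz.
Variables (R : realType) (H : completeNormedModType R[i]).
Variables (ip : {dot H for Num.conj}) (E : nat -> H).
Implicit Types (a b alpha : H -> H) (f F : R -> R[i]).

Definition is_hilbert_norm : Prop := forall x : H, `|x| ^+ 2 = ip x x.

Definition is_orthonormal_basis : Prop :=
  (forall i j, ip (E i) (E j) = (i == j)%:R) /\
  (forall x, series (fun k => ip x (E k) *: E k) @ \oo --> x).

Definition matrix_unit (k l : nat) (x : H) : H := ip x (E l) *: E k.

Definition unilateral_shift (x : H) : H := nsum (fun k => ip x (E k) *: E k.+1).

Definition unilateral_shift_adj (x : H) : H := nsum (fun k => ip x (E k.+1) *: E k).

(* Only used on vectors with rapidly decaying coordinates, where the series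
   converges. *)
Definition number_op (x : H) : H := nsum (fun k => k%:R *: (ip x (E k) *: E k)).

Definition matrix_op (c : nat -> nat -> R[i]) (x : H) : H :=
  nsum (fun k => nsum (fun l => c k l *: matrix_unit k l x)).

Definition toeplitz f (x : H) : H :=
  nsum (fun n : nat => fourier f n%:Z *: iter n unilateral_shift x) +
  nsum (fun n : nat => fourier f (- n.+1%:Z) *: iter n.+1 unilateral_shift_adj x).

Definition smooth_compact : set (H -> H) :=
  [set a | exists2 c, rapid_decay2 c & a = matrix_op c].

Definition smooth_toeplitz : set (H -> H) :=
  [set a | exists f c, [/\ smooth_circle f, rapid_decay2 c
                         & a = toeplitz f + matrix_op c]].

(* The sets toeplitz_ball n eps form a base of neighbourhoods of 0 for the
   product Frechet topology on pairs (f, c). *)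
Definition toeplitz_ball (n : nat) (eps : R) : set (H -> H) :=
  [set a | exists f c,
    [/\ smooth_circle f, rapid_decay2 c, a = toeplitz f + matrix_op c,
        forall k, (k <= n)%N -> smooth_seminorm k f < eps
      & forall M N, (M <= n)%N -> (N <= n)%N -> decay_seminorm M N c < eps]].

Definition toeplitz_nbhs a : set_system (H -> H) :=
  filter_from [set p : nat * R | 0 < p.2]
    (fun p => [set b | toeplitz_ball p.1 p.2 (b - a)]).

Definition toeplitz_continuous (delta : (H -> H) -> (H -> H)) : Prop :=
  forall a, smooth_toeplitz a ->
    delta @ toeplitz_nbhs a `=>` toeplitz_nbhs (delta a).

(* Maps on the algebra of smooth Toeplitz operators are represented by maps on
   all functions H -> H, whose values outside of the algebra are irrelevant. *)
Definition is_derivation (delta : (H -> H) -> (H -> H)) : Prop :=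
  [/\ forall a, smooth_toeplitz a -> smooth_toeplitz (delta a),
      forall (t : R[i]) a b, smooth_toeplitz a -> smooth_toeplitz b ->
        delta (t *: a + b) = t *: delta a + delta b
    & forall a b, smooth_toeplitz a -> smooth_toeplitz b ->
        delta (a \o b) = (a \o delta b) + (delta a \o b)].

Definition is_inner (d : (H -> H) -> (H -> H)) : Prop :=
  exists2 alpha, smooth_toeplitz alpha &
    forall a, smooth_toeplitz a -> d a = (alpha \o a) - (a \o alpha).

Definition rapid_decay_vector : set H :=
  [set x | rapid_decay (fun k => ip x (E k))].

Definition delta_generator F (x : H) : H :=
  toeplitz (fourier_plus F) (number_op x) + number_op (toeplitz (fourier_minus F) x).

(* dF a is the element of the algebra which extends the commutator, computed on
   the dense subspace of vectors with rapidly decaying coordinates. *)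
Definition is_delta F (dF : (H -> H) -> (H -> H)) : Prop :=
  forall a, smooth_toeplitz a ->
    smooth_toeplitz (dF a) /\
    forall x, rapid_decay_vector x ->
      dF a x = delta_generator F (a x) - a (delta_generator F x).

End Toeplitz.

(* Main.v *)
(* An operator a is studied through its matrix a_kl = <a E_l, E_k>.  For smooth
   Toeplitz operators this is f_(k-l) + c_kl with f and c rapidly decaying.
   Leibniz' rule applied to P_0k a P_l0 = a_kl P_00 shows that every derivation
   is implemented by the matrix beta_jl = <delta(P_l0) E_0, E_j>, without any
   continuity assumption.  Applied to the shift U this gives
   beta_(k+1)(l+1) - beta_kl = b_(k+1-l) + c_(k+1)l where b + c is the matrix of
   delta(U).  Hence, with F_n = b_(n+1), the difference of beta and the matrix
   F_(k-l) min(k,l) of T(F_+) K + K T(F_-) has rapidly decaying increments along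
   the diagonals, and rapidly decaying first row and column, so it is again the
   matrix of a smooth Toeplitz operator: this is the inner part.
   The same diagonal argument shows that the commutator with F_(k-l) min(k,l)
   preserves smooth Toeplitz matrices: the increments of the commutator with
   T(f) form the matrix of [T(F), T(f)], which is rapidly decaying.  All these
   estimates are explicit, which gives continuity.  Finally F is determined by
   the Toeplitz part of delta(U). *)

Require Import Defs.
From mathcomp Require Import all_boot all_order all_algebra.
From mathcomp Require Import complex.
From mathcomp Require Import all_classical all_reals all_analysis.
From mathcomp Require Import ring lra zify.

Set Implicit Arguments.
Unset Strict Implicit.
Unset Printing Implicit Defensive.

Import Order.TTheory GRing.Theory Num.Theory.
Import numFieldNormedType.Exports.

Local Open Scope classical_set_scope.
Local Open Scope complex_scope.
Local Open Scope ring_scope.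

(** * Absolutely convergent sums *)

(** Operators are bare functions [H -> H], so linearity, boundedness and convergence of each series
    are established before entries are compared; afterwards a bounded operator is recovered from its
    entries. One device controls the sums in all estimates: a bound [A] on the terms weighted by
    [(1 + j)^2] gives a sum of size at most [2 * A]. It explains most of the constants and every
    loss of two orders of decay. The generator is unbounded, but its entries [F_(k-l) min(k,l)] grow
    only linearly along a diagonal and vanish in row and column 0. By the first fact its commutators
    with rapidly decaying matrices decay rapidly; by the second, shifting its products along a
    diagonal leaves no boundary term. Fourier analysis enters twice: weighted bounds on coefficients
    and smooth seminorms control each other up to a loss of orders, which gives continuity, and a
    smooth function is determined by its coefficients (shown with Fejer kernels), which gives
    uniqueness of [F] as a function. *)

(** Norms over [R[i]] take values in [R[i]], which is only partially ordered. Their real parts live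
    in the ordered field [R], where estimates can be divided and passed to [lra]. *)
Definition nrm (R : realType) (V : normedZmodType R[i]) (x : V) : R :=
  complex.Re `|x|.

Section Norms.
Variable R : realType.
Implicit Type V : normedZmodType R[i].

Lemma nrmE V (x : V) : `|x| = (nrm x)%:C.
Proof. by rewrite RRe_real // normr_real. Qed.

Lemma nrm_ge0 V (x : V) : 0 <= nrm x.
Proof. by rewrite -ler0c -nrmE. Qed.

Lemma nrm0 V : nrm (0 : V) = 0.
Proof. by rewrite /nrm normr0. Qed.

Lemma nrm0_eq0 V (x : V) : nrm x = 0 -> x = 0.
Proof. by move=> h; apply/normr0_eq0; rewrite nrmE h. Qed.

Lemma ler_nrmD V (x y : V) : nrm (x + y) <= nrm x + nrm y.
Proof. by rewrite -lecR rmorphD /= -!nrmE ler_normD. Qed.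

Lemma nrmN V (x : V) : nrm (- x) = nrm x.
Proof. by rewrite /nrm normrN. Qed.

Lemma ler_nrmB V (x y : V) : nrm (x - y) <= nrm x + nrm y.
Proof. by rewrite -(nrmN y) ler_nrmD. Qed.

Lemma ler_nrm_sum V (I : Type) (r : seq I) (P : pred I) (F : I -> V) :
  nrm (\sum_(i <- r | P i) F i) <= \sum_(i <- r | P i) nrm (F i).
Proof.
elim/big_rec2: _ => [|i y x _ h]; first by rewrite nrm0.
by apply: le_trans (ler_nrmD _ _) _; rewrite lerD2l.
Qed.

Lemma nrmM (x y : R[i]) : nrm (x * y) = nrm x * nrm y.
Proof. by apply: complexI; rewrite rmorphM /= -!nrmE normrM. Qed.

Lemma nrmX (x : R[i]) n : nrm (x ^+ n) = nrm x ^+ n.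
Proof. by apply: complexI; rewrite rmorphXn /= -!nrmE normrX. Qed.

Lemma nrm_real (x : R) : nrm (x%:C) = `|x|.
Proof. by rewrite /nrm normc_def /= expr0n /= addr0 sqrtr_sqr. Qed.

Lemma nrm_nat n : nrm (n%:R : R[i]) = n%:R.
Proof. by rewrite -(rmorph_nat (real_complex R)) nrm_real normr_nat. Qed.

Lemma nrmZ (V : normedModType R[i]) (a : R[i]) (x : V) :
  nrm (a *: x) = nrm a * nrm x.
Proof. by apply: complexI; rewrite rmorphM /= -!nrmE normrZ. Qed.

Lemma Re_le_nrm (x : R[i]) : `|complex.Re x| <= nrm x.
Proof. by rewrite -lecR -nrmE normc_ge_Re. Qed.

Lemma Im_le_nrm (x : R[i]) : `|complex.Im x| <= nrm x.
Proof.
case: x => a b; rewrite /nrm normc_def /= -(sqrtr_sqr b).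
by apply: ler_wsqrtr; rewrite lerDr sqr_ge0.
Qed.

Lemma nrm_le_ReIm (x : R[i]) : nrm x <= `|complex.Re x| + `|complex.Im x|.
Proof.
case: x => a b; rewrite /nrm normc_def /=.
have h : 0 <= `|a| + `|b| by rewrite addr_ge0.
rewrite -(ger0_norm h) -sqrtr_sqr; apply: ler_wsqrtr.
rewrite sqrrD !real_normK ?num_real // addrAC lerDl.
by rewrite mulrn_wge0 // mulr_ge0.
Qed.

End Norms.

Section Sums.
Variable R : realType.
Implicit Type V : normedModType R[i].

Lemma cvg_nrmP V (u : nat -> V) (l : V) :
  u @ \oo --> l <->
  forall e : R, 0 < e -> \forall n \near \oo, nrm (l - u n) < e.
Proof.
split=> [/cvgrPdist_lt h e e0|h].
  have e0' : 0 < e%:C by rewrite ltcR.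
  by apply: filterS (h _ e0') => n; rewrite nrmE ltcR.
(* A positive element of [R[i]] is real, so only a real [e] remains. *)
apply/cvgrPdist_lt => -[e e'] /[dup]; rewrite {1}ltcE /= => /andP[/eqP -> e0] _.
by apply: filterS (h e e0) => n; rewrite nrmE ltcR.
Qed.

Lemma nsumE V (u : nat -> V) (l : V) : series u @ \oo --> l -> nsum u = l.
Proof. by move=> /cvg_lim; apply; exact: norm_hausdorff. Qed.

Lemma nrm_lim_le V (u : nat -> V) (l : V) (B : R) :
  u @ \oo --> l -> (\forall n \near \oo, nrm (u n) <= B) -> nrm l <= B.
Proof.
move=> /cvg_nrmP ul uB; apply/ler_addgt0Pr => e e0.
have [n [h1 h2]] := @filter_ex _ _ _ _ (filterI (ul e e0) uB).
rewrite -[l](subrK (u n)); apply: le_trans (ler_nrmD _ _) _.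
by rewrite addrC lerD // ltW.
Qed.

(** Telescoping: [2 / (1 + k) - 2 / (2 + k)] exceeds [(1 + k)^-2] by the nonnegative term
    [k / ((1 + k)^2 (2 + k))]. This is the factor 2 of all later sum estimates. *)
Lemma sum_inv_sqr m n : (m <= n)%N ->
  \sum_(m <= k < n) ((1 + k%:R) ^- 2 : R) <= 2 * (1 + m%:R)^-1 - 2 * (1 + n%:R)^-1.
Proof.
move=> /subnK <-; elim: (n - m)%N => [|p ih]; first by rewrite add0n big_geq // subrr.
rewrite addSn big_nat_recr ?leq_addl //=.
set q := (p + m)%N in ih *; apply: le_trans (lerD ih (lexx _)) _.
rewrite -[q.+1%:R]natr1; set x : R := q%:R.
have x0 : 0 <= x by rewrite ler0n.
have y0 : 0 < 1 + x by lra.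
have z0 : 0 < 1 + (x + 1) by lra.
rewrite -subr_ge0.
have -> : 2 * (1 + m%:R)^-1 - 2 * (1 + (x + 1))^-1 -
   (2 * (1 + m%:R)^-1 - 2 * (1 + x)^-1 + (1 + x) ^- 2) =
   x * ((1 + x) ^- 2 * (1 + (x + 1))^-1).
  by field; rewrite !lt0r_neq0 //= lt0r_neq0 // ltr_pwDl ?ler0n.
by rewrite !mulr_ge0 ?invr_ge0 ?exprn_ge0 // ltW.
Qed.

(** The factor [1 / (1 + m)] keeps a rate for the tails; it yields the Cauchy property here and
    uniform convergence of trigonometric series later. *)
Lemma nrm_sum_le V (u : nat -> V) (A : R) m n :
  (forall j, nrm (u j) * (1 + j%:R) ^+ 2 <= A) ->
  nrm (\sum_(m <= k < n) u k) <= 2 * A * (1 + m%:R)^-1.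
Proof.
move=> hu.
have A0 : 0 <= A.
  by apply: le_trans (hu 0%N); rewrite mulr_ge0 ?nrm_ge0 // exprn_ge0 // addr_ge0.
have hm k : 0 < 1 + k%:R :> R by rewrite ltr_pwDl.
have [mn|/ltnW nm] := leqP m n; last first.
  by rewrite big_geq // nrm0 !mulr_ge0 // invr_ge0 ltW.
apply: le_trans (ler_nrm_sum _ _ _) _.
apply: (@le_trans _ _ (\sum_(m <= k < n) A * (1 + k%:R) ^- 2)).
  by apply: ler_sum => k _; rewrite ler_pdivlMr ?exprn_gt0.
rewrite -mulr_sumr; apply: le_trans (ler_wpM2l A0 (sum_inv_sqr mn)) _.
rewrite mulrBr [2 * A]mulrC -mulrA gerBl.
by rewrite !mulr_ge0 // invr_ge0 ltW.
Qed.

Lemma nrm_series_le V (u : nat -> V) (A : R) n :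
  (forall j, nrm (u j) * (1 + j%:R) ^+ 2 <= A) -> nrm (series u n) <= 2 * A.
Proof.
by move=> /nrm_sum_le h; have := h 0%N n; rewrite addr0 invr1 mulr1.
Qed.

Lemma nrm_sum_lim V (u : nat -> V) (l : V) (A : R) :
  (forall j, nrm (u j) * (1 + j%:R) ^+ 2 <= A) -> series u @ \oo --> l ->
  nrm l <= 2 * A.
Proof.
by move=> hu /nrm_lim_le; apply; apply: nearW => n; exact: nrm_series_le.
Qed.

Lemma cauchy_series_sqr V (u : nat -> V) (A : R) :
  (forall j, nrm (u j) * (1 + j%:R) ^+ 2 <= A) -> cauchy (series u @ \oo).
Proof.
move=> hu; apply/cauchy_seriesP => -[e e']; rewrite ltcE /= => /andP[/eqP -> e0].
(* Beyond [2 * A / e] the tail bound [2 * A / (1 + m)] is below [e]. *)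
pose N := (Num.truncn (2 * A / e)).+1.
exists ([set n | (N <= n)%N], setT) => /=.
  by split; [exact: nbhs_infty_ge|exact: filterT].
move=> [m n] [/= Nm _]; rewrite nrmE ltcR.
apply: le_lt_trans (nrm_sum_le m n hu) _.
rewrite ltr_pdivrMr ?ltr_pwDl // [e * _]mulrC -ltr_pdivrMr //.
apply: lt_le_trans (truncnS_gt _) _.
by apply: (@le_trans _ _ m%:R); rewrite ?ler_nat // lerDr.
Qed.

Lemma nsum_cvg (V : completeNormedModType R[i]) (u : nat -> V) (A : R) :
  (forall j, nrm (u j) * (1 + j%:R) ^+ 2 <= A) ->
  series u @ \oo --> nsum u.
Proof.
by move=> /cauchy_series_sqr hu; apply/cauchy_cvgP.
Qed.

Lemma cvg_ReIm (u : nat -> R[i]) (a b : R) :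
  (fun n => complex.Re (u n)) @ \oo --> a ->
  (fun n => complex.Im (u n)) @ \oo --> b ->
  (u : nat -> R[i]^o) @ \oo --> (a +i* b : R[i]^o).
Proof.
move=> /cvgrPdist_lt ha /cvgrPdist_lt hb; apply/cvg_nrmP => e e0.
have e20 : 0 < e / 2 by rewrite divr_gt0.
apply: filterS2 (ha _ e20) (hb _ e20) => n h1 h2.
apply: le_lt_trans (nrm_le_ReIm _) _.
case: (u n) h1 h2 => x y /= h1 h2; rewrite (splitr e) ltrD //.
Qed.

Lemma series_sqr_cvgR (u : nat -> R) (A : R) :
  (forall j, `|u j| * (1 + j%:R) ^+ 2 <= A) -> cvgn (series u).
Proof.
move=> hu; apply: normed_cvg.
have hp j : 0 < (1 + j%:R) ^+ 2 :> R by rewrite exprn_gt0 // ltr_pwDl.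
apply: (@series_le_cvg R _ (fun j => A * (1 + j%:R) ^- 2)) => [n|n|n|].
- exact: normr_ge0.
- apply: le_trans (normr_ge0 (u n)) _.
  by rewrite ler_pdivlMr //; exact: hu.
- by rewrite ler_pdivlMr //; exact: hu.
have A0 : 0 <= A.
  by apply: le_trans (hu 0%N); rewrite mulr_ge0 // exprn_ge0 // addr_ge0.
apply: nondecreasing_is_cvgn.
  apply: nondecreasing_series => n _ _.
  by rewrite mulr_ge0 // invr_ge0 exprn_ge0 // addr_ge0.
exists (A * 2) => _ [n _ <-]; rewrite /series /= -mulr_sumr ler_wpM2l //.
apply: le_trans (sum_inv_sqr (leq0n n)) _.
by rewrite addr0 invr1 mulr1 gerBl mulr_ge0 // invr_ge0 addr_ge0.
Qed.

Lemma Re_sum (I : Type) (r : seq I) (P : pred I) (F : I -> R[i]) :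
  complex.Re (\sum_(i <- r | P i) F i) = \sum_(i <- r | P i) complex.Re (F i).
Proof. exact: (raddf_sum (@complex.Re R : Rcomplex R -> R)). Qed.

Lemma Im_sum (I : Type) (r : seq I) (P : pred I) (F : I -> R[i]) :
  complex.Im (\sum_(i <- r | P i) F i) = \sum_(i <- r | P i) complex.Im (F i).
Proof. exact: (raddf_sum (@complex.Im R : Rcomplex R -> R)). Qed.

(** A relation instead of an equation for [csum]: the limit of a divergent series is a default
    value, so sums are identified through uniqueness of limits. *)
Definition csums (u : nat -> R[i]) (s : R[i]) : Prop :=
  series (u : nat -> R[i]^o) @ \oo --> (s : R[i]^o).

(** Real and imaginary parts converge separately, by completeness of [R]. *)
Lemma csumsP (u : nat -> R[i]) (A : R) :
  (forall j, nrm (u j) * (1 + j%:R) ^+ 2 <= A) -> csums u (csum u).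
Proof.
move=> hu.
have h0 j : 0 <= (1 + j%:R) ^+ 2 :> R by rewrite exprn_ge0 // addr_ge0.
have hr : cvgn (series (fun j => complex.Re (u j))).
  apply: (@series_sqr_cvgR _ A) => j; apply: le_trans (hu j).
  by rewrite ler_wpM2r // Re_le_nrm.
have hi : cvgn (series (fun j => complex.Im (u j))).
  apply: (@series_sqr_cvgR _ A) => j; apply: le_trans (hu j).
  by rewrite ler_wpM2r // Im_le_nrm.
have h : csums u (limn (series (fun j => complex.Re (u j))) +i*
    limn (series (fun j => complex.Im (u j)))).
  apply: cvg_ReIm.
    rewrite [X in X @ _](_ : _ = series (fun j => complex.Re (u j))) //.
    by apply/funext => n; rewrite /series /= Re_sum.
  rewrite [X in X @ _](_ : _ = series (fun j => complex.Im (u j))) //.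
  by apply/funext => n; rewrite /series /= Im_sum.
by rewrite /csum (nsumE h).
Qed.

Lemma csumsE (u : nat -> R[i]) (s : R[i]) : csums u s -> csum u = s.
Proof. exact: nsumE. Qed.

Lemma csums_uniq (u : nat -> R[i]) (a b : R[i]) : csums u a -> csums u b -> a = b.
Proof. exact: (@cvg_unique _ (@norm_hausdorff _ R[i]^o)). Qed.

Lemma csums_le (u : nat -> R[i]) (s : R[i]) (A : R) :
  csums u s -> (forall j, nrm (u j) * (1 + j%:R) ^+ 2 <= A) -> nrm s <= 2 * A.
Proof. by move=> hs hu; exact: (@nrm_sum_lim R[i]^o u _ _ hu hs). Qed.

Lemma csum_le (u : nat -> R[i]) (A : R) :
  (forall j, nrm (u j) * (1 + j%:R) ^+ 2 <= A) -> nrm (csum u) <= 2 * A.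
Proof. by move=> hu; exact: (csums_le (csumsP hu)). Qed.

Lemma csumsD (u v : nat -> R[i]) (a b : R[i]) :
  csums u a -> csums v b -> csums (fun j => u j + v j) (a + b).
Proof.
move=> hu hv.
have e : series (fun j => u j + v j : R[i]^o) =
  series (u : nat -> R[i]^o) + series (v : nat -> R[i]^o).
  by apply/funext => n; rewrite /series /= big_split.
by rewrite /csums e; exact: (@cvgD _ R[i]^o _ _ _ _ _ _ _ hu hv).
Qed.

Lemma csumsZ (z : R[i]) (u : nat -> R[i]) (a : R[i]) :
  csums u a -> csums (fun j => z * u j) (z * a).
Proof.
move=> hu.
have e : series (fun j => z * u j : R[i]^o) = z \*: series (u : nat -> R[i]^o).
  by apply/funext => n; rewrite /series /= scaler_sumr.
by rewrite /csums e; exact: (@cvgZl_tmp _ R[i]^o _ _ _ z _ _ hu).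
Qed.

Lemma csumsB (u v : nat -> R[i]) (a b : R[i]) :
  csums u a -> csums v b -> csums (fun j => u j - v j) (a - b).
Proof.
move=> hu hv; have {}hv := csumsZ (z := -1) hv; rewrite -(mulN1r b).
rewrite (_ : (fun j => u j - v j) = fun j => u j + -1 * v j).
  exact: csumsD.
by apply/funext => j; rewrite mulN1r.
Qed.

(** Removing a head expresses both a shift of the summation index and the cancellation of a finite
    block. *)
Lemma csums_drop N (u : nat -> R[i]) (a : R[i]) :
  csums u a <-> csums (fun j => u (j + N)%N) (a - \sum_(0 <= j < N) u j).
Proof.
have e n : series (u : nat -> R[i]^o) (n + N)%N =
    \sum_(0 <= j < N) u j + series (fun j => u (j + N)%N : R[i]^o) n.
  rewrite /series /= (@big_cat_nat _ _ _ N 0 (n + N)) ?leq_addl //=.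
  by congr (_ + _); have := big_addn 0 (n + N) N xpredT u; rewrite add0n addnK.
split=> [|h].
  rewrite /csums -(cvg_shiftn N (series (u : nat -> R[i]^o))) => /cvg_nrmP h.
  apply/cvg_nrmP => e' e0; apply: filterS (h e' e0) => n.
  by rewrite /= e opprD addrA.
rewrite /csums -(cvg_shiftn N (series (u : nat -> R[i]^o))).
apply/cvg_nrmP => e' e0; move/cvg_nrmP: h => h; apply: filterS (h e' e0) => n.
by rewrite /= e opprD addrA.
Qed.

Lemma csums0 : csums (fun=> 0) 0.
Proof.
rewrite /csums (_ : series _ = fun=> 0); first exact: cvg_cst.
by apply/funext => n; rewrite /series /= big1.
Qed.

Lemma csums_finite N (u : nat -> R[i]) : (forall j, (N <= j)%N -> u j = 0) ->
  csums u (\sum_(0 <= j < N) u j).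
Proof.
move=> hu; apply/(csums_drop N); rewrite subrr.
rewrite (_ : (fun j => _) = fun=> 0); first exact: csums0.
by apply/funext => j; rewrite hu // leq_addl.
Qed.

Lemma csums_single m (z : R[i]) : csums (fun j => if j == m then z else 0) z.
Proof.
have := @csums_finite m.+1 (fun j => if j == m then z else 0).
rewrite big_nat_recr //= eqxx big_nat big1 ?add0r; first apply.
  by move=> j kj; rewrite gtn_eqF.
by move=> j /andP[_ jk]; rewrite ltn_eqF.
Qed.

End Sums.

(** * Rapidly decaying matrices *)

Section Matrices.
Variable R : realType.
Implicit Types (f g h F : int -> R[i]) (X Y Z c A : nat -> nat -> R[i]).

Definition wgt (n : nat) : R := 1 + n%:R.

(** Order and bound are explicit because continuity needs estimates uniform in the operator;
    [zdecay] and [mdecay] forget them. *)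
Definition zbd N (e : R) h := forall n : int, wgt `|n|%N ^+ N * nrm (h n) <= e.

Definition mbd N (e : R) c :=
  forall k l, wgt k ^+ N * wgt l ^+ N * nrm (c k l) <= e.

Definition zdecay h := forall N, exists e, zbd N e h.

Definition mdecay c := forall N, exists e, mbd N e c.

Definition toepm f k l : R[i] := f (k%:Z - l%:Z).

(* The matrix of the unbounded operator T(F_+) K + K T(F_-). *)
Definition genm F k l : R[i] := F (k%:Z - l%:Z) * (minn k l)%:R.

(** A common home for Toeplitz and rapidly decaying matrices ([p = 0]) and for [genm] ([p = 1]):
    rapid decay away from the diagonal, growth of degree [p] along it. *)
Definition band p N (P : R) X :=
  forall k l, wgt `|k%:Z - l%:Z|%N ^+ N * nrm (X k l) <= P * wgt (minn k l) ^+ p.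

Definition banded p X := forall N, exists P, band p N P X.

Definition mulm X Y k l : R[i] := csum (fun j => X k j * Y j l).

Definition commm X Y k l : R[i] := mulm X Y k l - mulm Y X k l.

Lemma wgt_ge1 n : 1 <= wgt n. Proof. by rewrite lerDl. Qed.

Lemma wgt_gt0 n : 0 < wgt n. Proof. exact: lt_le_trans ltr01 (wgt_ge1 n). Qed.

Lemma wgt_ge0 n : 0 <= wgt n. Proof. exact/ltW/wgt_gt0. Qed.

Lemma wgtX_ge0 n p : 0 <= wgt n ^+ p.
Proof. by rewrite exprn_ge0 // ltW // wgt_gt0. Qed.

#[local] Hint Resolve wgt_ge0 wgtX_ge0 nrm_ge0 : core.

Lemma wgtX_ge1 n p : 1 <= wgt n ^+ p.
Proof. by rewrite exprn_ege1 // wgt_ge1. Qed.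

Lemma wgt_le m n : (m <= n)%N -> wgt m <= wgt n.
Proof. by move=> mn; rewrite lerD2l ler_nat. Qed.

Lemma wgtX_le m n p q : (m <= n)%N -> (p <= q)%N -> wgt m ^+ p <= wgt n ^+ q.
Proof.
move=> mn pq; apply: (@le_trans _ _ (wgt n ^+ p)).
  by rewrite lerXn2r ?wgt_le // nnegrE ltW // wgt_gt0.
by rewrite ler_weXn2l // wgt_ge1.
Qed.

(** Peetre's inequality: a weight in [k] is paid for by decay in the distance to [j] and the same
    weight in [j]. *)
Lemma wgt_dist k j : wgt k <= wgt `|k%:Z - j%:Z|%N * wgt j.
Proof.
apply: (@le_trans _ _ (wgt (`|k%:Z - j%:Z| + j))).
  apply: wgt_le; lia.
rewrite /wgt natrD; set x : R := _%:R; set y : R := _%:R.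
have x0 : 0 <= x by rewrite ler0n.
have y0 : 0 <= y by rewrite ler0n.
nra.
Qed.

Lemma wgtX_dist k j N : wgt k ^+ N <= wgt `|k%:Z - j%:Z|%N ^+ N * wgt j ^+ N.
Proof.
rewrite -exprMn lerXn2r ?wgt_dist // nnegrE ?mulr_ge0 //; exact/ltW/wgt_gt0.
Qed.

Lemma wgt_distC k l : wgt `|k%:Z - l%:Z|%N = wgt `|l%:Z - k%:Z|%N.
Proof. by rewrite distnC. Qed.

Lemma zbd_ge0 N e h : zbd N e h -> 0 <= e.
Proof. by move/(_ 0); apply: le_trans; rewrite mulr_ge0 ?wgtX_ge0 ?nrm_ge0. Qed.

Lemma band_ge0 p N P X : band p N P X -> 0 <= P.
Proof.
move/(_ 0%N 0%N); rewrite /wgt minnn addr0 !expr1n mulr1 mul1r.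
by apply: le_trans; rewrite nrm_ge0.
Qed.

Lemma ler_wpM2 (a b x y : R) : 0 <= a -> 0 <= x -> a <= b -> x <= y -> a * x <= b * y.
Proof. by move=> *; apply: ler_pM. Qed.

Lemma zbdW N M e h : (N <= M)%N -> zbd M e h -> zbd N e h.
Proof.
move=> NM hM n; apply: le_trans (hM n).
by rewrite ler_wpM2r ?nrm_ge0 // wgtX_le.
Qed.

Lemma mbdW N M e c : (N <= M)%N -> mbd M e c -> mbd N e c.
Proof.
move=> NM hM k l; apply: le_trans (hM k l).
by rewrite ler_wpM2r ?nrm_ge0 // ler_wpM2 ?wgtX_ge0 // wgtX_le.
Qed.

Lemma bandW p q N M P Q X : (p <= q)%N -> (N <= M)%N -> P <= Q ->
  band p M P X -> band q N Q X.
Proof.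
move=> pq NM PQ hX k l; apply: (@le_trans _ _ (P * wgt (minn k l) ^+ p)).
  apply: le_trans (hX k l); rewrite ler_wpM2r ?nrm_ge0 //.
  exact: wgtX_le.
by rewrite ler_wpM2 ?wgtX_ge0 ?(band_ge0 hX) // wgtX_le.
Qed.

Lemma bandedW p q X : (p <= q)%N -> banded p X -> banded q X.
Proof. by move=> pq hX N; have [P hP] := hX N; exists P; exact: bandW hP. Qed.

Lemma mbdD N e1 e2 X Y : mbd N e1 X -> mbd N e2 Y ->
  mbd N (e1 + e2) (fun k l => X k l + Y k l).
Proof.
move=> h1 h2 k l; apply: le_trans (lerD (h1 k l) (h2 k l)).
by rewrite -mulrDr ler_wpM2l ?mulr_ge0 ?wgtX_ge0 // ler_nrmD.
Qed.

Lemma mbdN N e X : mbd N e X -> mbd N e (fun k l => - X k l).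
Proof. by move=> h k l; rewrite nrmN. Qed.

Lemma mbdZ N e X (a : R[i]) : mbd N e X -> mbd N (nrm a * e) (fun k l => a * X k l).
Proof.
by move=> h k l; rewrite nrmM mulrCA ler_wpM2l ?nrm_ge0 //; exact: h.
Qed.

Lemma mdecayD X Y : mdecay X -> mdecay Y -> mdecay (fun k l => X k l + Y k l).
Proof.
move=> h1 h2 N; have [e1 H1] := h1 N; have [e2 H2] := h2 N.
by exists (e1 + e2); exact: mbdD.
Qed.

Lemma mdecayN X : mdecay X -> mdecay (fun k l => - X k l).
Proof. by move=> h N; have [e H] := h N; exists e; exact: mbdN. Qed.

Lemma bandedD p X Y : banded p X -> banded p Y -> banded p (fun k l => X k l + Y k l).
Proof.
move=> h1 h2 N; have [P H1] := h1 N; have [Q H2] := h2 N.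
exists (P + Q) => k l; rewrite mulrDl; apply: le_trans (lerD (H1 k l) (H2 k l)).
by rewrite -mulrDr ler_wpM2l ?wgtX_ge0 // ler_nrmD.
Qed.

Lemma band_toepm N e f : zbd N e f -> band 0 N e (toepm f).
Proof. by move=> h k l; rewrite expr0 mulr1; exact: h. Qed.

Lemma band_genm N e F : zbd N e F -> band 1 N e (genm F).
Proof.
move=> h k l; rewrite expr1 nrmM nrm_nat mulrA ler_wpM2 //.
  by rewrite mulr_ge0 ?wgtX_ge0 ?nrm_ge0.
by rewrite lerDr.
Qed.

Lemma band_mbd N e c : mbd N e c -> band 0 N e c.
Proof.
move=> h k l; rewrite expr0 mulr1; apply: le_trans (h k l).
rewrite ler_wpM2r ?nrm_ge0 //.
have [kl|/ltnW lk] := leqP k l.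
  apply: (@le_trans _ _ (wgt l ^+ N)); first by apply: wgtX_le => //; lia.
  by rewrite ler_peMl ?wgtX_ge0 // wgtX_ge1.
apply: (@le_trans _ _ (wgt k ^+ N)); first by apply: wgtX_le => //; lia.
by rewrite ler_peMr ?wgtX_ge0 // wgtX_ge1.
Qed.

Lemma banded_toepm f : zdecay f -> banded 0 (toepm f).
Proof. by move=> h N; have [e /band_toepm H] := h N; exists e. Qed.

Lemma banded_genm F : zdecay F -> banded 1 (genm F).
Proof. by move=> h N; have [e /band_genm H] := h N; exists e. Qed.

Lemma banded_mdecay c : mdecay c -> banded 0 c.
Proof. by move=> h N; have [e /band_mbd H] := h N; exists e. Qed.

(** * Products of banded and rapidly decaying matrices *)

Lemma band_row p N P X k : band p N P X ->
  forall j, nrm (X k j) * wgt j ^+ N <= P * wgt k ^+ (p + N).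
Proof.
move=> hX j.
apply: (@le_trans _ _ (wgt `|k%:Z - j%:Z|%N ^+ N * nrm (X k j) * wgt k ^+ N)).
  rewrite mulrAC mulrC ler_wpM2r ?nrm_ge0 //.
  by rewrite wgt_distC wgtX_dist.
rewrite exprD mulrA ler_wpM2r ?wgtX_ge0 //; apply: le_trans (hX k j) _.
by rewrite ler_wpM2l ?(band_ge0 hX) // wgtX_le // geq_minl.
Qed.

Lemma band_col p N P X l : band p N P X ->
  forall j, nrm (X j l) * wgt j ^+ N <= P * wgt l ^+ (p + N).
Proof.
move=> hX j.
apply: (@le_trans _ _ (wgt `|j%:Z - l%:Z|%N ^+ N * nrm (X j l) * wgt l ^+ N)).
  rewrite mulrAC mulrC ler_wpM2r ?nrm_ge0 //.
  by rewrite wgtX_dist.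
rewrite exprD mulrA ler_wpM2r ?wgtX_ge0 //; apply: le_trans (hX j l) _.
by rewrite ler_wpM2l ?(band_ge0 hX) // wgtX_le // geq_minr.
Qed.

(** Two orders of decay along row [k] of [X] suffice, as column [l] of [Y] is bounded. *)
Lemma mulm_cvg p q X Y k l : banded p X -> banded q Y ->
  csums (fun j => X k j * Y j l) (mulm X Y k l).
Proof.
move=> hX hY; have [P hP] := hX 2%N; have [Q hQ] := hY 0%N.
apply: (@csumsP _ _ ((P * wgt k ^+ (p + 2)) * (Q * wgt l ^+ (q + 0)))) => j.
rewrite nrmM mulrAC ler_wpM2 ?mulr_ge0 ?nrm_ge0 ?wgtX_ge0 //.
  exact: band_row.
by have := band_col l hQ j; rewrite expr0 mulr1.
Qed.

Lemma mulmDl p q X Y Z k l : banded p X -> banded p Y -> banded q Z ->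
  mulm (fun k l => X k l + Y k l) Z k l = mulm X Z k l + mulm Y Z k l.
Proof.
move=> hX hY hZ; apply: csumsE.
have -> : (fun j => (X k j + Y k j) * Z j l) =
  fun j => X k j * Z j l + Y k j * Z j l by apply/funext => j; rewrite mulrDl.
by apply: csumsD; apply: mulm_cvg; eassumption.
Qed.

Lemma mulmDr p q X Y Z k l : banded p X -> banded p Y -> banded q Z ->
  mulm Z (fun k l => X k l + Y k l) k l = mulm Z X k l + mulm Z Y k l.
Proof.
move=> hX hY hZ; apply: csumsE.
have -> : (fun j => Z k j * (X j l + Y j l)) =
  fun j => Z k j * X j l + Z k j * Y j l by apply/funext => j; rewrite mulrDr.
by apply: csumsD; apply: mulm_cvg; eassumption.
Qed.

Lemma commmC X Y k l : commm X Y k l = - commm Y X k l.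
Proof. by rewrite /commm opprB. Qed.

Lemma commmDl p q X Y Z k l : banded p X -> banded p Y -> banded q Z ->
  commm (fun k l => X k l + Y k l) Z k l = commm X Z k l + commm Y Z k l.
Proof.
move=> hX hY hZ; rewrite /commm (mulmDl _ _ hX hY hZ) (mulmDr _ _ hX hY hZ).
by rewrite opprD addrACA.
Qed.

Lemma commmDr p q X Y Z k l : banded p X -> banded p Y -> banded q Z ->
  commm Z (fun k l => X k l + Y k l) k l = commm Z X k l + commm Z Y k l.
Proof.
by move=> hX hY hZ; rewrite commmC (commmDl _ _ hX hY hZ) opprD -!commmC.
Qed.

(** Rapidly decaying matrices absorb banded ones. Of the order [N + p + 2], [N] replaces the row
    weight by Peetre's inequality, [p] compensates the growth of [X], and 2 makes the sum
    converge. *)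
Lemma mulm_bdr p N P e X Y : band p N P X -> mbd (N + p + 2) e Y ->
  mbd N (2 * (P * e)) (mulm X Y).
Proof.
move=> hX hY k l; set a := wgt k ^+ N * wgt l ^+ N.
have a0 : 0 < a by rewrite mulr_gt0 ?exprn_gt0 ?wgt_gt0.
rewrite -ler_pdivlMl // mulrCA; apply: csum_le => j; rewrite ler_pdivlMl //.
rewrite nrmM.
apply: (@le_trans _ _ ((wgt `|k%:Z - j%:Z|%N ^+ N * wgt j ^+ N * nrm (X k j)) *
    (wgt l ^+ (N + p + 2) * wgt j ^+ 2 * nrm (Y j l)))).
  rewrite /a [leLHS](_ : _ = (wgt k ^+ N * nrm (X k j)) * (wgt l ^+ N * wgt j ^+ 2 * nrm (Y j l))); last first.
    by rewrite /wgt; ring.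
  rewrite ler_wpM2 ?mulr_ge0 ?wgtX_ge0 ?nrm_ge0 //.
    by rewrite ler_wpM2r ?nrm_ge0 // wgtX_dist.
  by rewrite !ler_wpM2r ?nrm_ge0 ?wgtX_ge0 // wgtX_le // -addnA leq_addr.
apply: (@le_trans _ _ (P * wgt j ^+ p * wgt j ^+ N * (wgt l ^+ (N + p + 2) * wgt j ^+ 2 * nrm (Y j l)))).
  rewrite ler_wpM2r ?mulr_ge0 ?wgtX_ge0 ?nrm_ge0 //.
  rewrite mulrAC ler_wpM2r ?wgtX_ge0 //; apply: le_trans (hX k j) _.
  by rewrite ler_wpM2l ?(band_ge0 hX) // wgtX_le // geq_minr.
have -> : P * wgt j ^+ p * wgt j ^+ N * (wgt l ^+ (N + p + 2) * wgt j ^+ 2 * nrm (Y j l)) =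
   P * (wgt j ^+ (N + p + 2) * wgt l ^+ (N + p + 2) * nrm (Y j l)).
  by rewrite [X in _ = P * (X * _ * _)]exprD [X in _ = P * (X * _ * _ * _)]exprD; ring.
by rewrite ler_wpM2l ?(band_ge0 hX) //; exact: hY.
Qed.

Definition trm X k l : R[i] := X l k.

Lemma trm_mulm X Y k l : mulm X Y k l = mulm (trm Y) (trm X) l k.
Proof. by congr csum; apply/funext => j; rewrite mulrC. Qed.

Lemma band_trm p N P X : band p N P X -> band p N P (trm X).
Proof. by move=> h k l; rewrite wgt_distC minnC; exact: h. Qed.

Lemma mbd_trm N e X : mbd N e X -> mbd N e (trm X).
Proof. by move=> h k l; rewrite [_ ^+ _ * _]mulrC; exact: h. Qed.

(** Both kinds of bound are invariant under transposition, which reverses products. *)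
Lemma mulm_bdl p N P e X Y : band p N P X -> mbd (N + p + 2) e Y ->
  mbd N (2 * (P * e)) (mulm Y X).
Proof.
move=> /band_trm hX /mbd_trm hY k l; rewrite trm_mulm [_ ^+ _ * _]mulrC.
exact: (mulm_bdr hX hY).
Qed.

Lemma commm_bd p N P e X Y : band p N P X -> mbd (N + p + 2) e Y ->
  mbd N (4 * (P * e)) (commm X Y).
Proof.
move=> hX hY.
have -> : 4 * (P * e) = 2 * (P * e) + 2 * (P * e) by ring.
exact: mbdD (mulm_bdr hX hY) (mbdN (mulm_bdl hX hY)).
Qed.

(** * Commutators of Toeplitz matrices *)

(** The commutator is a difference of products of Hankel matrices: one factor sees only [k + i], the
    other only [l + i], so each supplies one of the two weights, and [f] also the weight of order 2
    in [i]. *)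
Lemma nrm_commm_toepm_term N a e g f k l i :
  zbd (N + 2) a g -> zbd (N + 2) e f ->
  wgt k ^+ N * wgt l ^+ N *
   (nrm (g (- (l + i).+1%:Z) * f (k + i).+1%:Z) * wgt i ^+ 2) <= a * e.
Proof.
move=> hg hf; rewrite nrmM.
rewrite [leLHS](_ : _ = (wgt l ^+ N * nrm (g (- (l + i).+1%:Z))) *
   (wgt k ^+ N * wgt i ^+ 2 * nrm (f (k + i).+1%:Z))); last by ring.
apply: ler_wpM2; rewrite ?mulr_ge0 ?wgtX_ge0 ?nrm_ge0 //.
  apply: le_trans (hg (- (l + i).+1%:Z)); rewrite ler_wpM2r ?nrm_ge0 //.
  by rewrite wgtX_le ?leq_addr //; lia.
apply: le_trans (hf (k + i).+1%:Z); rewrite ler_wpM2r ?nrm_ge0 // exprD.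
by rewrite ler_wpM2 ?wgtX_ge0 // wgtX_le //; lia.
Qed.

(* The sum over j <= k + l of the commutator vanishes by the symmetry
   j -> k + l - j, so only the tail j > k + l remains. *)
Lemma commm_toepm_cvg f g k l : zdecay f -> zdecay g ->
  csums (fun i => g (- (l + i).+1%:Z) * f (k + i).+1%:Z -
                  f (- (l + i).+1%:Z) * g (k + i).+1%:Z)
        (commm (toepm g) (toepm f) k l).
Proof.
move=> hf hg; have bf := banded_toepm hf; have bg := banded_toepm hg.
have := csumsB (@mulm_cvg 0 0 _ _ k l bg bf) (@mulm_cvg 0 0 _ _ k l bf bg).
move=> /(csums_drop (k + l).+1); rewrite -/(commm _ _ _ _) sumrB.
have -> : \sum_(0 <= j < (k + l).+1) toepm g k j * toepm f j l =
          \sum_(0 <= j < (k + l).+1) toepm f k j * toepm g j l.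
  rewrite [LHS]big_nat_rev /=; apply: eq_big_nat => j /andP[_ jkl].
  by rewrite mulrC /toepm; congr (f _ * g _); lia.
rewrite subrr subr0; congr csums; apply/funext => j; rewrite /toepm.
congr (g _ * f _ - f _ * g _); lia.
Qed.

Lemma commm_toepm_bd N a e g f : zdecay f -> zdecay g ->
  zbd (N + 2) a g -> zbd (N + 2) e f ->
  mbd N (4 * (a * e)) (commm (toepm g) (toepm f)).
Proof.
move=> rf rg hg hf k l; set b := wgt k ^+ N * wgt l ^+ N.
have b0 : 0 < b by rewrite mulr_gt0 ?exprn_gt0 ?wgt_gt0.
have -> : 4 * (a * e) = 2 * (2 * (a * e)) by ring.
rewrite -ler_pdivlMl // mulrCA.
apply: (csums_le (commm_toepm_cvg rf rg)) => i.
rewrite ler_pdivlMl //.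
apply: (@le_trans _ _ (b * (nrm (g (- (l + i).+1%:Z) * f (k + i).+1%:Z) * wgt i ^+ 2) +
  b * (nrm (f (- (l + i).+1%:Z) * g (k + i).+1%:Z) * wgt i ^+ 2))).
  rewrite -mulrDr; apply: ler_wpM2l; first exact: ltW.
  by rewrite -mulrDl; apply: ler_wpM2r (ler_nrmB _ _); exact: wgtX_ge0.
have -> : 2 * (a * e) = a * e + e * a by ring.
by apply: lerD; exact: nrm_commm_toepm_term.
Qed.

(** * Increments along diagonals *)

(** The entries of [U^* A U - A] for the shift [U]; they vanish exactly when [A] is Toeplitz. *)
Definition diffm A k l : R[i] := A k.+1 l.+1 - A k l.

(** The increments telescope to the limit along the diagonal minus [A k l], whence the sign: this is
    the part of [A] that vanishes at infinity. *)
Definition diag_tail A k l : R[i] := - csum (fun j => diffm A (k + j) (l + j)).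

(** The limit is read off at the first entry of the diagonal, in column 0 for [n >= 0] and in row 0
    for [n < 0]; [Negz n] stands for [- (n + 1)]. *)
Definition diag_limit A (n : int) : R[i] :=
  match n with
  | Posz n => A n 0%N - diag_tail A n 0
  | Negz n => A 0%N n.+1 - diag_tail A 0 n.+1
  end.

Lemma diag_tail_term N e A k l j : mbd (N + 2) e (diffm A) ->
  wgt k ^+ N * wgt l ^+ N * (nrm (diffm A (k + j) (l + j)) * wgt j ^+ 2) <= e.
Proof.
move=> /(_ (k + j)%N (l + j)%N); apply: le_trans.
rewrite [leLHS](_ : _ = (wgt k ^+ N * wgt j ^+ 2) * wgt l ^+ N * nrm (diffm A (k + j) (l + j))); last by ring.
rewrite ler_wpM2r ?nrm_ge0 // ler_wpM2 ?mulr_ge0 ?wgtX_ge0 //.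
  by rewrite exprD ler_wpM2 ?wgtX_ge0 // wgtX_le // ?leq_addr ?leq_addl.
by rewrite wgtX_le // leq_addr.
Qed.

Lemma diag_tail_bd N e A : mbd (N + 2) e (diffm A) -> mbd N (2 * e) (diag_tail A).
Proof.
move=> hA k l; set b := wgt k ^+ N * wgt l ^+ N.
have b0 : 0 < b by rewrite mulr_gt0 ?exprn_gt0 ?wgt_gt0.
rewrite -ler_pdivlMl // mulrCA /diag_tail nrmN; apply: csum_le => j.
by rewrite ler_pdivlMl //; exact: diag_tail_term.
Qed.

Lemma diag_tail_cvg A k l : mdecay (diffm A) ->
  csums (fun j => diffm A (k + j) (l + j)) (- diag_tail A k l).
Proof.
move=> hA; have [e he] := hA 2%N; rewrite opprK; apply: (@csumsP _ _ e) => j.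
by have := @diag_tail_term 0 e A k l j he; rewrite !expr0 !mul1r.
Qed.

Lemma diag_tail_diff A k l : mdecay (diffm A) ->
  diag_tail A k.+1 l.+1 - diag_tail A k l = diffm A k l.
Proof.
move=> hA; have := @diag_tail_cvg A k l hA.
move=> /(csums_drop 1); rewrite big_nat1 !addn0.
have -> : (fun j => diffm A (k + (j + 1)) (l + (j + 1))) =
          fun j => diffm A (k.+1 + j) (l.+1 + j).
  by apply/funext => j; congr diffm; lia.
move=> /(csums_uniq (@diag_tail_cvg A k.+1 l.+1 hA)) h.
by rewrite -[diag_tail A k.+1 l.+1]opprK h; ring.
Qed.

(** [A - diag_tail A] has zero increments, so it keeps along each diagonal the value it has at the
    border. *)
Lemma diag_decomp A : mdecay (diffm A) ->
  forall k l, A k l = diag_limit A (k%:Z - l%:Z) + diag_tail A k l.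
Proof.
move=> hA; have step k l j : A (k + j)%N (l + j)%N - diag_tail A (k + j) (l + j) =
    A k l - diag_tail A k l.
  elim: j => [|j ih]; first by rewrite !addn0.
  rewrite -ih !addnS; have := diag_tail_diff (k + j) (l + j) hA.
  rewrite /diffm => h; apply/eqP; rewrite -subr_eq0; apply/eqP.
  move/eqP: h; rewrite -subr_eq0 => /eqP h.
  by rewrite -[RHS]oppr0 -[X in _ = - X]h; ring.
move=> k l; apply/eqP; rewrite -subr_eq; apply/eqP.
have [lk|kl] := leqP l k.
  have -> : k%:Z - l%:Z = Posz (k - l) by lia.
  by have := step (k - l)%N 0%N l; rewrite subnK // add0n.
have -> : k%:Z - l%:Z = Negz (l - k).-1 by lia.
by have := step 0%N (l - k)%N k; rewrite add0n subnK 1?ltnW //= prednK // subn_gt0.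
Qed.

(** Decay across the diagonals is inherited from the border row and column, where the limits differ
    from [A] only by the rapidly decaying tail. *)
Lemma diag_limit_bd N a e A : mbd (N + 2) e (diffm A) ->
  (forall k, wgt k ^+ N * nrm (A k 0%N) <= a) ->
  (forall l, wgt l ^+ N * nrm (A 0%N l) <= a) ->
  zbd N (a + 2 * e) (diag_limit A).
Proof.
move=> /diag_tail_bd ht h1 h2 [n|n] /=.
  apply: (@le_trans _ _ (wgt n ^+ N * nrm (A n 0%N) + wgt n ^+ N * nrm (diag_tail A n 0))).
    by rewrite -mulrDr ler_wpM2l ?wgtX_ge0 // ler_nrmB.
  apply: lerD => //; have := ht n 0%N.
  by rewrite {2}/wgt addr0 expr1n mulr1.
apply: (@le_trans _ _ (wgt n.+1 ^+ N * nrm (A 0%N n.+1) + wgt n.+1 ^+ N * nrm (diag_tail A 0 n.+1))).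
  by rewrite -mulrDr ler_wpM2l ?wgtX_ge0 // ler_nrmB.
apply: lerD => //; have := ht 0%N n.+1.
by rewrite {1}/wgt addr0 expr1n mul1r.
Qed.

(** * Commutators with the generator *)

(** One step down a diagonal adds [F_(k-l)] to [genm F] and nothing to a Toeplitz matrix, so the
    increment of each product is a product of Toeplitz matrices. *)
Lemma diffm_commm_genm F f k l : zdecay F -> zdecay f ->
  diffm (commm (genm F) (toepm f)) k l = commm (toepm F) (toepm f) k l.
Proof.
move=> hF hf.
have bF := banded_genm hF; have bf := banded_toepm hf; have bT := banded_toepm hF.
(* The product at [(k+1, l+1)] has one extra term, [j = 0], which vanishes because [genm] is zero on
   its border. *)
have key : forall X Y : nat -> nat -> R[i], forall u s,
   (forall j, X k.+1 j.+1 * Y j.+1 l.+1 = X k j * Y j l + u j) ->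
   X k.+1 0%N * Y 0%N l.+1 = 0 ->
   csums (fun j => X k.+1 j * Y j l.+1) (mulm X Y k.+1 l.+1) ->
   csums (fun j => X k j * Y j l) (mulm X Y k l) ->
   csums u s -> mulm X Y k.+1 l.+1 - mulm X Y k l = s.
  move=> X Y u s hu h0 /(csums_drop 1); rewrite big_nat1 h0 subr0.
  have -> : (fun j => X k.+1 (j + 1)%N * Y (j + 1)%N l.+1) =
    fun j => X k j * Y j l + u j by apply/funext => j; rewrite addn1 hu.
  move=> c1 c2 c3; rewrite (csums_uniq c1 (csumsD c2 c3)).
  by rewrite addrC addKr.
have E (g : int -> R[i]) (i j : nat) : g (i.+1%:Z - j.+1%:Z) = g (i%:Z - j%:Z).
  by congr g; lia.
have k1 : mulm (genm F) (toepm f) k.+1 l.+1 - mulm (genm F) (toepm f) k l =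
          mulm (toepm F) (toepm f) k l.
  apply: (key _ _ _ _ _ _ (mulm_cvg bF bf) (mulm_cvg bF bf) (mulm_cvg bT bf)).
    move=> j; rewrite /genm /toepm !E minnSS -natr1; ring.
  by rewrite /genm minn0 mulr0 mul0r.
have k2 : mulm (toepm f) (genm F) k.+1 l.+1 - mulm (toepm f) (genm F) k l =
          mulm (toepm f) (toepm F) k l.
  apply: (key _ _ _ _ _ _ (mulm_cvg bf bF) (mulm_cvg bf bF) (mulm_cvg bf bT)).
    move=> j; rewrite /genm /toepm !E minnSS -natr1; ring.
  by rewrite /genm min0n mulr0 mulr0.
by rewrite /diffm /commm -k1 -k2; ring.
Qed.

(** Order [N + 3]: [N] for the row weight, one for the linear growth of [genm], two for
    summation. *)
Lemma mulm_genm_col0 N P e F f k : band 1 N P (genm F) -> zbd (N + 3) e f ->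
  wgt k ^+ N * nrm (mulm (genm F) (toepm f) k 0) <= 2 * (P * e).
Proof.
move=> hF hf; have a0 : 0 < wgt k ^+ N by rewrite exprn_gt0 ?wgt_gt0.
rewrite -ler_pdivlMl // mulrCA; apply: csum_le => j; rewrite ler_pdivlMl // nrmM.
apply: (@le_trans _ _ ((wgt `|k%:Z - j%:Z|%N ^+ N * nrm (genm F k j)) *
   (wgt j ^+ N * wgt j ^+ 2 * nrm (toepm f j 0)))).
  rewrite [leRHS](_ : _ = (wgt `|k%:Z - j%:Z|%N ^+ N * wgt j ^+ N) *
     (nrm (genm F k j) * nrm (toepm f j 0) * wgt j ^+ 2)); last by ring.
  by rewrite ler_wpM2r ?mulr_ge0 ?nrm_ge0 ?wgtX_ge0 // wgtX_dist.
apply: (@le_trans _ _ ((P * wgt j ^+ 1) * (wgt j ^+ N * wgt j ^+ 2 * nrm (toepm f j 0)))).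
  rewrite ler_wpM2r ?mulr_ge0 ?nrm_ge0 ?wgtX_ge0 //; apply: le_trans (hF k j) _.
  by rewrite ler_wpM2l ?(band_ge0 hF) // wgtX_le // geq_minr.
rewrite -mulrA ler_wpM2l ?(band_ge0 hF) //.
have -> : wgt j ^+ 1 * (wgt j ^+ N * wgt j ^+ 2 * nrm (toepm f j 0)) =
   wgt j ^+ (N + 3) * nrm (toepm f j 0) by rewrite exprD; ring.
by apply: le_trans (hf j%:Z); rewrite /toepm subr0.
Qed.

(** Only one of the two products contributes, because column 0 of [genm] is zero. *)
Lemma commm_genm_col0 N P e F f k : band 1 N P (genm F) -> zbd (N + 3) e f ->
  wgt k ^+ N * nrm (commm (genm F) (toepm f) k 0) <= 2 * (P * e).
Proof.
move=> hF hf; rewrite /commm.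
have -> : mulm (toepm f) (genm F) k 0 = 0.
  apply: csumsE; rewrite (_ : (fun j => _) = fun=> 0); first exact: csums0.
  by apply/funext => j; rewrite /genm minn0 !mulr0.
by rewrite subr0; exact: mulm_genm_col0.
Qed.

(** Transposition reflects both symbols and turns the row into a column. *)
Lemma commm_genm_row0 N P e F f l : band 1 N P (genm F) -> zbd (N + 3) e f ->
  wgt l ^+ N * nrm (commm (genm F) (toepm f) 0 l) <= 2 * (P * e).
Proof.
move=> /band_trm hF hf; rewrite /commm.
have -> : mulm (genm F) (toepm f) 0 l = 0.
  apply: csumsE; rewrite (_ : (fun j => _) = fun=> 0); first exact: csums0.
  by apply/funext => j; rewrite /genm min0n mulr0 mul0r.
rewrite sub0r nrmN trm_mulm.
have -> : trm (genm F) = genm (fun n => F (- n)).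
  by apply/funext => k; apply/funext => j; rewrite /trm /genm opprB minnC.
have -> : trm (toepm f) = toepm (fun n => f (- n)).
  by apply/funext => k; apply/funext => j; rewrite /trm /toepm opprB.
apply: mulm_genm_col0.
  have -> : genm (fun n => F (- n)) = trm (genm F) => //.
  by apply/funext => k; apply/funext => j; rewrite /trm /genm opprB minnC.
by move=> n; rewrite -abszN; exact: hf.
Qed.

(** The increments cost two orders as a commutator of Toeplitz matrices, and summing them costs two
    more, hence [N + 4]. The constants are [8 = 2 * 4] for the tail and [10 = 2 + 8] for the limits,
    the 2 coming from the border. *)
Lemma commm_genm_toepm F f : zdecay F -> zdecay f ->
  exists h c, [/\ zdecay h, mdecay c,
    forall k l, commm (genm F) (toepm f) k l = toepm h k l + c k l &
    forall N a e, zbd (N + 4) a F -> zbd (N + 4) e f ->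
      zbd N (10 * (a * e)) h /\ mbd N (8 * (a * e)) c].
Proof.
move=> hF hf; set A := commm (genm F) (toepm f).
have dA : diffm A = commm (toepm F) (toepm f).
  by apply/funext => k; apply/funext => l; exact: diffm_commm_genm.
have bdA N a e : zbd (N + 4) a F -> zbd (N + 4) e f ->
    zbd N (10 * (a * e)) (diag_limit A) /\ mbd N (8 * (a * e)) (diag_tail A).
  move=> HF Hf; have hd : mbd (N + 2) (4 * (a * e)) (diffm A).
    by rewrite dA; apply: commm_toepm_bd => //; rewrite -addnA.
  split; last first.
    by have := diag_tail_bd hd; congr (mbd _ _ _); ring.
  have bF : band 1 N a (genm F) by apply: band_genm; apply: zbdW HF; rewrite leq_addr.
  have Hf' : zbd (N + 3) e f by apply: zbdW Hf; rewrite leq_add2l.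
  have -> : 10 * (a * e) = 2 * (a * e) + 2 * (4 * (a * e)) by ring.
  apply: diag_limit_bd => // k.
    exact: commm_genm_col0.
  exact: commm_genm_row0.
exists (diag_limit A), (diag_tail A); split=> //.
- move=> N; have [a Ha] := hF (N + 4)%N; have [e He] := hf (N + 4)%N.
  by exists (10 * (a * e)); have [] := bdA _ _ _ Ha He.
- move=> N; have [a Ha] := hF (N + 4)%N; have [e He] := hf (N + 4)%N.
  by exists (8 * (a * e)); have [] := bdA _ _ _ Ha He.
apply: diag_decomp => N; have [a Ha] := hF (N + 2)%N; have [e He] := hf (N + 2)%N.
by exists (4 * (a * e)); rewrite dA; exact: commm_toepm_bd.
Qed.

(** The rapidly decaying part of the operand goes entirely into [d] and adds 4 to the constant 8 of
    the Toeplitz part. *)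
Lemma commm_genm F f c : zdecay F -> zdecay f -> mdecay c ->
  exists h d, [/\ zdecay h, mdecay d,
    forall k l, commm (genm F) (fun k l => toepm f k l + c k l) k l =
                toepm h k l + d k l &
    forall N a e, zbd (N + 4) a F -> zbd (N + 4) e f -> mbd (N + 4) e c ->
      zbd N (10 * (a * e)) h /\ mbd N (12 * (a * e)) d].
Proof.
move=> hF hf hc; have [h [d [rh rd hd bd]]] := commm_genm_toepm hF hf.
have bdc N a e : zbd (N + 4) a F -> mbd (N + 4) e c ->
    mbd N (4 * (a * e)) (commm (genm F) c).
  move=> HF Hc; apply: (@commm_bd 1).
    by apply: band_genm; apply: zbdW HF; rewrite leq_addr.
  by apply: mbdW Hc; rewrite -addnA leq_add2l.
exists h, (fun k l => d k l + commm (genm F) c k l); split=> //.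
- apply: mdecayD => // N; have [a Ha] := hF (N + 4)%N.
  by have [e He] := hc (N + 4)%N; exists (4 * (a * e)); exact: bdc.
- move=> k l; rewrite (commmDr _ _ (banded_toepm hf) (banded_mdecay hc) (banded_genm hF)).
  by rewrite hd /= -addrA.
move=> N a e Ha He Hc; have [H1 H2] := bd _ _ _ Ha He; split=> //.
have -> : 12 * (a * e) = 8 * (a * e) + 4 * (a * e) by ring.
by apply: mbdD => //; exact: bdc.
Qed.

(** Toeplitz matrices commute modulo rapid decay, so no Toeplitz part survives; this is why the
    inner part takes compact values. Four commutators of constant 4 make 16. *)
Lemma commm_toepm_bounded g y f c : zdecay g -> mdecay y -> zdecay f -> mdecay c ->
  forall N a e, zbd (N + 2) a g -> mbd (N + 2) a y ->
    zbd (N + 2) e f -> mbd (N + 2) e c ->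
    mbd N (16 * (a * e)) (commm (fun k l => toepm g k l + y k l)
                                (fun k l => toepm f k l + c k l)).
Proof.
move=> rg ry rf rc N a e hg hy hf hc.
have b1 : banded 0 (fun k l => toepm f k l + c k l).
  by apply: bandedD; [exact: banded_toepm|exact: banded_mdecay].
have -> : commm (fun k l => toepm g k l + y k l) (fun k l => toepm f k l + c k l) =
  fun k l => (commm (toepm g) (toepm f) k l + commm (toepm g) c k l) +
   (- commm (toepm f) y k l + commm y c k l).
  apply/funext => k; apply/funext => l.
  rewrite (commmDl _ _ (banded_toepm rg) (banded_mdecay ry) b1).
  rewrite (commmDr _ _ (banded_toepm rf) (banded_mdecay rc) (banded_toepm rg)).
  rewrite (commmDr _ _ (banded_toepm rf) (banded_mdecay rc) (banded_mdecay ry)).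
  by rewrite (commmC (toepm f)) opprK.
have -> : 16 * (a * e) = (4 * (a * e) + 4 * (a * e)) + (4 * (e * a) + 4 * (a * e)) by ring.
have hW (h : int -> R[i]) x : zbd (N + 2) x h -> band 0 N x (toepm h).
  by move=> hh; apply/band_toepm; apply: zbdW hh; rewrite leq_addr.
apply: mbdD; apply: mbdD.
- exact: commm_toepm_bd.
- by apply: (@commm_bd 0); rewrite ?addn0 //; exact: hW.
- by apply: mbdN; apply: (@commm_bd 0); rewrite ?addn0 //; exact: hW.
- apply: (@commm_bd 0); rewrite ?addn0 //.
  by apply: band_mbd; apply: mbdW hy; rewrite leq_addr.
Qed.

End Matrices.

(** * Smooth functions on the circle and their Fourier coefficients *)

Section CircleAnalysis.
Variable R : realType.
Implicit Types (f F u v : R -> R[i]) (p q : R -> R) (h : int -> R[i]).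
Local Notation mu := (@lebesgue_measure R).

Definition int01 p : R := \int[mu]_(x in `[0, 1]) p x.

Lemma integrable01 p : continuous p -> mu.-integrable `[0, 1] (EFin \o p).
Proof.
move=> cp; apply: continuous_compact_integrable; first exact: segment_compact.
exact: continuous_subspaceT.
Qed.

Lemma int01D p q : continuous p -> continuous q ->
  int01 (fun x => p x + q x) = int01 p + int01 q.
Proof. by move=> cp cq; rewrite /int01 RintegralD //; exact: integrable01. Qed.

Lemma int01Z (r : R) p : continuous p -> int01 (fun x => r * p x) = r * int01 p.
Proof. by move=> cp; rewrite /int01 RintegralZl //; exact: integrable01. Qed.

Lemma int01_cst (r : R) : int01 (fun=> r) = r.
Proof.
rewrite /int01 Rintegral_cst //=.
by rewrite lebesgue_measure_itv /= lte_fin ltr01 oppr0 adde0 mulr1.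
Qed.

Lemma continuous_cst (r : R) : continuous (fun _ : R => r : R).
Proof. by move=> x; exact: cvg_cst. Qed.

Lemma int01_mono p q : continuous p -> continuous q -> (forall x, p x <= q x) ->
  int01 p <= int01 q.
Proof.
by move=> cp cq h; apply: le_Rintegral => //; exact: integrable01.
Qed.

Lemma int01_le p (B : R) : continuous p -> (forall x, `|p x| <= B) -> `|int01 p| <= B.
Proof.
move=> cp h; rewrite ler_norml.
have h1 x : - B <= p x by have := h x; rewrite ler_norml => /andP[].
have h2 x : p x <= B by have := h x; rewrite ler_norml => /andP[].
have := int01_mono (continuous_cst (r := - B)) cp h1.
have := int01_mono cp (continuous_cst (r := B)) h2.
by rewrite !int01_cst => -> ->.
Qed.

Lemma derive_continuous p q : (forall x : R, is_derive x 1 p (q x)) -> continuous p.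
Proof.
move=> hp x; apply/differentiable_continuous/derivable1_diffP.
by have := hp x => -[].
Qed.

Lemma int01_FTC p q : (forall x : R, is_derive x 1 p (q x)) -> continuous q ->
  int01 q = p 1 - p 0.
Proof.
move=> hp cq; rewrite /int01 /Rintegral (@continuous_FTC2 _ q p) //.
- exact: continuous_subspaceT.
- have cp := derive_continuous hp; split.
  + by move=> x _; have := hp x => -[].
  + by apply: cvg_at_right_filter; exact: cp.
  + by apply: cvg_at_left_filter; exact: cp.
- by move=> x _; rewrite derive1E; apply: derive_val.
Qed.

Definition cis (t : R) : R[i] := cos t +i* sin t.

Lemma cisD a b : cis (a + b) = cis a * cis b.
Proof.
rewrite /cis cosD sinD; apply/eqP; rewrite eq_complex /= eqxx.
by rewrite addrC eqxx.
Qed.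

Lemma nrm_cis a : nrm (cis a) = 1.
Proof. by rewrite /nrm normc_def /= cos2Dsin2 sqrtr1. Qed.

Lemma cis0 : cis 0 = 1.
Proof. by rewrite /cis cos0 sin0. Qed.

Lemma cexp2piE n x : cexp2pi n x = cis (2 * pi * n%:~R * x).
Proof. by []. Qed.

Lemma cis_2piz (n : int) : cis (2 * pi * n%:~R : R) = 1.
Proof.
have nat_case (m : nat) : cis (2 * pi * m%:R : R) = 1.
  rewrite /cis; have e : 2 * pi * m%:R = 0 + (pi *+ 2) *+ m :> R.
    by rewrite add0r -[RHS]mulr_natr -[pi *+ 2]mulr_natr; ring.
  have c := periodicn (@cosD2pi R) m 0; have s := periodicn (@sinD2pi R) m 0.
  by rewrite e c s cos0 sin0.
case: n => n; first exact: nat_case.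
have /eqP := nat_case n.+1; rewrite eq_complex /= => /andP[/eqP h1 /eqP h2].
by rewrite NegzE /cis mulrNz mulrN cosN sinN h1 h2 oppr0.
Qed.

Lemma cexp2pi_periodic n (x : R) : cexp2pi n (x + 1) = cexp2pi n x.
Proof. by rewrite !cexp2piE mulrDr mulr1 cisD cis_2piz mulr1. Qed.

(** Continuity and integrals are taken componentwise, so that the calculus of real functions
    applies. *)
Definition ccont u := continuous (fun x => complex.Re (u x)) /\
                      continuous (fun x => complex.Im (u x)).

Definition cint u : R[i] :=
  int01 (fun x => complex.Re (u x)) +i* int01 (fun x => complex.Im (u x)).

Lemma fourierE f n : fourier f n = cint (fun x => f x * cexp2pi (- n) x).
Proof. by []. Qed.

Lemma cReD (a b : R[i]) : complex.Re (a + b) = complex.Re a + complex.Re b.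
Proof. by case: a b => ? ? []. Qed.

Lemma cImD (a b : R[i]) : complex.Im (a + b) = complex.Im a + complex.Im b.
Proof. by case: a b => ? ? []. Qed.

Lemma cReM (a b : R[i]) : complex.Re (a * b) =
  complex.Re a * complex.Re b - complex.Im a * complex.Im b.
Proof. by case: a b => ? ? []. Qed.

Lemma cImM (a b : R[i]) : complex.Im (a * b) =
  complex.Re a * complex.Im b + complex.Im a * complex.Re b.
Proof. by case: a b => ? ? []. Qed.

Lemma ccontD u v : ccont u -> ccont v -> ccont (fun x => u x + v x).
Proof.
move=> [u1 u2] [v1 v2]; split=> x.
  under eq_fun do rewrite cReD; exact: cvgD (u1 x) (v1 x).
under eq_fun do rewrite cImD; exact: cvgD (u2 x) (v2 x).
Qed.

Lemma ccontM u v : ccont u -> ccont v -> ccont (fun x => u x * v x).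
Proof.
move=> [u1 u2] [v1 v2]; split=> x.
  under eq_fun do rewrite cReM.
  exact: cvgB (cvgM (u1 x) (v1 x)) (cvgM (u2 x) (v2 x)).
under eq_fun do rewrite cImM.
exact: cvgD (cvgM (u1 x) (v2 x)) (cvgM (u2 x) (v1 x)).
Qed.

Lemma ccont_cst (z : R[i]) : ccont (fun=> z).
Proof. by split; exact: continuous_cst. Qed.

Lemma continuous_lin (l : R) : continuous (fun x : R => l * x).
Proof. by move=> x; exact: cvgM (cvg_cst _) cvg_id. Qed.

Lemma ccont_cis (l : R) : ccont (fun x => cis (l * x)).
Proof.
split=> x /=.
  apply: (@continuous_comp _ _ _ (fun x => l * x) cos); first exact: continuous_lin.
  exact: continuous_cos.
apply: (@continuous_comp _ _ _ (fun x => l * x) sin); first exact: continuous_lin.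
exact: continuous_sin.
Qed.

Lemma cintD u v : ccont u -> ccont v -> cint (fun x => u x + v x) = cint u + cint v.
Proof.
move=> [u1 u2] [v1 v2]; rewrite /cint.
have -> : (fun x => complex.Re (u x + v x)) =
  fun x => complex.Re (u x) + complex.Re (v x) by apply/funext => x; exact: cReD.
have -> : (fun x => complex.Im (u x + v x)) =
  fun x => complex.Im (u x) + complex.Im (v x) by apply/funext => x; exact: cImD.
by rewrite !int01D.
Qed.

Lemma cintZ (z : R[i]) u : ccont u -> cint (fun x => z * u x) = z * cint u.
Proof.
move=> [u1 u2]; rewrite /cint.
have k (r : R) p : continuous p -> continuous (fun x => r * p x).
  by move=> cp x; exact: cvgM (cvg_cst _) (cp x).
have -> : (fun x => complex.Re (z * u x)) =
  fun x => complex.Re z * complex.Re (u x) + (- complex.Im z) * complex.Im (u x).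
  by apply/funext => x; rewrite cReM mulNr.
have -> : (fun x => complex.Im (z * u x)) =
  fun x => complex.Re z * complex.Im (u x) + complex.Im z * complex.Re (u x).
  by apply/funext => x; rewrite cImM.
rewrite !int01D ?int01Z //; try exact: k.
by case: z => a b; apply/eqP; rewrite eq_complex /= mulNr !eqxx.
Qed.

(** The factor 2 comes from bounding the two components separately. *)
Lemma cint_le u (B : R) : ccont u -> (forall x, nrm (u x) <= B) -> nrm (cint u) <= 2 * B.
Proof.
move=> [u1 u2] h; apply: le_trans (nrm_le_ReIm _) _.
rewrite (_ : 2 * B = B + B); last by ring.
apply: lerD; apply: int01_le => // x; apply: le_trans (h x).
  exact: Re_le_nrm.
exact: Im_le_nrm.
Qed.

Lemma ccont_sum (w : nat -> R -> R[i]) n : (forall j, ccont (w j)) ->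
  ccont (fun x => \sum_(0 <= j < n) w j x).
Proof.
move=> hw; elim: n => [|n ih].
  by under eq_fun do rewrite big_geq //; exact: ccont_cst.
under eq_fun do rewrite big_nat_recr //=; exact: ccontD.
Qed.

Lemma cint_sum (w : nat -> R -> R[i]) n : (forall j, ccont (w j)) ->
  cint (fun x => \sum_(0 <= j < n) w j x) = \sum_(0 <= j < n) cint (w j).
Proof.
move=> hw; elim: n => [|n ih].
  rewrite big_geq //; under eq_fun do rewrite big_geq //.
  by rewrite /cint /= !int01_cst.
rewrite big_nat_recr //= -ih -cintD //; last exact: ccont_sum.
by under eq_fun do rewrite big_nat_recr //=.
Qed.

Lemma is_derive_lin (l x : R) : is_derive x 1 (fun x : R => l * x) l.
Proof.
have := @is_deriveZ _ R^o R^o (@id R) l x 1 1 (is_derive_id x 1).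
by rewrite /GRing.scale /= mulr1.
Qed.

Lemma is_derive_cosl (l x : R) :
  is_derive x 1 (fun x : R => cos (l * x)) (- l * sin (l * x)).
Proof.
rewrite mulNr -mulrN mulrC.
exact: (@is_derive1_comp _ cos (fun x => l * x) x _ _ (is_derive_cos _) (is_derive_lin l x)).
Qed.

Lemma is_derive_sinl (l x : R) :
  is_derive x 1 (fun x : R => sin (l * x)) (l * cos (l * x)).
Proof.
rewrite mulrC.
exact: (@is_derive1_comp _ sin (fun x => l * x) x _ _ (is_derive_sin _) (is_derive_lin l x)).
Qed.

(** For nonzero [n] both components are, up to a nonzero factor, derivatives of functions with equal
    values at 0 and 1. *)
Lemma cint_cexp2pi n : cint (cexp2pi n) = (n == 0)%:R :> R[i].
Proof.
have [->|n0] := eqVneq n 0.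
  have -> : cexp2pi 0 = (fun=> 1 : R[i]).
    by apply/funext => x; rewrite cexp2piE mulr0 mul0r cis0.
  by rewrite /cint /= !int01_cst.
set l : R := 2 * pi * n%:~R.
have l0 : l != 0.
  by rewrite mulf_neq0 ?intr_eq0 // mulf_neq0 ?pnatr_eq0 // gt_eqF // pi_gt0.
have c1 : continuous (fun x : R => cos (l * x)) := (ccont_cis l).1.
have c2 : continuous (fun x : R => sin (l * x)) := (ccont_cis l).2.
have := cis_2piz n; rewrite -/l => /eqP.
rewrite eq_complex /= => /andP[/eqP e1 /eqP e2].
have k1 : int01 (fun x => l * cos (l * x)) = 0.
  rewrite (int01_FTC (is_derive_sinl l)); last first.
    by move=> x; exact: cvgM (cvg_cst _) (c1 x).
  by rewrite mulr1 mulr0 sin0 e2 subr0.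
have k2 : int01 (fun x => - l * sin (l * x)) = 0.
  rewrite (int01_FTC (is_derive_cosl l)); last first.
    by move=> x; exact: cvgM (cvg_cst _) (c2 x).
  by rewrite mulr1 mulr0 cos0 e1 subrr.
move: k1 k2; rewrite !int01Z // => /eqP; rewrite mulf_eq0 (negPf l0) /= => /eqP k1.
move=> /eqP; rewrite mulf_eq0 oppr_eq0 (negPf l0) /= => /eqP k2.
by rewrite /cint /= -/l k1 k2.
Qed.

Lemma ccont_cexp2pi n : ccont (cexp2pi n).
Proof. exact: ccont_cis. Qed.

Lemma cexp2piM n m (x : R) : cexp2pi n x * cexp2pi m x = cexp2pi (n + m) x.
Proof. by rewrite !cexp2piE -cisD; congr cis; rewrite rmorphD /=; ring. Qed.

Lemma fourierD f F n : ccont f -> ccont F ->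
  fourier (fun x => f x + F x) n = fourier f n + fourier F n.
Proof.
move=> cf cF; rewrite !fourierE -cintD; last 2 first.
  by apply: ccontM => //; exact: ccont_cexp2pi.
  by apply: ccontM => //; exact: ccont_cexp2pi.
by under eq_fun do rewrite mulrDl.
Qed.

(** * Trigonometric series *)

(** The enumeration [nu] of frequencies allows a single treatment of the halves [n >= 0] and
    [n < 0]. *)
Definition trigsum (nu : nat -> int) (z : nat -> R[i]) (x : R) : R[i] :=
  csum (fun j => z j * cexp2pi (nu j) x).

Section TrigSum.
Variables (nu : nat -> int).

Lemma trig_term z (A : R) x : (forall j, nrm (z j) * (1 + j%:R) ^+ 2 <= A) ->
  forall j, nrm (z j * cexp2pi (nu j) x) * (1 + j%:R) ^+ 2 <= A.
Proof. by move=> hA j; rewrite nrmM nrm_cis mulr1; exact: hA. Qed.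

Lemma trigsum_le z (A : R) x : (forall j, nrm (z j) * (1 + j%:R) ^+ 2 <= A) ->
  nrm (trigsum nu z x) <= 2 * A.
Proof. by move=> /trig_term h; exact: csum_le. Qed.

(** The bound is uniform in [x], which allows integration term by term. *)
Lemma trigsum_tail z (A : R) x N : (forall j, nrm (z j) * (1 + j%:R) ^+ 2 <= A) ->
  nrm (trigsum nu z x - \sum_(0 <= j < N) z j * cexp2pi (nu j) x) <=
  2 * A * (1 + N%:R)^-1.
Proof.
move=> /trig_term h; have /cvg_nrmP hc := csumsP (h x).
apply/ler_addgt0Pr => e e0.
have [n [h1 h2]] := @filter_ex _ _ _ _ (filterI (hc e e0) (nbhs_infty_ge N)).
set s := series _ n in h1.
have -> : trigsum nu z x - \sum_(0 <= j < N) z j * cexp2pi (nu j) x =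
   (trigsum nu z x - s) + \sum_(N <= j < n) z j * cexp2pi (nu j) x.
  rewrite /s /series /= (@big_cat_nat _ _ _ N 0 n) //=; ring.
apply: le_trans (ler_nrmD _ _) _; rewrite addrC lerD //; last exact: ltW.
exact: (@nrm_sum_le R R[i]^o _ _ _ _ (h x)).
Qed.


Lemma trigsum_fourier z (A : R) m : (forall j, nrm (z j) * (1 + j%:R) ^+ 2 <= A) ->
  ccont (trigsum nu z) ->
  csums (fun j => z j * (nu j == m)%:R) (fourier (trigsum nu z) m).
Proof.
move=> hA hc; have h := trig_term _ hA.
have A0 : 0 <= A.
  by apply: le_trans (hA 0%N); rewrite mulr_ge0 ?nrm_ge0 // exprn_ge0 // addr_ge0.
have hw j : ccont (fun x => z j * cexp2pi (nu j) x).
  by apply: ccontM; [exact: ccont_cst|exact: ccont_cexp2pi].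
have term j : cint (fun x => z j * cexp2pi (nu j) x * cexp2pi (- m) x) = z j * (nu j == m)%:R.
  under eq_fun do rewrite -mulrA cexp2piM.
  by rewrite cintZ ?cint_cexp2pi ?subr_eq0 //; exact: ccont_cexp2pi.
apply/cvg_nrmP => e e0.
(* The 4 is the 2 of the tail estimate times the 2 of [cint_le]. *)
have hN := nbhs_infty_ge (Num.truncn (4 * A / e)).+1.
apply: filterS hN => N /= hN.
have -> : series (fun j => z j * (nu j == m)%:R) N =
   cint (fun x => (\sum_(0 <= j < N) z j * cexp2pi (nu j) x) * cexp2pi (- m) x).
  rewrite /series /=; under eq_bigr do rewrite -term.
  rewrite -cint_sum.
    by congr cint; apply/funext => x; rewrite mulr_suml.
  by move=> j; apply: ccontM => //; exact: ccont_cexp2pi.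
rewrite fourierE -[X in _ + X]mulN1r -cintZ; last first.
  by apply: ccontM; [exact: ccont_sum|exact: ccont_cexp2pi].
rewrite -cintD; last 2 first.
- by apply: ccontM => //; exact: ccont_cexp2pi.
- apply: ccontM; first exact: ccont_cst.
  by apply: ccontM; [exact: ccont_sum|exact: ccont_cexp2pi].
apply: le_lt_trans (@cint_le _ (2 * A * (1 + N%:R)^-1) _ _) _.
- apply: ccontD; first by apply: ccontM => //; exact: ccont_cexp2pi.
  apply: ccontM; first exact: ccont_cst.
  by apply: ccontM; [exact: ccont_sum|exact: ccont_cexp2pi].
- move=> x; rewrite mulN1r -mulrBl nrmM nrm_cis mulr1.
  exact: trigsum_tail.
rewrite !mulrA -natrM ltr_pdivrMr ?ltr_pwDl // [e * _]mulrC -ltr_pdivrMr //.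
apply: lt_le_trans (truncnS_gt _) _.
by apply: (@le_trans _ _ N%:R); rewrite ?ler_nat // lerDr.
Qed.

End TrigSum.
End CircleAnalysis.

(** * Termwise differentiation *)

Section TrigDerivative.
Variable R : realType.
Implicit Types (g : R -> R) (z : nat -> R[i]) (nu : nat -> int).

Lemma mvt_increment g g' (a s : R) : (forall x : R, is_derive x 1 g (g' x)) ->
  exists2 c, `|c| <= `|s| & g (a + s) - g a = g' (a + c) * s.
Proof.
move=> hg; have cg := derive_continuous hg.
have [s0|s0|->] := ltgtP s 0; last first.
- by exists 0; rewrite ?addr0 ?subrr ?mulr0.
- have as' : a < a + s by rewrite ltrDl.
  have [c] := MVT as' (fun x _ => hg x) (continuous_subspaceT cg).
  rewrite in_itv /= => /andP[h1 h2] e; exists (c - a).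
    by rewrite !gtr0_norm ?subr_gt0 // lerBlDl ltW.
  by rewrite e subrKC addrC addKr.
- have as' : a + s < a by rewrite gtrDl.
  have [c] := MVT as' (fun x _ => hg x) (continuous_subspaceT cg).
  rewrite in_itv /= => /andP[h1 h2] e; exists (c - a).
    rewrite !ltr0_norm ?subr_lt0 //; lra.
  by rewrite -opprB e subrKC -mulrN; congr (_ * _); ring.
Qed.

(** Two applications of the mean value theorem, the intermediate increment [c] satisfying
    [|c| <= |s|], give the constant 1 in place of 1/2. *)
Lemma taylor2 g g' g'' (a s : R) : (forall x : R, is_derive x 1 g (g' x)) ->
  (forall x : R, is_derive x 1 g' (g'' x)) -> (forall x, `|g'' x| <= 1) ->
  `|g (a + s) - g a - g' a * s| <= s ^+ 2.
Proof.
move=> h1 h2 b; have [c cs ->] := mvt_increment a s h1.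
have [d _ e] := mvt_increment a c h2.
rewrite -mulrBl e !normrM -(real_normK (num_real s)) expr2 ler_wpM2r //.
by apply: le_trans cs; rewrite ler_piMl.
Qed.

Lemma cis_taylor (a s : R) :
  nrm (cis (a + s) - cis a - (0 +i* s) * cis a) <= 2 * s ^+ 2.
Proof.
have dc (x : R) : is_derive x 1 (@cos R) (- sin x) by exact: is_derive_cos.
have ds (x : R) : is_derive x 1 (@sin R) (cos x) by exact: is_derive_sin.
have dns (x : R) : is_derive x 1 (fun x => - sin x : R) (- cos x).
  exact: (is_deriveN (ds x)).
apply: le_trans (nrm_le_ReIm _) _ => /=.
rewrite (_ : 2 * s ^+ 2 = s ^+ 2 + s ^+ 2); last by ring.
apply: lerD.
  have := @taylor2 cos (fun x => - sin x) (fun x => - cos x) a s dc dns.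
  rewrite (_ : cos (a + s) - cos a - - sin a * s = cos (a + s) - cos a - (0 * cos a - s * sin a)); last by ring.
  by apply => x; rewrite normrN ler_norml cos_geN1 cos_le1.
have := @taylor2 sin cos (fun x => - sin x) a s ds dc.
rewrite (_ : sin (a + s) - sin a - cos a * s = sin (a + s) - sin a - (0 * sin a + s * cos a)); last by ring.
by apply => x; rewrite normrN ler_norml sin_geN1 sin_le1.
Qed.

Lemma is_derive_of_taylor g (x d K : R) :
  (forall t, `|g (x + t) - g x - t * d| <= K * t ^+ 2) -> is_derive x 1 g d.
Proof.
move=> hK.
have K0 : 0 <= K by have := hK 1; rewrite expr1n mulr1; apply: le_trans.
have hc : (fun t : R => t^-1 *: ((g \o shift x) (t *: (1 : R)) - g x)) @ 0^' --> d.
  apply/cvgrPdist_lt => e e0; near=> t.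
  have t0 : t != 0 by near: t; exact: nbhs_dnbhs_neq.
  (* The denominator is [K + 1] because [K] may be zero. *)
  have te : `|t| < e / (K + 1).
    near: t; apply: dnbhs0_lt; rewrite divr_gt0 //; lra.
  rewrite /= [t *: 1]mulr1 [t + x]addrC distrC.
  have -> : t^-1 *: (g (x + t) - g x) - d = t^-1 * (g (x + t) - g x - t * d).
    by rewrite [RHS]mulrBr mulKf.
  rewrite normrM normfV -ltr_pdivlMl ?invr_gt0 ?normr_gt0 // invrK.
  apply: le_lt_trans (hK t) _; rewrite -real_normK ?num_real // expr2 mulrCA.
  rewrite ltr_pM2l ?normr_gt0 //.
  have K1 : 0 < K + 1 by lra.
  rewrite ltr_pdivlMr // in te.
  apply: le_lt_trans te; rewrite mulrC ler_wpM2l //; lra.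
have hd : derivable g x 1 by apply: cvgP hc.
by split=> //; apply: cvg_lim hc.
Unshelve. all: by end_near. Qed.

Definition sdecay z := forall N, exists A : R, forall j, nrm (z j) * (1 + j%:R) ^+ N <= A.

(** The coefficients [2 pi i nu_j z_j] of the formal derivative. *)
Definition trigder nu z j : R[i] := (0 +i* (2 * pi * (nu j)%:~R)) * z j.

Lemma nrm_imag (a : R) : nrm (0 +i* a : R[i]) = `|a|.
Proof. by rewrite /nrm normc_def /= expr0n add0r sqrtr_sqr. Qed.

Lemma nrm_trigder nu z j : (`|nu j| <= j.+1)%N ->
  nrm (trigder nu z j) <= 2 * pi * (nrm (z j) * (1 + j%:R)).
Proof.
move=> hj; have p0 : 0 <= 2 * pi :> R by rewrite mulr_ge0 // pi_ge0.
rewrite nrmM nrm_imag normrM (ger0_norm p0) -[leLHS]mulrA.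
apply: ler_wpM2l => //; rewrite mulrC; apply: ler_wpM2l; first exact: nrm_ge0.
by rewrite -intr_norm -abszE nat1r ler_nat.
Qed.

(** A derivative costs one order of decay. The growth condition on [nu] is met by both enumerations,
    [Posz] and [negidx]. *)
Lemma trigder_bd nu z N (A : R) : (forall j, (`|nu j| <= j.+1)%N) ->
  (forall j, nrm (z j) * (1 + j%:R) ^+ N.+1 <= A) ->
  forall j, nrm (trigder nu z j) * (1 + j%:R) ^+ N <= 2 * pi * A.
Proof.
move=> hnu hA j.
apply: le_trans (ler_wpM2r _ (nrm_trigder z (hnu j))) _.
  by rewrite exprn_ge0 // addr_ge0.
have p0 : 0 <= 2 * pi :> R by rewrite mulr_ge0 // pi_ge0.
by rewrite -[leLHS]mulrA; apply: ler_wpM2l => //; rewrite -mulrA -exprS.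
Qed.

Lemma trigder_iter_bd nu z n N (A : R) : (forall j, (`|nu j| <= j.+1)%N) ->
  (forall j, nrm (z j) * (1 + j%:R) ^+ (n + N) <= A) ->
  forall j, nrm (iter n (trigder nu) z j) * (1 + j%:R) ^+ N <= (2 * pi) ^+ n * A.
Proof.
move=> hnu; elim: n N => [|n ih] N hA j; first by rewrite mul1r; exact: hA.
rewrite iterS exprS -mulrA; apply: trigder_bd => // i; apply: ih => i'.
by rewrite addnS -addSn; exact: hA.
Qed.

Lemma sdecay_trigder nu z : (forall j, (`|nu j| <= j.+1)%N) -> sdecay z ->
  sdecay (trigder nu z).
Proof.
by move=> hnu hz N; have [A hA] := hz N.+1; exists (2 * pi * A); exact: trigder_bd.
Qed.

(** The Taylor remainders of the terms are summed. Each is at most [2 (l t)^2] with [l] bounded by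
    [2 pi (1 + j)], so order 4 is used: two to absorb [l^2] and two for summation. *)
Lemma trigsum_taylor nu z : (forall j, (`|nu j| <= j.+1)%N) -> sdecay z ->
  exists K : R, forall x t,
   nrm (trigsum nu z (x + t) - trigsum nu z x - t%:C * trigsum nu (trigder nu z) x) <= K * t ^+ 2.
Proof.
move=> hnu hz; have [A hA] := hz 4%N; have [A2 hA2] := hz 2%N.
have [A3 hA3] := sdecay_trigder hnu hz 2%N.
exists (2 * (2 * (2 * pi) ^+ 2 * A)) => x t.
have c1 y := csumsP (trig_term nu y hA2).
have c3 := csumsP (trig_term nu x hA3).
have hc := csumsB (csumsB (c1 (x + t)) (c1 x)) (csumsZ (z := t%:C) c3).
rewrite -mulrA; apply: csums_le hc _ => j.
set l : R := 2 * pi * (nu j)%:~R.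
have -> : z j * cexp2pi (nu j) (x + t) - z j * cexp2pi (nu j) x -
    t%:C * (trigder nu z j * cexp2pi (nu j) x) =
   z j * (cis (l * x + l * t) - cis (l * x) - (0 +i* (l * t)) * cis (l * x)).
  rewrite !cexp2piE -/l mulrDr /trigder -/l.
  have -> : (0 +i* (l * t) : R[i]) = t%:C * (0 +i* l).
    by apply/eqP; rewrite eq_complex /=; apply/andP; split; apply/eqP; ring.
  ring.
rewrite nrmM.
apply: (@le_trans _ _ (nrm (z j) * (2 * (l * t) ^+ 2) * (1 + j%:R) ^+ 2)).
  by rewrite ler_wpM2r ?exprn_ge0 ?addr_ge0 // ler_wpM2l ?nrm_ge0 // cis_taylor.
have hl : l ^+ 2 <= (2 * pi) ^+ 2 * (1 + j%:R) ^+ 2.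
  rewrite /l exprMn ler_wpM2l ?sqr_ge0 // -(real_normK (num_real _)).
  rewrite lerXn2r ?nnegrE ?addr_ge0 //.
  by rewrite -intr_norm -abszE nat1r ler_nat.
apply: (@le_trans _ _ (2 * t ^+ 2 * (nrm (z j) * (1 + j%:R) ^+ 2) *
   ((2 * pi) ^+ 2 * (1 + j%:R) ^+ 2))).
  have -> : nrm (z j) * (2 * (l * t) ^+ 2) * (1 + j%:R) ^+ 2 =
    2 * t ^+ 2 * (nrm (z j) * (1 + j%:R) ^+ 2) * l ^+ 2 by rewrite exprMn; ring.
  apply: ler_wpM2l => //.
  by apply: mulr_ge0; apply: mulr_ge0; rewrite ?sqr_ge0 ?nrm_ge0.
have -> : 2 * t ^+ 2 * (nrm (z j) * (1 + j%:R) ^+ 2) * ((2 * pi) ^+ 2 * (1 + j%:R) ^+ 2) =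
   2 * (2 * pi) ^+ 2 * t ^+ 2 * (nrm (z j) * (1 + j%:R) ^+ 4) by ring.
have -> : 2 * (2 * pi) ^+ 2 * A * t ^+ 2 = 2 * (2 * pi) ^+ 2 * t ^+ 2 * A by ring.
by apply: ler_wpM2l => //; rewrite -mulrA mulr_ge0 // mulr_ge0 // sqr_ge0.
Qed.

Lemma trigsum_derive nu z (x : R) : (forall j, (`|nu j| <= j.+1)%N) -> sdecay z ->
  is_derive x 1 (fun y => complex.Re (trigsum nu z y))
                (complex.Re (trigsum nu (trigder nu z) x)) /\
  is_derive x 1 (fun y => complex.Im (trigsum nu z y))
                (complex.Im (trigsum nu (trigder nu z) x)).
Proof.
move=> hnu hz; have [K hK] := trigsum_taylor hnu hz.
split; apply: (@is_derive_of_taylor _ _ _ K) => t; apply: le_trans (hK x t).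
  apply: le_trans (Re_le_nrm _); rewrite le_eqVlt; apply/orP; left; apply/eqP.
  case: (trigsum nu z (x + t)) (trigsum nu z x) (trigsum nu (trigder nu z) x) => [a b] [c d] [e f] /=.
  by congr (`| _ |); ring.
apply: le_trans (Im_le_nrm _); rewrite le_eqVlt; apply/orP; left; apply/eqP.
case: (trigsum nu z (x + t)) (trigsum nu z x) (trigsum nu (trigder nu z) x) => [a b] [c d] [e f] /=.
by congr (`| _ |); ring.
Qed.

Lemma trigsum_ccont nu z : (forall j, (`|nu j| <= j.+1)%N) -> sdecay z ->
  ccont (trigsum nu z).
Proof.
move=> hnu hz; split.
  by apply: derive_continuous => x; have [h _] := trigsum_derive x hnu hz; exact: h.
by apply: derive_continuous => x; have [_ h] := trigsum_derive x hnu hz; exact: h.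
Qed.

Lemma sdecay_iter nu z n : (forall j, (`|nu j| <= j.+1)%N) -> sdecay z ->
  sdecay (iter n (trigder nu) z).
Proof. by move=> hnu hz; elim: n => //= n ih; exact: sdecay_trigder. Qed.

End TrigDerivative.

(** * Smooth functions from rapidly decaying coefficients *)

Section Synthesis.
Variable R : realType.
Implicit Types (f F : R -> R[i]) (h : int -> R[i]).

Definition negidx (n : nat) : int := - n.+1%:Z.

(** The two summands have the shape of [fourier_plus] and [fourier_minus], so that results on them
    transfer by conversion. *)
Definition synth h (x : R) : R[i] :=
  trigsum Posz (fun n => h n%:Z) x + trigsum negidx (fun n => h (negidx n)) x.

Lemma posidx_le j : (`|Posz j| <= j.+1)%N. Proof. by rewrite absz_nat. Qed.

Lemma negidx_le j : (`|negidx j| <= j.+1)%N. Proof. by rewrite /negidx abszN. Qed.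

Lemma zbd_pos N (e : R) h : zbd N e h -> forall j, nrm (h (Posz j)) * (1 + j%:R) ^+ N <= e.
Proof. by move=> hh j; rewrite mulrC; exact: hh j%:Z. Qed.

Lemma zbd_neg N (e : R) h : zbd N e h ->
  forall j, nrm (h (negidx j)) * (1 + j%:R) ^+ N <= e.
Proof.
move=> hh j; apply: le_trans (hh (negidx j)); rewrite mulrC ler_wpM2r ?nrm_ge0 //.
by apply: wgtX_le => //; rewrite /negidx abszN.
Qed.

Lemma zdecay_pos h : zdecay h -> sdecay (fun n => h n%:Z).
Proof. by move=> hh N; have [e /zbd_pos he] := hh N; exists e. Qed.

Lemma zdecay_neg h : zdecay h -> sdecay (fun n => h (negidx n)).
Proof. by move=> hh N; have [e /zbd_neg he] := hh N; exists e. Qed.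

Lemma derive1nS_eq n (p : nat -> R -> R) :
  (forall n (x : R), is_derive x 1 (p n) (p n.+1 x)) -> derive1n n (p 0%N) = p n.
Proof.
move=> hp; elim: n => [//|n ih]; rewrite derive1nS ih.
by apply/funext => x; rewrite derive1E; have := hp n x => hx; apply: derive_val.
Qed.

(** The [n]-th termwise derivative of [synth h]. *)
Definition synthn n h (x : R) : R[i] :=
  trigsum Posz (iter n (trigder Posz) (fun n => h n%:Z)) x +
  trigsum negidx (iter n (trigder negidx) (fun n => h (negidx n))) x.

Lemma synthn_derive n h (x : R) : zdecay h ->
  is_derive x 1 (fun y => complex.Re (synthn n h y)) (complex.Re (synthn n.+1 h x)) /\
  is_derive x 1 (fun y => complex.Im (synthn n h y)) (complex.Im (synthn n.+1 h x)).
Proof.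
move=> hh.
have [a1 b1] := trigsum_derive x posidx_le (sdecay_iter n posidx_le (zdecay_pos hh)).
have [a2 b2] := trigsum_derive x negidx_le (sdecay_iter n negidx_le (zdecay_neg hh)).
rewrite /synthn; split.
  under eq_fun do rewrite cReD; rewrite cReD; exact: is_deriveD.
under eq_fun do rewrite cImD; rewrite cImD; exact: is_deriveD.
Qed.

Lemma cderive1n_synth n h : zdecay h -> cderive1n n (synth h) = synthn n h.
Proof.
move=> hh; apply/funext => x; rewrite /cderive1n.
have -> : derive1n n (fun y => complex.Re (synth h y)) = fun y => complex.Re (synthn n h y).
  exact: (@derive1nS_eq n (fun n y => complex.Re (synthn n h y))
    (fun m y => (synthn_derive m y hh).1)).
have -> : derive1n n (fun y => complex.Im (synth h y)) = fun y => complex.Im (synthn n h y).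
  exact: (@derive1nS_eq n (fun n y => complex.Im (synthn n h y))
    (fun m y => (synthn_derive m y hh).2)).
by case: (synthn n h x).
Qed.

Lemma trigsum_periodic nu z (x : R) : trigsum nu z (x + 1) = trigsum nu z x.
Proof. by congr csum; apply/funext => j; rewrite cexp2pi_periodic. Qed.

Lemma synth_smooth h : zdecay h -> smooth_circle (synth h).
Proof.
move=> hh; split=> [x|n x]; first by rewrite /synth !trigsum_periodic.
have -> : derive1n n (fun y => complex.Re (synth h y)) = fun y => complex.Re (synthn n h y).
  exact: (@derive1nS_eq n (fun n y => complex.Re (synthn n h y))
    (fun m y => (synthn_derive m y hh).1)).
have -> : derive1n n (fun y => complex.Im (synth h y)) = fun y => complex.Im (synthn n h y).
  exact: (@derive1nS_eq n (fun n y => complex.Im (synthn n h y))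
    (fun m y => (synthn_derive m y hh).2)).
by have [[a _] [b _]] := synthn_derive n x hh.
Qed.

(** Order [n] pays for the derivatives and 2 for summation; two half series with a factor 2 each
    make 4. *)
Lemma synth_seminorm n (e : R) h : zdecay h -> zbd (n + 2) e h ->
  smooth_seminorm n (synth h) <= 4 * (2 * pi) ^+ n * e.
Proof.
move=> hh he; apply: ge_sup; first by exists (complex.Re `|cderive1n n (synth h) 0|), 0.
move=> _ [x _ <-]; rewrite cderive1n_synth // -/(nrm _).
apply: le_trans (ler_nrmD _ _) _.
have -> : 4 * (2 * pi) ^+ n * e = 2 * ((2 * pi) ^+ n * e) + 2 * ((2 * pi) ^+ n * e) :> R by ring.
apply: lerD; apply: trigsum_le; apply: trigder_iter_bd.
- exact: posidx_le.
- exact: zbd_pos.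
- exact: negidx_le.
- exact: zbd_neg.
Qed.

Lemma fourier_trigpos h m : zdecay h ->
  fourier (trigsum Posz (fun n => h n%:Z) : R -> R[i]) m = if m is Posz _ then h m else 0.
Proof.
move=> hh; have hs := zdecay_pos hh; have [A hA] := hs 2%N.
apply: csums_uniq (trigsum_fourier hA (trigsum_ccont posidx_le hs)) _.
case: m => m.
  rewrite (_ : (fun j => _) = fun j => if j == m then h m else 0); first exact: csums_single.
  apply/funext => j; rewrite eqz_nat.
  by case: eqP => [->|_]; rewrite ?mulr1 ?mulr0.
rewrite (_ : (fun j => _) = fun=> 0); first exact: csums0.
by apply/funext => j; rewrite mulr0.
Qed.

Lemma fourier_trigneg h m : zdecay h ->
  fourier (trigsum negidx (fun n => h (negidx n)) : R -> R[i]) m = if m is Negz _ then h m else 0.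
Proof.
move=> hh; have hs := zdecay_neg hh; have [A hA] := hs 2%N.
apply: csums_uniq (trigsum_fourier hA (trigsum_ccont negidx_le hs)) _.
case: m => m.
  rewrite (_ : (fun j => _) = fun=> 0); first exact: csums0.
  apply/funext => j; case: eqP => [|_]; last by rewrite mulr0.
  by rewrite /negidx; lia.
rewrite (_ : (fun j => _) = fun j => if j == m then h (Negz m) else 0); first exact: csums_single.
apply/funext => j; rewrite /negidx -NegzE.
case: (eqVneq j m) => [->|jm]; first by rewrite eqxx mulr1.
by case: eqP => [[] e|_]; [rewrite e eqxx in jm|rewrite mulr0].
Qed.

Lemma fourier_synth h : zdecay h -> fourier (synth h) = h.
Proof.
move=> hh; apply/funext => m.
have c1 := trigsum_ccont posidx_le (zdecay_pos hh).
have c2 := trigsum_ccont negidx_le (zdecay_neg hh).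
rewrite /synth fourierD // fourier_trigpos // fourier_trigneg //.
by case: m => m; rewrite ?addr0 ?add0r.
Qed.

Lemma fourier_fourier_plus F m : zdecay (fourier F) ->
  fourier (fourier_plus F) m = if m is Posz _ then fourier F m else 0.
Proof. exact: fourier_trigpos. Qed.

Lemma fourier_fourier_minus F m : zdecay (fourier F) ->
  fourier (fourier_minus F) m = if m is Negz _ then fourier F m else 0.
Proof. exact: fourier_trigneg. Qed.

End Synthesis.

(** * Decay of the Fourier coefficients of smooth functions *)

Section FourierDecay.
Variable R : realType.
Implicit Types (p q : R -> R) (f : R -> R[i]).

Definition smooth_periodic p :=
  (forall x, p (x + 1) = p x) /\ forall n (x : R), derivable (derive1n n p) x 1.

Lemma is_derive_derive1 p (x : R) : derivable p x 1 -> is_derive x 1 p (derive1 p x).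
Proof. by move=> h; rewrite derive1E; exact: derivableP. Qed.

Lemma smooth_periodic_derive p : smooth_periodic p -> smooth_periodic (derive1 p).
Proof.
move=> [per sm]; split=> [x|n x]; last first.
  by have := sm n.+1 x; rewrite /derive1n iterSr.
have h1 := is_derive_derive1 (sm 0%N (x + 1)).
have h2 := is_derive_derive1 (sm 0%N x).
have h3 : is_derive x 1 (fun y : R => y + 1) 1.
  rewrite -[X in is_derive _ _ _ X]addr0.
  exact: (is_deriveD (is_derive_id x 1) (is_derive_cst (1:R) x (1:R))).
have h4 := @is_derive1_comp _ p (fun y => y + 1) x _ _ h1 h3.
have e : p \o (fun y => y + 1) = p by apply/funext => y; exact: per.
rewrite mulr1 e in h4.
by case: h4 => _ <-; case: h2 => _ <-.
Qed.

Lemma smooth_periodic_derive1n p k : smooth_periodic p -> smooth_periodic (derive1n k p).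
Proof. by elim: k => [//|k ih] hp; rewrite derive1nS; exact/smooth_periodic_derive/ih. Qed.

Lemma smooth_periodic_is_derive p (x : R) : smooth_periodic p -> is_derive x 1 p (derive1 p x).
Proof. by move=> [_ sm]; exact: is_derive_derive1 (sm 0%N x). Qed.

Lemma smooth_periodic_continuous p : smooth_periodic p -> continuous p.
Proof.
by move=> sp; apply: (derive_continuous (q := derive1 p)) => x; exact: smooth_periodic_is_derive.
Qed.

Lemma periodic_floor p (x : R) : (forall x, p (x + 1) = p x) ->
  exists2 y, 0 <= y <= 1 & p x = p y.
Proof.
move=> per; exists (x - (Num.floor x)%:~R).
  rewrite subr_ge0 ge_floor /=.
  have := lt_succ_floor x; rewrite intrD; lra.
have pern := @periodicn R R p 1 per.
case: (Num.floor x) => n.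
  by rewrite -[in LHS](subrK (n%:R) x) pern.
by rewrite NegzE mulrNz opprK -[(n.+1)%:~R]/(1 *+ n.+1) pern.
Qed.

Lemma periodic_bounded p : continuous p -> (forall x, p (x + 1) = p x) ->
  exists M, forall x, `|p x| <= M.
Proof.
move=> cp per.
have ca : continuous (fun x => `|p x|) by move=> x; exact: cvg_norm (cp x).
have [c _ hc] := @EVT_max R (fun x => `|p x|) 0 1 ler01 (continuous_subspaceT ca).
exists `|p c| => x; have [y hy ->] := periodic_floor x per.
by apply: hc; rewrite in_itv.
Qed.

Definition cosc (n : int) p : R := int01 (fun x => p x * cos (2 * pi * n%:~R * x)).

Definition sinc (n : int) p : R := int01 (fun x => p x * sin (2 * pi * n%:~R * x)).

Lemma cont_mul p q : continuous p -> continuous q -> continuous (fun x => p x * q x).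
Proof. by move=> cp cq x; exact: cvgM (cp x) (cq x). Qed.

Lemma cont_cos (l : R) : continuous (fun x : R => cos (l * x)).
Proof. by have [] := ccont_cis l. Qed.

Lemma cont_sin (l : R) : continuous (fun x : R => sin (l * x)).
Proof. by have [] := ccont_cis l. Qed.

(** Integration by parts; the boundary terms cancel by periodicity. *)
Lemma cosc_derive n p : smooth_periodic p ->
  cosc n (derive1 p) = 2 * pi * n%:~R * sinc n p.
Proof.
move=> hp; set l : R := 2 * pi * n%:~R.
have cp := smooth_periodic_continuous hp.
have cp' := smooth_periodic_continuous (smooth_periodic_derive hp).
have := cis_2piz R n; rewrite -/l => /eqP.
rewrite eq_complex /= => /andP[/eqP e1 /eqP e2].
have h (x : R) : is_derive x 1 (fun x => p x * cos (l * x))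
    (derive1 p x * cos (l * x) + - l * (p x * sin (l * x))).
  have := is_deriveM (smooth_periodic_is_derive x hp) (is_derive_cosl l x).
  congr (is_derive x 1 _ _); rewrite /GRing.scale /=; ring.
have c1 := cont_mul cp' (@cont_cos l).
have c2 := cont_mul cp (@cont_sin l).
have c3 : continuous (fun x => - l * (p x * sin (l * x))).
  by move=> x; exact: cvgM (cvg_cst _) (c2 x).
have c4 : continuous (fun x => derive1 p x * cos (l * x) + - l * (p x * sin (l * x))).
  by move=> x; apply: cvgD; [exact: c1|exact: c3].
have := int01_FTC h c4.
rewrite int01D // int01Z // mulr1 mulr0 e1 cos0 !mulr1.
rewrite -[X in p X - _]add0r hp.1 subrr mulNr => /eqP.
by rewrite subr_eq0 => /eqP.
Qed.

Lemma sinc_derive n p : smooth_periodic p ->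
  sinc n (derive1 p) = - (2 * pi * n%:~R * cosc n p).
Proof.
move=> hp; set l : R := 2 * pi * n%:~R.
have cp := smooth_periodic_continuous hp.
have cp' := smooth_periodic_continuous (smooth_periodic_derive hp).
have := cis_2piz R n; rewrite -/l => /eqP.
rewrite eq_complex /= => /andP[/eqP e1 /eqP e2].
have h (x : R) : is_derive x 1 (fun x => p x * sin (l * x))
    (derive1 p x * sin (l * x) + l * (p x * cos (l * x))).
  have := is_deriveM (smooth_periodic_is_derive x hp) (is_derive_sinl l x).
  congr (is_derive x 1 _ _); rewrite /GRing.scale /=; ring.
have c1 := cont_mul cp' (@cont_sin l).
have c2 := cont_mul cp (@cont_cos l).
have c3 : continuous (fun x => l * (p x * cos (l * x))).
  by move=> x; exact: cvgM (cvg_cst _) (c2 x).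
have c4 : continuous (fun x => derive1 p x * sin (l * x) + l * (p x * cos (l * x))).
  by move=> x; apply: cvgD; [exact: c1|exact: c3].
have := int01_FTC h c4.
rewrite int01D // int01Z // mulr1 mulr0 e2 sin0 !mulr0 subrr => /eqP.
by rewrite addr_eq0 => /eqP.
Qed.

(** Integration by parts exchanges cosine and sine coefficients, so the two bounds go through the
    induction together. *)
Lemma cosc_sinc_bd k n p (M : R) : smooth_periodic p ->
  (forall x, `|derive1n k p x| <= M) ->
  (2 * pi * `|n|%N%:R) ^+ k * `|cosc n p| <= M /\
  (2 * pi * `|n|%N%:R) ^+ k * `|sinc n p| <= M.
Proof.
elim: k p => [|k ih] p hp hM.
  have cp := smooth_periodic_continuous hp; rewrite !mul1r.
  split; apply: int01_le.
  - exact: cont_mul cp (@cont_cos _).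
  - move=> x; rewrite normrM; apply: le_trans (hM x); rewrite ler_piMr //.
    by rewrite ler_norml cos_geN1 cos_le1.
  - exact: cont_mul cp (@cont_sin _).
  - move=> x; rewrite normrM; apply: le_trans (hM x); rewrite ler_piMr //.
    by rewrite ler_norml sin_geN1 sin_le1.
have hM' x : `|derive1n k (derive1 p) x| <= M by have := hM x; rewrite /derive1n iterSr.
have [h1 h2] := ih _ (smooth_periodic_derive hp) hM'.
have e : `|2 * pi * n%:~R : R| = 2 * pi * `|n|%N%:R.
  by rewrite normrM ger0_norm ?mulr_ge0 ?pi_ge0 // -intr_norm.
rewrite exprSr; split.
  by rewrite -[leLHS]mulrA; move: h2; rewrite sinc_derive // normrN normrM e.
by rewrite -[leLHS]mulrA; move: h1; rewrite cosc_derive // normrM e.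
Qed.

Lemma smooth_circleRe f : smooth_circle f -> smooth_periodic (fun x => complex.Re (f x)).
Proof. by move=> [per sm]; split=> [x|n x]; [rewrite per|have [] := sm n x]. Qed.

Lemma smooth_circleIm f : smooth_circle f -> smooth_periodic (fun x => complex.Im (f x)).
Proof. by move=> [per sm]; split=> [x|n x]; [rewrite per|have [] := sm n x]. Qed.

Lemma smooth_ccont f : smooth_circle f -> ccont f.
Proof.
by move=> hf; split; apply: smooth_periodic_continuous; [exact: smooth_circleRe|exact: smooth_circleIm].
Qed.

Lemma fourier_cosc_sinc f n : smooth_circle f ->
  fourier f n = (cosc n (fun x => complex.Re (f x)) + sinc n (fun x => complex.Im (f x))) +i*
    (cosc n (fun x => complex.Im (f x)) - sinc n (fun x => complex.Re (f x))).
Proof.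
move=> /smooth_ccont [c1 c2]; rewrite fourierE /cint.
set l : R := 2 * pi * n%:~R.
have e x : cexp2pi (- n) x = cos (l * x) +i* (- sin (l * x)).
  by rewrite cexp2piE /cis -/l mulrNz mulrN mulNr cosN sinN.
congr (_ +i* _).
  rewrite -int01D; [|exact: cont_mul c1 (@cont_cos l)|exact: cont_mul c2 (@cont_sin l)].
  by congr int01; apply/funext => x; rewrite cReM e /= mulrN opprK.
rewrite -[X in _ + X]mulN1r /sinc -int01Z; last exact: cont_mul c1 (@cont_sin l).
rewrite -int01D; first last.
- by move=> x; apply: cvgM; [exact: cvg_cst|exact: (cont_mul c1 (@cont_sin l))].
- exact: cont_mul c2 (@cont_cos l).
by congr int01; apply/funext => x; rewrite cImM e /= mulrN mulN1r addrC.
Qed.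

Lemma nrm_complex (a b : R) : nrm (a +i* b : R[i]) <= `|a| + `|b|.
Proof. exact: nrm_le_ReIm. Qed.

Lemma cderive1n_le_seminorm f k x : smooth_circle f ->
  nrm (cderive1n k f x) <= smooth_seminorm k f.
Proof.
move=> hf.
have h1 := smooth_periodic_derive1n k (smooth_circleRe hf).
have h2 := smooth_periodic_derive1n k (smooth_circleIm hf).
have [M1 b1] := periodic_bounded (smooth_periodic_continuous h1) h1.1.
have [M2 b2] := periodic_bounded (smooth_periodic_continuous h2) h2.1.
apply: ub_le_sup; last by exists x.
by exists (M1 + M2) => _ [y _ <-]; apply: le_trans (nrm_complex _ _) _; exact: lerD.
Qed.

(** The 4 counts the real integrals in a complex coefficient. For nonzero [n], [1 + |n| <= 2 pi |n|]
    turns [N] integrations by parts into the weight; [n = 0] takes none. *)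
Lemma fourier_zbd f N (e : R) : smooth_circle f ->
  (forall k, (k <= N)%N -> smooth_seminorm k f <= e) -> zbd N (4 * e) (fourier f).
Proof.
move=> hf he n.
have key k : (k <= N)%N -> (2 * pi * `|n|%N%:R) ^+ k * nrm (fourier f n) <= 4 * e.
  move=> kN; rewrite fourier_cosc_sinc //.
  have b x : nrm (cderive1n k f x) <= e.
    exact: le_trans (cderive1n_le_seminorm k x hf) (he k kN).
  have [h1 h2] := cosc_sinc_bd n (smooth_circleRe hf) (fun x => le_trans (Re_le_nrm (cderive1n k f x)) (b x)).
  have [h3 h4] := cosc_sinc_bd n (smooth_circleIm hf) (fun x => le_trans (Im_le_nrm (cderive1n k f x)) (b x)).
  set a := _ ^+ k in h1 h2 h3 h4 *.
  have a0 : 0 <= a by rewrite exprn_ge0 // !mulr_ge0 // pi_ge0.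
  apply: le_trans (ler_wpM2l a0 (nrm_complex _ _)) _.
  have := ler_wpM2l a0 (ler_normD (cosc n (fun x => complex.Re (f x))) (sinc n (fun x => complex.Im (f x)))).
  have := ler_wpM2l a0 (ler_normB (cosc n (fun x => complex.Im (f x))) (sinc n (fun x => complex.Re (f x)))).
  rewrite !mulrDr; lra.
have [n0|n0] := eqVneq n 0.
  by have := key 0%N isT; rewrite n0 /wgt absz0 addr0 expr1n expr0.
apply: le_trans (key N (leqnn N)); rewrite ler_wpM2r ?nrm_ge0 //.
have n1 : 1 <= `|n|%N%:R :> R by rewrite ler1n absz_gt0.
have p1 : 2 <= pi :> R by exact: pi_ge2.
have km : wgt R `|n|%N <= 2 * pi * `|n|%N%:R by rewrite /wgt; nra.
have w1 := wgt_ge1 R `|n|%N.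
by rewrite lerXn2r // nnegrE; lra.
Qed.

Lemma fourier_zdecay f : smooth_circle f -> zdecay (fourier f).
Proof.
(* The sum of absolute values is a common bound for finitely many seminorms. *)
move=> hf N; exists (4 * \sum_(0 <= k < N.+1) `|smooth_seminorm k f|).
apply: fourier_zbd => // k kN; apply: le_trans (ler_norm _) _.
rewrite (bigD1_seq k) ?iota_uniq ?mem_index_iota //=.
by rewrite lerDl sumr_ge0.
Qed.

End FourierDecay.

(** * Injectivity of Fourier coefficients *)

Section Fejer.
Variable R : realType.
Implicit Types (p q : R -> R) (f : R -> R[i]).

Definition dirichlet N (t : R) : R[i] := \sum_(0 <= i < N) cexp2pi i%:Z t.

(* N times the Fejer kernel of order N, centred at [x0]. *)
Definition fejer N (x0 y : R) : R := nrm (dirichlet N (y - x0)) ^+ 2.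

Lemma conj_cexp2pi n (x : R) : Num.conj (cexp2pi n x) = cexp2pi (- n) x.
Proof.
have -> : Num.conj (cexp2pi n x) = conjc (cexp2pi n x) by [].
by rewrite !cexp2piE /cis /= mulrNz mulrN mulNr cosN sinN.
Qed.

Lemma cexp2pi_sub n (x y : R) : cexp2pi n (y - x) = cexp2pi (- n) x * cexp2pi n y.
Proof.
by rewrite !cexp2piE -cisD; congr cis; rewrite mulrNz; ring.
Qed.

Lemma nrm_sqr_conj (z : R[i]) : (nrm z ^+ 2)%:C = z * Num.conj z.
Proof. by rewrite rmorphXn /= -nrmE normCK. Qed.

Lemma fejerE N (x0 y : R) : (fejer N x0 y)%:C =
  \sum_(0 <= i < N) \sum_(0 <= j < N)
    cexp2pi (j%:Z - i%:Z) x0 * cexp2pi (i%:Z - j%:Z) y.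
Proof.
rewrite /fejer nrm_sqr_conj /dirichlet rmorph_sum mulr_suml.
apply: eq_bigr => i _; rewrite mulr_sumr; apply: eq_bigr => j _.
rewrite /= [X in _ * X]conj_cexp2pi cexp2piM cexp2pi_sub.
by congr (cexp2pi _ _ * _); lia.
Qed.

(** Geometric sum, with [|e^(2 pi i t) - 1|^2 = 4 sin^2(pi t)] and [|e^(2 pi i N t) - 1| <= 2]. The
    bound is independent of [N], whereas the kernel has integral [N]. *)
Lemma fejer_geom N (x0 y : R) : 4 * sin (pi * (y - x0)) ^+ 2 * fejer N x0 y <= 4.
Proof.
have geom (t : R) : (cexp2pi 1 t - 1) * dirichlet N t = cexp2pi N%:Z t - 1.
  rewrite /dirichlet; elim: N => [|N ih].
    by rewrite big_geq // mulr0 cexp2piE mulr0 mul0r cis0 subrr.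
  rewrite big_nat_recr //= mulrDr ih mulrBl cexp2piM mul1r.
  by rewrite (_ : 1 + N%:Z = N.+1%:Z) //; ring.
have e (t : R) : nrm (cexp2pi 1 t - 1) ^+ 2 = 4 * sin (pi * t) ^+ 2.
  apply: complexI; rewrite nrm_sqr_conj rmorphB rmorph1 /= conj_cexp2pi.
  rewrite mulrBl !mulrBr cexp2piM subrr !mulr1 !mul1r.
  have -> : cexp2pi 0 t = 1 by rewrite cexp2piE mulr0 mul0r cis0.
  rewrite !cexp2piE mulrNz mulrN !mulr1 mulNr /cis cosN sinN.
  have -> : 2 * pi * t = pi * t + pi * t by ring.
  rewrite cosD sinD; apply/eqP; rewrite eq_complex /=; apply/andP; split; apply/eqP.
    have := cos2Dsin2 (pi * t); set c := cos _; set s := sin _ => h.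
    have -> : c * c = 1 - s ^+ 2 by rewrite -h; ring.
    by ring.
  by ring.
rewrite /fejer -e -exprMn -nrmM geom.
have h : nrm (cexp2pi N%:Z (y - x0) - 1) <= 2.
  apply: le_trans (ler_nrmB _ _) _; rewrite nrm_cis.
  by have := nrm_nat R 1; rewrite mulr1n => ->; lra.
have -> : 4 = 2 ^+ 2 :> R by ring.
by rewrite lerXn2r // nnegrE ?nrm_ge0 // ler0n.
Qed.

Lemma ccont_fejer N x0 : ccont (fun y => (fejer N x0 y)%:C : R[i]).
Proof.
under eq_fun do rewrite fejerE.
apply: ccont_sum => i; apply: ccont_sum => j; apply: ccontM.
  exact: ccont_cst.
exact: ccont_cexp2pi.
Qed.

(** The kernel is a trigonometric polynomial, so this integral vanishes together with the Fourier
    coefficients of [f]. *)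
Lemma cint_fejer N x0 f : ccont f ->
  cint (fun y => f y * (fejer N x0 y)%:C) =
  \sum_(0 <= i < N) \sum_(0 <= j < N)
    cexp2pi (j%:Z - i%:Z) x0 * fourier f (j%:Z - i%:Z).
Proof.
move=> cf; under eq_fun do rewrite fejerE mulr_sumr.
have ct i j : ccont (fun y => f y * (cexp2pi (j%:Z - i%:Z) x0 * cexp2pi (i%:Z - j%:Z) y)).
  apply: ccontM => //; apply: ccontM; first exact: ccont_cst.
  exact: ccont_cexp2pi.
rewrite cint_sum => [|i]; last first.
  by under eq_fun do rewrite mulr_sumr; apply: ccont_sum => j; exact: ct.
apply: eq_bigr => i _; under eq_fun do rewrite mulr_sumr.
rewrite cint_sum => [|j]; last exact: ct.
apply: eq_bigr => j _; under eq_fun do rewrite mulrCA.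
rewrite cintZ; last by apply: ccontM => //; exact: ccont_cexp2pi.
by rewrite fourierE opprB.
Qed.

Lemma int01_mono01 p q : continuous p -> continuous q ->
  (forall x, 0 <= x <= 1 -> p x <= q x) -> int01 p <= int01 q.
Proof.
by move=> cp cq h; apply: le_Rintegral => //; exact: integrable01.
Qed.

(** With [g y = 4 sin^2(pi (y - x0))], an inequality [p x0 - p y <= e / 2 + C g y] on [[0, 1]]
    integrates against the kernel to [N p x0 <= N e / 2 + 4 C]; a large [N] gives [p x0 <= e]. As
    [x0] is interior, [g] vanishes nowhere else on [[0, 1]]. *)
Lemma fourier_zero_Re f (x0 : R) : ccont f -> (forall x, f (x + 1) = f x) ->
  (forall n, fourier f n = 0) -> 0 < x0 < 1 -> complex.Re (f x0) <= 0.
Proof.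
move=> cf per hf /andP[x0g x0l].
set p := fun x => complex.Re (f x); have cp : continuous p by exact: cf.1.
have [M hM] : exists M, forall x, `|p x| <= M.
  by apply: periodic_bounded => // x; rewrite /p per.
apply/ler_addgt0Pr => e e0; rewrite add0r.
have e20 : 0 < e / 2 by lra.
have /cvgrPdist_lt /(_ _ e20) /nbhs_ballP [d /= d0 hd] := cp x0.
pose g (y : R) := 4 * sin (pi * (y - x0)) ^+ 2.
have cg : continuous g.
  move=> y; apply: cvgM; first exact: cvg_cst.
  apply: (@continuous_comp _ _ _ (fun y => sin (pi * (y - x0))) (fun z => z ^+ 2)).
    apply: (@continuous_comp _ _ _ (fun y => pi * (y - x0)) sin); last exact: continuous_sin.
    by apply: cvgM; [exact: cvg_cst|apply: cvgB; [exact: cvg_id|exact: cvg_cst]].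
  exact: exprn_continuous.
have g0 y : 0 <= g y by rewrite mulr_ge0 // sqr_ge0.
(* A bump inside the [d]-ball makes [G] positive on the whole compact interval; its minimum then
   bounds [g] from below outside the ball. *)
pose G y := g y + Num.max 0 (d - `|y - x0|).
have cG : continuous G.
  move=> y; apply: cvgD; first exact: cg.
  apply: (@continuous_max _ _ (fun=> 0) (fun y => d - `|y - x0|)) => //.
    exact: cvg_cst.
  apply: cvgB; first exact: cvg_cst.
  by apply: cvg_norm; apply: cvgB; [exact: cvg_id|exact: cvg_cst].
have [c c01 hc] := @EVT_min R G 0 1 ler01 (continuous_subspaceT cG).
have gpos t : 0 < t < 1 -> 0 < sin (pi * t) :> R.
  move=> /andP[t0 t1]; apply: sin_gt0_pi; have := pi_gt0 R => pi0.
  by rewrite mulr_gt0 //= gtr_pMr.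
have Gc : 0 < G c.
  move: c01; rewrite in_itv /= => /andP[c0 c1].
  have mx : 0 <= Num.max 0 (d - `|c - x0|) by rewrite le_max lexx.
  have [e1|n1|n1] := ltgtP c x0.
  - apply: ltr_wpDr => //; rewrite /g mulr_gt0 // exprn_even_gt0 //=.
    by rewrite -[c - x0]opprB mulrN sinN oppr_eq0 gt_eqF // gpos //; lra.
  - apply: ltr_wpDr => //; rewrite /g mulr_gt0 // exprn_even_gt0 //=.
    by rewrite gt_eqF // gpos //; lra.
  - apply: ltr_wpDl; first exact: g0.
    by rewrite n1 subrr normr0 subr0 lt_max d0 orbT.
(* Outside the ball [g >= G c], so [C * g] dominates the oscillation [2 * M] of [p]. *)
pose C := 2 * M / G c.
have M0 : 0 <= M by apply: le_trans (hM 0).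
have C0 : 0 <= C by rewrite divr_ge0 ?mulr_ge0 // ltW.
have est y : 0 <= y <= 1 -> p x0 - p y <= e / 2 + C * g y.
  move=> hy; have [yd|yd] := ltP `|y - x0| d.
    have := hd y; rewrite /ball /= distrC => /(_ yd) h.
    apply: (@le_trans _ _ (e / 2)); last by rewrite lerDl mulr_ge0.
    by apply: ltW; apply: le_lt_trans h; exact: ler_norm.
  have : G c <= g y.
    have := hc y; rewrite in_itv /= => /(_ hy); rewrite /G.
    by rewrite (max_l (y := d - `|y - x0|)) ?addr0 // subr_le0.
  move=> gy; apply: (@le_trans _ _ (2 * M)).
    have := hM x0; have := hM y; rewrite !ler_norml => /andP[? ?] /andP[? ?]; lra.
  apply: (@le_trans _ _ (C * g y)); last by rewrite lerDr ltW.
  by rewrite /C mulrAC ler_pdivlMr // ler_wpM2l // mulr_ge0.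
(* This makes [4 * C] smaller than [N * e / 2]. *)
pose N := (Num.truncn (8 * C / e)).+1.
have NC : 8 * C / e < N%:R by exact: truncnS_gt.
have N0 : 0 < N%:R :> R by rewrite ltr0n.
pose K := fejer N x0; have cK := ccont_fejer N x0.
have cKr : continuous K := cK.1.
have K0 y : 0 <= K y by rewrite sqr_ge0.
have iK : int01 K = N%:R.
  have := @cint_fejer N x0 (fun=> 1) (ccont_cst 1).
  under eq_fun do rewrite mul1r.
  have f1 m : fourier (fun=> 1 : R[i]) m = (m == 0)%:R.
    rewrite fourierE; under eq_fun do rewrite mul1r.
    by rewrite cint_cexp2pi oppr_eq0.
  rewrite (_ : \sum_(0 <= i < N) _ = N%:R) => [/(congr1 (@complex.Re R))|].
    by rewrite /cint /= -(rmorph_nat (real_complex R)).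
  rewrite (eq_big_nat _ _ (F2 := fun=> 1)) => [|i /andP[_ iN]].
    by rewrite big_const_nat subn0 iter_addr_0.
  rewrite (bigD1_seq i) ?iota_uniq ?mem_index_iota //= big1 => [|j ji].
    by rewrite f1 !subrr eqxx mulr1 addr0 cexp2piE mulr0 mul0r cis0.
  by rewrite f1 subr_eq0 eqz_nat (negPf ji) mulr0.
have iF : int01 (fun y => p y * K y) = 0.
  have := cint_fejer N x0 cf; rewrite big1 => [|i _]; last first.
    by rewrite big1 // => j _; rewrite hf mulr0.
  move=> /(congr1 (@complex.Re R)) /=; rewrite /cint /= => <-.
  by congr int01; apply/funext => y; rewrite cReM /= mulr0 subr0.
have cpK := cont_mul cp cKr.
have cA : continuous (fun y => p x0 * K y + - 1 * (p y * K y)).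
  move=> y; apply: cvgD; apply: cvgM; try exact: cvg_cst; first exact: cKr.
  exact: cpK.
have cB : continuous (fun y => e / 2 * K y + C * 4).
  move=> y; apply: cvgD; last exact: cvg_cst.
  by apply: cvgM; [exact: cvg_cst|exact: cKr].
have := int01_mono01 cA cB.
have cK1 : continuous (fun y => p x0 * K y).
  by move=> y; apply: cvgM; [exact: cvg_cst|exact: cKr].
have cK2 : continuous (fun y => - 1 * (p y * K y)).
  by move=> y; apply: cvgM; [exact: cvg_cst|exact: cpK].
have cK3 : continuous (fun y => e / 2 * K y).
  by move=> y; apply: cvgM; [exact: cvg_cst|exact: cKr].
rewrite !int01D ?int01Z ?int01_cst ?iK ?iF //; try exact: continuous_cst.
rewrite mulr0 addr0 => h.
have {h} : p x0 * N%:R <= e / 2 * N%:R + C * 4.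
  apply: h => y hy; have := est y hy; have := fejer_geom N x0 y.
  rewrite -/(K y) -/(g y) => h1 h2.
  have := ler_wpM2r (K0 y) h2; have := ler_wpM2l C0 h1.
  rewrite mulrBl mulrDl mulrA; lra.
have : C * 4 < e / 2 * N%:R.
  by move: NC; rewrite ltr_pdivrMr //; lra.
move=> h1 h2; rewrite -/(p x0).
have : p x0 * N%:R <= e * N%:R by lra.
by rewrite ler_pM2r.
Qed.

Lemma fourier_scale (z : R[i]) f n : ccont f ->
  fourier (fun x => z * f x) n = z * fourier f n.
Proof.
move=> cf; rewrite !fourierE -cintZ; last by apply: ccontM => //; exact: ccont_cexp2pi.
by under eq_fun do rewrite -mulrA.
Qed.

(** The one-sided inequality is applied to the difference times 1, -1, [i] and [-i] on the open
    interval; continuity reaches 0, periodicity the rest. *)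
Lemma fourier_inj f g : smooth_circle f -> smooth_circle g ->
  fourier f = fourier g -> f = g.
Proof.
move=> sf sg hfg; have cf := smooth_ccont sf; have cg := smooth_ccont sg.
pose d x := f x - g x.
have dE : d = fun x => f x + -1 * g x by apply/funext => x; rewrite mulN1r.
have cd : ccont d by rewrite dE; apply: ccontD => //; apply: ccontM => //; exact: ccont_cst.
have per x : d (x + 1) = d x by rewrite /d sf.1 sg.1.
have hd n : fourier d n = 0.
  rewrite dE fourierD // ?fourier_scale // ?hfg ?mulN1r ?subrr //.
  by apply: ccontM => //; exact: ccont_cst.
have key z x : 0 < x < 1 -> complex.Re (z * d x) <= 0.
  apply: (@fourier_zero_Re (fun x => z * d x)).
  - by apply: ccontM => //; exact: ccont_cst.
  - by move=> y; rewrite per.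
  - by move=> n; rewrite fourier_scale // hd mulr0.
have d0 x : 0 < x < 1 -> d x = 0.
  move=> hx; have h1 := key 1 x hx; have h2 := key (-1) x hx.
  have h3 := key (0 +i* 1) x hx; have h4 := key (0 +i* -1) x hx.
  move: h1 h2 h3 h4; rewrite mul1r mulN1r; case: (d x) => a b /= *.
  apply/eqP; rewrite eq_complex /=; apply/andP; split; apply/eqP; lra.
have z0 p : continuous p -> (forall x, 0 < x < 1 -> p x = 0) -> p 0 = 0 :> R.
  move=> cp hp; apply/eqP/negP => /negP p0.
  have /cvgrPdist_lt /(_ `|p 0|) := cp 0; rewrite normr_gt0 => /(_ p0).
  move=> /nbhs_ballP [e /= e0 he].
  pose x := Num.min (e / 2) (1 / 2).
  have x0 : 0 < x by rewrite lt_min; apply/andP; split; lra.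
  have x1 : x < 1 by rewrite gt_min; apply/orP; right; lra.
  have xe : x < e by rewrite gt_min; apply/orP; left; lra.
  have := he x; rewrite /ball /= sub0r normrN gtr0_norm // => /(_ xe).
  by rewrite (hp x) ?x0 ?x1 // subr0 ltxx.
have d00 : d 0 = 0.
  have h1 := z0 _ cd.1 (fun x hx => congr1 (@complex.Re R) (d0 x hx)).
  have h2 := z0 _ cd.2 (fun x hx => congr1 (@complex.Im R) (d0 x hx)).
  by move: h1 h2; case: (d 0) => a b /= -> ->.
have perI (x : R) : 0 <= x <= 1 -> d x = 0.
  rewrite le_eqVlt => /andP[/orP[/eqP <- //|x0]].
  rewrite le_eqVlt => /orP[/eqP ->|x1]; last by rewrite d0 // x0 x1.
  by rewrite -[1]add0r per.
apply/funext => x; apply/eqP; rewrite -subr_eq0 -/(d x); apply/eqP.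
have pR y : complex.Re (d (y + 1)) = complex.Re (d y) by rewrite per.
have pI y : complex.Im (d (y + 1)) = complex.Im (d y) by rewrite per.
have [y1 hy1 e1] := @periodic_floor R (fun x => complex.Re (d x)) x pR.
have [y2 hy2 e2] := @periodic_floor R (fun x => complex.Im (d x)) x pI.
by move: e1 e2 => /=; rewrite (perI _ hy1) (perI _ hy2); case: (d x) => a b /= -> ->.
Qed.

End Fejer.

(** * Bounded operators and their matrices *)

Section Operators.
Variables (R : realType) (H : completeNormedModType R[i]).
Variables (ip : {dot H for Num.conj}) (E : nat -> H).
Hypotheses (hH : is_hilbert_norm ip) (hE : is_orthonormal_basis ip E).
Implicit Types (x y z : H) (a b : H -> H) (f F : R -> R[i]) (h : int -> R[i]).

Lemma ipDl x y z : ip (x + y) z = ip x z + ip y z.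
Proof. exact: linearDl. Qed.

Lemma ipZl (t : R[i]) x z : ip (t *: x) z = t * ip x z.
Proof. exact: linearZl_LR. Qed.

Lemma ip0l z : ip 0 z = 0.
Proof. exact: linear0l. Qed.

Lemma ipNl x z : ip (- x) z = - ip x z.
Proof. exact: linearNl. Qed.

Lemma ipBl x y z : ip (x - y) z = ip x z - ip y z.
Proof. by rewrite ipDl ipNl. Qed.

Lemma ip_suml (I : Type) (r : seq I) (P : pred I) (u : I -> H) z :
  ip (\sum_(i <- r | P i) u i) z = \sum_(i <- r | P i) ip (u i) z.
Proof.
by elim/big_rec2: _ => [|i s t _ <-]; [exact: ip0l|exact: ipDl].
Qed.

Lemma ipC x y : ip x y = Num.conj (ip y x).
Proof. by rewrite hermC mul1r. Qed.

Lemma ipZr (t : R[i]) x z : ip x (t *: z) = Num.conj t * ip x z.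
Proof. by rewrite ipC ipZl rmorphM /= [in RHS]ipC. Qed.

Lemma ip_sumr (I : Type) (r : seq I) (P : pred I) (u : I -> H) z :
  ip z (\sum_(i <- r | P i) u i) = \sum_(i <- r | P i) ip z (u i).
Proof.
by rewrite ipC ip_suml rmorph_sum; apply: eq_bigr => i _; rewrite [in RHS]ipC.
Qed.

Lemma ipE i j : ip (E i) (E j) = (i == j)%:R.
Proof. exact: hE.1. Qed.

Lemma nrm_sqrE x : ((nrm x) ^+ 2)%:C = ip x x.
Proof. by rewrite rmorphXn /= -nrmE; exact: hH. Qed.

Lemma nrm_le_ip x y : ip x x <= ip y y -> nrm x <= nrm y.
Proof. by rewrite -!nrm_sqrE lecR ler_sqr // nnegrE nrm_ge0. Qed.

(** The value does not involve the injection [s]; this is how convergence passes to shifted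
    series. *)
Lemma nrm_orthosum (s : nat -> nat) (u : nat -> R[i]) m n : injective s ->
  ip (\sum_(m <= k < n) u k *: E (s k)) (\sum_(m <= k < n) u k *: E (s k)) =
  \sum_(m <= k < n) u k * Num.conj (u k).
Proof.
move=> sI; rewrite ip_suml; apply: eq_big_nat => k /andP[mk kn].
rewrite ipZl ip_sumr (bigD1_seq k) ?iota_uniq //=; last first.
  by rewrite mem_index_iota mk kn.
rewrite ipZr ipE eqxx mulr1 big1 ?addr0 // => j jk.
by rewrite ipZr ipE (inj_eq sI) eq_sym (negPf jk) mulr0.
Qed.

(** The projection [p] satisfies [ip p p = ip x p], so [0 <= ip (x - p) (x - p)] reads
    [ip p p <= ip x x]. *)
Lemma nrm_bessel x m n : nrm (\sum_(m <= k < n) ip x (E k) *: E k) <= nrm x.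
Proof.
apply: nrm_le_ip; set p := \sum_(m <= k < n) _.
have e : ip p p = ip x p.
  rewrite nrm_orthosum // /p ip_sumr; apply: eq_bigr => k _.
  by rewrite ipZr mulrC.
have er : Num.conj (ip p p) = ip p p by rewrite -ipC.
have : 0 <= ip (x - p) (x - p) by rewrite dnorm_ge0.
rewrite dnormB -e er opprD addrA addrK subr_ge0 //.
Qed.

Lemma nrmEk k : nrm (E k) = 1.
Proof.
have : (nrm (E k) ^+ 2)%:C = (1%:C : R[i]) by rewrite nrm_sqrE ipE eqxx.
by move/complexI/eqP; rewrite sqrp_eq1 ?nrm_ge0 //; exact: eqP.
Qed.

Lemma coord_le x k : nrm (ip x (E k)) <= nrm x.
Proof. by have := nrm_bessel x k k.+1; rewrite big_nat1 nrmZ nrmEk mulr1. Qed.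

Lemma coord_cvg (u : nat -> H) x k : u @ \oo --> x ->
  (fun n => ip (u n) (E k) : R[i]^o) @ \oo --> (ip x (E k) : R[i]^o).
Proof.
move=> /cvg_nrmP h; apply/cvg_nrmP => e e0; apply: filterS (h e e0) => n.
by apply: le_lt_trans; rewrite -ipBl; exact: coord_le.
Qed.

Lemma coord_series (u : nat -> H) x k : series u @ \oo --> x ->
  csums (fun j => ip (u j) (E k)) (ip x (E k)).
Proof.
move=> /(@coord_cvg _ _ k); rewrite /csums.
rewrite (_ : (fun n => ip (series u n) (E k)) =
  series (fun j => ip (u j) (E k) : R[i]^o)) //.
by apply/funext => n; rewrite /series /= ip_suml.
Qed.

Lemma coord_inj x y : (forall k, ip x (E k) = ip y (E k)) -> x = y.
Proof.
move=> h; have hx := hE.2 x; have := hE.2 y.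
rewrite (_ : (fun k => _) = fun k => ip x (E k) *: E k) => [hy|].
  exact: (cvg_unique (@norm_hausdorff _ _) hx hy).
by apply/funext => k; rewrite h.
Qed.

(** Elements of the algebra are bare functions; boundedness and linearity are what make their
    entries determine them. *)
Definition blin a := (forall (t : R[i]) x y, a (t *: x + y) = t *: a x + a y) /\
  exists M : R, 0 <= M /\ forall x, nrm (a x) <= M * nrm x.

Definition entry a k l : R[i] := ip (a (E l)) (E k).

Lemma blin_applyD a x y : blin a -> a (x + y) = a x + a y.
Proof. by case=> l _; rewrite -[x in LHS]scale1r l scale1r. Qed.

Lemma blin_apply0 a : blin a -> a 0 = 0.
Proof.
move=> ha; have := blin_applyD 0 0 ha; rewrite addr0.
by move/(congr1 (fun z => z - a 0)); rewrite subrr addrK => <-.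
Qed.

Lemma blin_applyZ a t x : blin a -> a (t *: x) = t *: a x.
Proof. by move=> ha; rewrite -[t *: x]addr0 ha.1 (blin_apply0 ha) addr0. Qed.

Lemma blin_applyB a x y : blin a -> a (x - y) = a x - a y.
Proof. by move=> ha; rewrite -scaleN1r blin_applyD // blin_applyZ // scaleN1r. Qed.

Lemma blin_apply_sum a (u : nat -> H) m n : blin a ->
  a (\sum_(m <= k < n) u k) = \sum_(m <= k < n) a (u k).
Proof.
move=> ha; elim/big_rec2: _ => [|i s t _ <-]; [exact: blin_apply0|exact: blin_applyD].
Qed.

Lemma blin_cvg a (u : nat -> H) x : blin a -> u @ \oo --> x -> a \o u @ \oo --> a x.
Proof.
move=> [l [M [M0 hM]]] /cvg_nrmP h; apply/cvg_nrmP => e e0.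
have M1 : 0 < M + 1 by rewrite ltr_wpDl.
apply: filterS (h (e / (M + 1)) (divr_gt0 e0 M1)) => n /=.
rewrite ltr_pdivlMr // => hn; apply: le_lt_trans hn.
rewrite -blin_applyB //; last by split=> //; exists M.
apply: le_trans (hM _) _; rewrite mulrC ler_wpM2l ?nrm_ge0 // lerDl //.
Qed.

Lemma blin_series a (u : nat -> H) x : blin a -> series u @ \oo --> x ->
  series (a \o u) @ \oo --> a x.
Proof.
move=> ha /(blin_cvg ha); rewrite (_ : a \o series u = series (a \o u)) //.
by apply/funext => n; rewrite /series /= blin_apply_sum.
Qed.

(** Stated with [csums]: convergence comes from continuity of [a] along the basis expansion of [x],
    not from a weighted bound. *)
Lemma blin_coord a x k : blin a ->
  csums (fun j => entry a k j * ip x (E j)) (ip (a x) (E k)).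
Proof.
move=> ha; have := coord_series (k := k) (blin_series ha (hE.2 x)).
congr csums; apply/funext => j /=.
by rewrite blin_applyZ // ipZl mulrC.
Qed.

Lemma blin_eq a b : blin a -> blin b ->
  (forall k l, entry a k l = entry b k l) -> a = b.
Proof.
move=> ha hb hab; apply/funext => x; apply: coord_inj => k.
apply: csums_uniq (@blin_coord a x k ha) _.
have := @blin_coord b x k hb; congr csums; apply/funext => j; by rewrite hab.
Qed.

Lemma blin_id : blin id.
Proof.
by split=> [//|]; exists 1; split => [//|x]; rewrite mul1r.
Qed.

Lemma blin_comp a b : blin a -> blin b -> blin (a \o b).
Proof.
move=> [la [M [M0 hM]]] [lb [N [N0 hN]]]; split => [t x y /=|].
  by rewrite lb la.
exists (M * N); split; first exact: mulr_ge0.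
by move=> x /=; apply: le_trans (hM _) _; rewrite -mulrA ler_wpM2l.
Qed.

Lemma blinD a b : blin a -> blin b -> blin (a + b).
Proof.
move=> [la [M [M0 hM]]] [lb [N [N0 hN]]]; split => [t x y /=|].
  by rewrite /GRing.add /= lb la scalerDr addrACA.
exists (M + N); split; first exact: addr_ge0.
move=> x /=; apply: le_trans (ler_nrmD _ _) _; rewrite mulrDl lerD //.
Qed.

Lemma blinZ (s : R[i]) a : blin a -> blin (s *: a).
Proof.
move=> [la [M [M0 hM]]]; split => [t x y /=|].
  have e z : (s *: a) z = s *: a z by [].
  by rewrite !e la scalerDr !scalerA mulrC.
exists (nrm s * M); split; first by rewrite mulr_ge0 ?nrm_ge0.
by move=> x; rewrite nrmZ -mulrA ler_wpM2l ?nrm_ge0.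
Qed.

Lemma blinB a b : blin a -> blin b -> blin (a - b).
Proof. by move=> ha hb; rewrite -scaleN1r; apply: blinD => //; exact: blinZ. Qed.

Lemma entD a b k l : entry (a + b) k l = entry a k l + entry b k l.
Proof. exact: ipDl. Qed.

Lemma entB a b k l : entry (a - b) k l = entry a k l - entry b k l.
Proof. exact: ipBl. Qed.

Lemma entZ s a k l : entry (s *: a) k l = s * entry a k l.
Proof. exact: ipZl. Qed.

Lemma ent_comp a b k l : blin a -> entry (a \o b) k l = mulm (entry a) (entry b) k l.
Proof. by move=> ha; rewrite /mulm (csumsE (@blin_coord a (b (E l)) k ha)). Qed.

(** Shared by [toeplitz] and [matrix_op]: the weighted bound gives operator norm at most [2 * A],
    and entries pass to the limit by continuity of coordinates. *)
Lemma blin_nsum (a_ : nat -> H -> H) (A : R) :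
  (forall j, blin (a_ j)) ->
  (forall j x, nrm (a_ j x) * (1 + j%:R) ^+ 2 <= A * nrm x) ->
  blin (fun x => nsum (fun j => a_ j x)) /\
  forall k l, csums (fun j => entry (a_ j) k l) (entry (fun x => nsum (fun j => a_ j x)) k l).
Proof.
move=> ha hA; have hc x := nsum_cvg (fun j => hA j x).
have A0 : 0 <= A.
  have := hA 0%N (E 0%N); rewrite nrmEk mulr1; apply: le_trans.
  by rewrite mulr_ge0 ?nrm_ge0 // exprn_ge0 // addr_ge0.
split; last by move=> k l; exact: coord_series (hc (E l)).
split=> [t x y|]; last first.
  exists (2 * A); split=> [|x]; first by rewrite mulr_ge0.
  by rewrite -mulrA; apply: nrm_sum_lim (hc x).
apply: coord_inj => k; apply: csums_uniq (coord_series (k := k) (hc _)) _.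
rewrite ipDl ipZl.
have := csumsD (csumsZ (z := t) (coord_series (k := k) (hc x))) (coord_series (k := k) (hc y)).
by congr csums; apply/funext => j; rewrite (ha j).1 ipDl ipZl.
Qed.

Lemma blin_matrix_unit k l : blin (matrix_unit ip E k l).
Proof.
split=> [t x y|]; first by rewrite /matrix_unit ipDl ipZl scalerDl scalerA.
exists 1; split=> // x; rewrite /matrix_unit nrmZ nrmEk mulr1 mul1r.
exact: coord_le.
Qed.

Lemma ent_matrix_unit k l i j :
  entry (matrix_unit ip E k l) i j = ((i == k) && (j == l))%:R.
Proof. by rewrite /entry /matrix_unit ipZl !ipE -natrM mulnb andbC eq_sym. Qed.

(** * Shifts, Toeplitz operators and matrix operators *)

(** Norms of blocks over an orthonormal system depend only on the coefficients, so the Cauchy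
    property survives reindexing. *)
Lemma cvg_series_reindex (s : nat -> nat) (u : nat -> R[i]) :
  injective s -> cauchy (series (fun k => u k *: E k) @ \oo) ->
  series (fun k => u k *: E (s k)) @ \oo --> nsum (fun k => u k *: E (s k)).
Proof.
move=> sI /cauchy_seriesP h; apply/cauchy_cvgP/cauchy_seriesP => e e0.
apply: filterS (h e e0) => -[m n] /=; apply: le_lt_trans.
rewrite !nrmE lecR; apply: nrm_le_ip; rewrite nrm_orthosum //.
by rewrite (@nrm_orthosum id).
Qed.

Lemma shift_cvg x : series (fun k => ip x (E k) *: E k.+1) @ \oo --> unilateral_shift ip E x.
Proof.
apply: cvg_series_reindex; first exact: succn_inj.
by apply/cauchy_cvgP; exact: (cvgP _ (hE.2 x)).
Qed.

Lemma shift_adj_cvg x :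
  series (fun k => ip x (E k.+1) *: E k) @ \oo --> unilateral_shift_adj ip E x.
Proof.
apply/cauchy_cvgP/cauchy_seriesP => e e0.
have /cvgP/cauchy_cvgP/cauchy_seriesP/(_ e e0) := hE.2 x.
move=> [[A B] /= [[N _ hN] [M _ hM]] hAB].
exists ([set n | (N <= n)%N], [set n | (M <= n)%N]) => /=.
  by split; [exists N|exists M].
(* The block from [m] to [n] carries the coefficients of the block from [m + 1] to [n + 1] of the
   expansion of [x]. *)
move=> [m n] /= [hm hn]; have := hAB (m.+1, n.+1); rewrite /= => h.
have {}h := h (conj (hN m.+1 (leqW hm)) (hM n.+1 (leqW hn))).
apply: le_lt_trans h; rewrite !nrmE lecR; apply: nrm_le_ip.
rewrite (@nrm_orthosum id) // (@nrm_orthosum id) //.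
by rewrite [in leRHS]big_add1.
Qed.

Lemma shift_coordS x k : ip (unilateral_shift ip E x) (E k.+1) = ip x (E k).
Proof.
apply: (csums_uniq (@coord_series _ _ k.+1 (@shift_cvg x))).
rewrite (_ : (fun j => _) = fun j => if j == k then ip x (E k) else 0); last first.
  apply/funext => j; rewrite ipZl ipE eqSS.
  by case: eqP => [->|_]; rewrite ?mulr1 ?mulr0.
have := @csums_finite R k.+1 (fun j => if j == k then ip x (E k) else 0).
rewrite big_nat_recr //= eqxx big_nat big1 ?add0r; first apply.
  by move=> j kj; rewrite gtn_eqF.
by move=> j /andP[_ jk]; rewrite ltn_eqF.
Qed.

Lemma shift_coord0 x : ip (unilateral_shift ip E x) (E 0%N) = 0.
Proof.
apply: (csums_uniq (@coord_series _ _ 0 (@shift_cvg x))).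
rewrite (_ : (fun j => _) = fun=> 0); first exact: csums0.
by apply/funext => j; rewrite ipZl ipE mulr0.
Qed.

Lemma shift_adj_coord x k : ip (unilateral_shift_adj ip E x) (E k) = ip x (E k.+1).
Proof.
apply: (csums_uniq (@coord_series _ _ k (@shift_adj_cvg x))).
rewrite (_ : (fun j => _) = fun j => if j == k then ip x (E k.+1) else 0); last first.
  apply/funext => j; rewrite ipZl ipE.
  by case: eqP => [->|_]; rewrite ?mulr1 ?mulr0.
have := @csums_finite R k.+1 (fun j => if j == k then ip x (E k.+1) else 0).
rewrite big_nat_recr //= eqxx big_nat big1 ?add0r; first apply.
  by move=> j kj; rewrite gtn_eqF.
by move=> j /andP[_ jk]; rewrite ltn_eqF.
Qed.

(** The iterates are contractions, so decay of the Fourier coefficients alone makes the Toeplitz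
    series converge. *)
Lemma blin_shift_iter n : blin (iter n (unilateral_shift ip E)) /\
  forall x, nrm (iter n (unilateral_shift ip E) x) <= nrm x.
Proof.
have h1 x : nrm (unilateral_shift ip E x) <= nrm x.
  apply: nrm_lim_le (@shift_cvg x) _; apply: nearW => m.
  rewrite /series /=; apply: le_trans (nrm_bessel x 0 m).
  apply: nrm_le_ip; rewrite nrm_orthosum; last exact: succn_inj.
  by rewrite (@nrm_orthosum id).
have l1 (t : R[i]) x y : unilateral_shift ip E (t *: x + y) =
    t *: unilateral_shift ip E x + unilateral_shift ip E y.
  apply: coord_inj => -[|k]; rewrite ipDl ipZl.
    by rewrite !shift_coord0 mulr0 addr0.
  by rewrite !shift_coordS ipDl ipZl.
elim: n => [|n [ih1 ih2]].
  by split=> [|x] //; exact: blin_id.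
split=> [|x]; last exact: le_trans (h1 _) (ih2 x).
rewrite (_ : iter n.+1 _ = unilateral_shift ip E \o iter n (unilateral_shift ip E)) //.
apply: blin_comp => //; split => //; exists 1; split=> // x; by rewrite mul1r.
Qed.

Lemma blin_shift_adj_iter n : blin (iter n (unilateral_shift_adj ip E)) /\
  forall x, nrm (iter n (unilateral_shift_adj ip E) x) <= nrm x.
Proof.
have h1 x : nrm (unilateral_shift_adj ip E x) <= nrm x.
  apply: nrm_lim_le (@shift_adj_cvg x) _; apply: nearW => m.
  rewrite /series /=; apply: le_trans (nrm_bessel x 1 m.+1).
  apply: nrm_le_ip; rewrite (@nrm_orthosum id) // (@nrm_orthosum id) //.
  by rewrite [in leRHS]big_add1.
have l1 (t : R[i]) x y : unilateral_shift_adj ip E (t *: x + y) =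
    t *: unilateral_shift_adj ip E x + unilateral_shift_adj ip E y.
  by apply: coord_inj => k; rewrite ipDl ipZl !shift_adj_coord ipDl ipZl.
elim: n => [|n [ih1 ih2]].
  by split=> [|x] //; exact: blin_id.
split=> [|x]; last exact: le_trans (h1 _) (ih2 x).
rewrite (_ : iter n.+1 _ = unilateral_shift_adj ip E \o iter n (unilateral_shift_adj ip E)) //.
apply: blin_comp => //; split => //; exists 1; split=> // x; by rewrite mul1r.
Qed.

Lemma shift_iter_coord n x k : ip (iter n (unilateral_shift ip E) x) (E (n + k)) = ip x (E k).
Proof. by elim: n => [//|n ih]; rewrite addSn /= shift_coordS. Qed.

Lemma shift_iter_coord0 n x k : (k < n)%N ->
  ip (iter n (unilateral_shift ip E) x) (E k) = 0.
Proof.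
elim: n k => [//|n ih] [|k] /= kn; first exact: shift_coord0.
by rewrite shift_coordS ih.
Qed.

Lemma shift_adj_iter_coord n x k :
  ip (iter n (unilateral_shift_adj ip E) x) (E k) = ip x (E (n + k)).
Proof.
by elim: n k => [//|n ih] k; rewrite /= shift_adj_coord ih addnS.
Qed.

(** For each entry a single term survives: [n = k - l] in the first series or [n + 1 = l - k] in the
    second. *)
Lemma toeplitz_blin f : zdecay (fourier f) ->
  blin (toeplitz ip E f) /\ forall k l, entry (toeplitz ip E f) k l = toepm (fourier f) k l.
Proof.
move=> hf; have [e he] := hf 2%N.
have bnd (n : nat) (m : int) (y x : H) : (n <= `|m|)%N -> nrm y <= nrm x ->
    nrm (fourier f m *: y) * (1 + n%:R) ^+ 2 <= e * nrm x.
  move=> nm yx; rewrite nrmZ mulrAC ler_wpM2 ?nrm_ge0 //.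
    by rewrite mulr_ge0 ?nrm_ge0 // exprn_ge0 // addr_ge0.
  apply: le_trans (he m); rewrite mulrC ler_wpM2r ?nrm_ge0 //.
  exact: wgtX_le.
have [b1 e1] := @blin_nsum
  (fun n => fourier f n%:Z *: iter n (unilateral_shift ip E)) e
  (fun n => blinZ _ (blin_shift_iter n).1)
  (fun n x => bnd n n%:Z _ _ (leqnn n) ((blin_shift_iter n).2 x)).
have [b2 e2] := @blin_nsum
  (fun n => fourier f (- n.+1%:Z) *: iter n.+1 (unilateral_shift_adj ip E)) e
  (fun n => blinZ _ (blin_shift_adj_iter n.+1).1)
  (fun n x => bnd n (- n.+1%:Z) _ _ (leqnSn n) ((blin_shift_adj_iter n.+1).2 x)).
have -> : toeplitz ip E f =
  (fun x => nsum (fun n => (fourier f n%:Z *: iter n (unilateral_shift ip E)) x)) +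
  (fun x => nsum (fun n => (fourier f (- n.+1%:Z) *: iter n.+1 (unilateral_shift_adj ip E)) x)).
  by apply/funext => x.
split=> [|k l]; first exact: blinD.
rewrite entD.
have [lk|kl] := leqP l k.
  rewrite (csums_uniq (e1 k l) (b := fourier f (k%:Z - l%:Z))); last first.
    have -> : k%:Z - l%:Z = (k - l)%N by lia.
    rewrite (_ : (fun j => _) = fun j => if j == (k - l)%N then fourier f (k - l)%N else 0).
      exact: csums_single.
    apply/funext => j; rewrite entZ /entry.
    have [kj|jk] := ltnP k j.
      by rewrite shift_iter_coord0 // mulr0 ifF //; apply/eqP; lia.
    rewrite -{1}(subnKC jk) shift_iter_coord ipE.
    case: eqP => h1; case: eqP => h2; rewrite ?mulr1 ?mulr0 //; try lia.
    by rewrite h2.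
  rewrite (csums_uniq (e2 k l) (b := 0)) ?addr0 //.
  rewrite (_ : (fun j => _) = fun=> 0); first exact: csums0.
  apply/funext => j; rewrite entZ /entry shift_adj_iter_coord ipE.
  by case: eqP => h; rewrite ?mulr0 //; lia.
rewrite (csums_uniq (e1 k l) (b := 0)); last first.
  rewrite (_ : (fun j => _) = fun=> 0); first exact: csums0.
  apply/funext => j; rewrite entZ /entry.
  have [kj|jk] := ltnP k j; first by rewrite shift_iter_coord0 // mulr0.
  rewrite -{1}(subnKC jk) shift_iter_coord ipE.
  by case: eqP => h; rewrite ?mulr0 //; lia.
rewrite add0r; apply: csums_uniq (e2 k l) _.
rewrite (_ : (fun j => _) = fun j => if j == (l - k).-1 then fourier f (k%:Z - l%:Z) else 0).
  exact: csums_single.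
apply/funext => j; rewrite entZ /entry shift_adj_iter_coord ipE.
case: eqP => h1; case: eqP => h2; rewrite ?mulr1 ?mulr0 //; try lia.
congr fourier; lia.
Qed.

(** The inner series uses two orders in [l]; two orders in [k] remain for the outer one. *)
Lemma matrix_op_blin c : mdecay c ->
  blin (matrix_op ip E c) /\ forall k l, entry (matrix_op ip E c) k l = c k l.
Proof.
move=> hc; have [e he] := hc 2%N.
have row k : blin (fun x => nsum (fun l => (c k l *: matrix_unit ip E k l) x)) /\
    (forall i l, csums (fun j => entry (c k j *: matrix_unit ip E k j) i l)
      (entry (fun x => nsum (fun l => (c k l *: matrix_unit ip E k l) x)) i l)).
  apply: (@blin_nsum (fun l => c k l *: matrix_unit ip E k l) e).
    by move=> l; apply/blinZ/blin_matrix_unit.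
  move=> l x; rewrite nrmZ mulrAC ler_wpM2 ?nrm_ge0 //.
  - by rewrite mulr_ge0 ?nrm_ge0 // exprn_ge0 // addr_ge0.
  - apply: le_trans (he k l); rewrite mulrC ler_wpM2r ?nrm_ge0 //.
    by rewrite ler_peMl ?wgtX_ge0 ?wgtX_ge1.
  by rewrite nrmZ nrmEk mulr1 coord_le.
have bb k x : nrm (nsum (fun l => c k l *: matrix_unit ip E k l x)) * (1 + k%:R) ^+ 2 <=
    2 * e * nrm x.
  have k0 : 0 < (1 + k%:R) ^+ 2 :> R by rewrite exprn_gt0 // wgt_gt0.
  rewrite -ler_pdivlMr //.
  have bk j : nrm (c k j *: matrix_unit ip E k j x) * (1 + j%:R) ^+ 2 <=
      e * nrm x / (1 + k%:R) ^+ 2.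
    rewrite ler_pdivlMr // nrmZ /matrix_unit nrmZ nrmEk mulr1.
    rewrite [leLHS](_ : _ = (wgt R k ^+ 2 * wgt R j ^+ 2 * nrm (c k j)) * nrm (ip x (E j))); last first.
      by rewrite /wgt; ring.
    rewrite ler_wpM2 ?nrm_ge0 ?coord_le //.
    by rewrite mulr_ge0 ?nrm_ge0 // mulr_ge0 ?wgtX_ge0.
  have -> : 2 * e * nrm x / (1 + k%:R) ^+ 2 = 2 * (e * nrm x / (1 + k%:R) ^+ 2) by ring.
  exact: nrm_sum_lim bk (nsum_cvg bk).
have [b2 e2] := @blin_nsum _ (2 * e) (fun k => (row k).1) bb.
split=> [//|i l].
apply: csums_uniq (e2 i l) _.
rewrite (_ : (fun j => _) = fun j => if j == i then c i l else 0).
  exact: csums_single.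
apply/funext => k; apply: csums_uniq ((row k).2 i l) _.
rewrite (_ : (fun j => _) = fun j => if j == l then (if k == i then c i l else 0) else 0).
  exact: csums_single.
apply/funext => j; rewrite entZ ent_matrix_unit eq_sym [l == j]eq_sym.
by case: eqP => [->|_] /=; case: eqP => [->|_]; rewrite ?mulr1 ?mulr0.
Qed.

End Operators.

(** * Smooth Toeplitz operators and their derivations *)

Section RapidDecayMatrices.
Variable R : realType.

Lemma le_Re_nrm (V : normedZmodType R[i]) (x : V) (B : R[i]) :
  `|x| <= B -> nrm x <= complex.Re B.
Proof. by rewrite nrmE lecE /= => /andP[]. Qed.

Lemma natrC (k : nat) : (1 + k%:R : R[i]) = (wgt R k)%:C.
Proof. by rewrite rmorphD rmorph1 rmorph_nat. Qed.

Lemma nrm_wgt k N : nrm ((1 + k%:R : R[i]) ^+ N) = wgt R k ^+ N.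
Proof. by rewrite nrmX natrC nrm_real ger0_norm // wgt_ge0. Qed.

Lemma nat_le_wgt k : k%:R <= wgt R k.
Proof. by rewrite lerDr. Qed.

Lemma poly_nat_bound (p : {poly R[i]}) :
  exists N (B : R), 0 <= B /\ forall k, nrm p.[k%:R] <= B * wgt R k ^+ N.
Proof.
elim/poly_ind: p => [|p c [N [B [B0 h]]]].
  by exists 0%N, 0; split=> // k; rewrite horner0 nrm0 mul0r.
exists N.+1, (B + nrm c); split; first by rewrite addr_ge0 ?nrm_ge0.
move=> k; rewrite hornerMXaddC; apply: le_trans (ler_nrmD _ _) _.
rewrite mulrDl; apply: lerD; last by rewrite ler_peMr ?nrm_ge0 ?wgtX_ge1.
rewrite nrmM nrm_nat exprSr mulrA; apply: ler_pM; rewrite ?nrm_ge0 //.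
exact: nat_le_wgt.
Qed.

Lemma poly2_nat_bound (p : {poly {poly R[i]}}) :
  exists N (B : R), 0 <= B /\
    forall k l, nrm p.[k%:R, l%:R] <= B * (wgt R k ^+ N * wgt R l ^+ N).
Proof.
elim/poly_ind: p => [|p c [N [B [B0 h]]]].
  by exists 0%N, 0; split=> // k l; rewrite !horner0 nrm0 mul0r.
have [M [D [D0 hD]]] := poly_nat_bound c.
exists (N.+1 + M)%N, (B + D); split; first exact: addr_ge0.
move=> k l; rewrite hornerMXaddC hornerD hornerM hornerC.
apply: le_trans (ler_nrmD _ _) _; rewrite mulrDl; apply: lerD.
  rewrite nrmM nrm_nat.
  apply: (@le_trans _ _ (B * (wgt R k ^+ N * wgt R l ^+ N) * wgt R k)).
    by apply: ler_pM; rewrite ?nrm_ge0 // nat_le_wgt.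
  rewrite -mulrA ler_wpM2l // mulrAC -exprSr.
  by apply: ler_pM; rewrite ?wgtX_ge0 // wgtX_le //; lia.
apply: le_trans (hD l) _; rewrite ler_wpM2l //.
rewrite -[leLHS]mul1r; apply: ler_pM; rewrite ?wgtX_ge0 ?wgtX_ge1 // wgtX_le //; lia.
Qed.

(** One direction tests with [(1 + X)^N (1 + Y)^N]; conversely such a product dominates any
    polynomial on pairs of naturals. *)
Lemma rapid_decay2P (c : nat -> nat -> R[i]) : rapid_decay2 c <-> mdecay c.
Proof.
split=> [h N|h p].
  have [B hB] := h (('X + 1) ^+ N * ((('X + 1) ^+ N : {poly R[i]})%:P)).
  exists (complex.Re B) => k l; have := le_Re_nrm (hB k l).
  rewrite hornerM horner_exp hornerD hornerX !hornerC hornerM !horner_exp.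
  rewrite !hornerD !hornerX !hornerC !nrmM.
  by rewrite ![_ + 1]addrC !nrm_wgt.
have [N [B [B0 hB]]] := poly2_nat_bound p; have [e he] := h N.
exists (B * e)%:C => k l; rewrite nrmE lecR nrmM.
apply: le_trans (ler_wpM2r (nrm_ge0 _) (hB k l)) _.
by rewrite -mulrA ler_wpM2l //; exact: he.
Qed.

Lemma rapid_decayP (x : nat -> R[i]) : rapid_decay x <-> sdecay x.
Proof.
split=> [h N|h p].
  have [B hB] := h (('X + 1) ^+ N).
  exists (complex.Re B) => k; have := le_Re_nrm (hB k).
  by rewrite horner_exp hornerD hornerX hornerC nrmM addrC nrm_wgt mulrC.
have [N [B [B0 hB]]] := poly_nat_bound p; have [e he] := h N.
exists (B * e)%:C => k; rewrite nrmE lecR nrmM.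
apply: le_trans (ler_wpM2r (nrm_ge0 _) (hB k)) _.
by rewrite -mulrA ler_wpM2l // mulrC; exact: he.
Qed.

Lemma decay_seminorm_term M N (c : nat -> nat -> R[i]) k l :
  complex.Re `|(1 + k%:R) ^+ M * (1 + l%:R) ^+ N * c k l| =
  wgt R k ^+ M * wgt R l ^+ N * nrm (c k l).
Proof. by rewrite -/(nrm _) !nrmM !nrm_wgt. Qed.

(** Decay is required first, because [sup] bounds a set only when the set is bounded above. *)
Lemma mbd_decay_seminorm N (c : nat -> nat -> R[i]) : mdecay c ->
  mbd N (decay_seminorm N N c) c.
Proof.
move=> hc k l; rewrite -decay_seminorm_term; apply: ub_le_sup; last by exists (k, l).
have [e he] := hc N; exists e => _ [[i j] _ <-].
by rewrite (decay_seminorm_term N N c i j); exact: he.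
Qed.

Lemma decay_seminorm_le L M N (e : R) (c : nat -> nat -> R[i]) :
  (M <= L)%N -> (N <= L)%N -> mbd L e c -> decay_seminorm M N c <= e.
Proof.
move=> ML NL hc; apply: ge_sup.
  by exists (complex.Re `|(1 + 0%:R) ^+ M * (1 + 0%:R) ^+ N * c 0%N 0%N|), (0%N, 0%N).
move=> _ [[i j] _ <-]; rewrite (decay_seminorm_term M N c i j); apply: le_trans (hc i j).
by rewrite ler_wpM2r ?nrm_ge0 // ler_pM ?wgtX_ge0 // wgtX_le.
Qed.

End RapidDecayMatrices.

(** * Matrix description of the smooth Toeplitz algebra *)

Section SmoothToeplitz.
Variables (R : realType) (H : completeNormedModType R[i]).
Variables (ip : {dot H for Num.conj}) (E : nat -> H).
Hypotheses (hH : is_hilbert_norm ip) (hE : is_orthonormal_basis ip E).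
Implicit Types (x y z : H) (a b : H -> H) (f F : R -> R[i]) (h : int -> R[i]).
Implicit Type c : nat -> nat -> R[i].
Local Notation ent := (entry ip E).

Lemma blin_toeplitz f : zdecay (fourier f) -> blin (toeplitz ip E f).
Proof. by case/(toeplitz_blin hH hE). Qed.

Lemma ent_toeplitz f k l : zdecay (fourier f) ->
  ent (toeplitz ip E f) k l = toepm (fourier f) k l.
Proof. by case/(toeplitz_blin hH hE). Qed.

Lemma blin_matrix_op c : mdecay c -> blin (matrix_op ip E c).
Proof. by case/(matrix_op_blin hH hE). Qed.

Lemma ent_matrix_op c k l : mdecay c -> ent (matrix_op ip E c) k l = c k l.
Proof. by case/(matrix_op_blin hH hE). Qed.

Lemma toeplitz_repr a h c : blin a -> zdecay h -> mdecay c ->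
  (forall k l, ent a k l = toepm h k l + c k l) ->
  a = toeplitz ip E (synth h) + matrix_op ip E c.
Proof.
move=> ha hh hc e; have zh : zdecay (fourier (synth h)) by rewrite fourier_synth.
apply: (blin_eq hH hE) => // [|k l].
  by apply: blinD; [exact: blin_toeplitz|exact: blin_matrix_op].
by rewrite entD ent_toeplitz // ent_matrix_op // fourier_synth.
Qed.

(** The bridge to matrices: from here membership is a statement about entries, and [synth] supplies
    the function with given coefficients. *)
Lemma smooth_toeplitzP a : smooth_toeplitz ip E a <->
  blin a /\ exists h c, [/\ zdecay h, mdecay c &
                           forall k l, ent a k l = toepm h k l + c k l].
Proof.
split=> [[f [c [sf /rapid_decay2P hc ->]]]|[ha [h [c [hh hc e]]]]].
  have zf := fourier_zdecay sf; split.
    by apply: blinD; [exact: blin_toeplitz|exact: blin_matrix_op].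
  exists (fourier f), c; split=> // k l.
  by rewrite entD ent_toeplitz // ent_matrix_op.
exists (synth h), c; split; [exact: synth_smooth|exact/rapid_decay2P|].
exact: toeplitz_repr.
Qed.

Lemma smooth_toeplitz_blin a : smooth_toeplitz ip E a -> blin a.
Proof. by move=> /smooth_toeplitzP[]. Qed.

Lemma smooth_toeplitz_banded a : smooth_toeplitz ip E a -> banded 0 (ent a).
Proof.
move=> /smooth_toeplitzP[_ [h [c [hh hc e]]]].
have -> : ent a = fun k l => toepm h k l + c k l.
  by apply/funext => k; apply/funext => l.
by apply: bandedD; [exact: banded_toepm|exact: banded_mdecay].
Qed.

Lemma zdecay0 : zdecay (fun=> 0 : R[i]).
Proof. by move=> N; exists 0 => n; rewrite nrm0 mulr0. Qed.

Lemma smooth_toeplitz_of_decay a : blin a -> mdecay (ent a) -> smooth_toeplitz ip E a.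
Proof.
move=> ha hm; apply/smooth_toeplitzP; split=> //; exists (fun=> 0), (ent a).
by split=> // [|k l]; [exact: zdecay0|rewrite add0r].
Qed.

Lemma smooth_compact_of_decay a : blin a -> mdecay (ent a) -> smooth_compact ip E a.
Proof.
move=> ha hm; exists (ent a); first exact/rapid_decay2P.
apply: (blin_eq hH hE) => // [|k l]; first exact: blin_matrix_op.
by rewrite ent_matrix_op.
Qed.

Definition rdvec x := sdecay (fun k => ip x (E k)).

Lemma rapid_decay_vectorP x : rapid_decay_vector ip E x <-> rdvec x.
Proof. exact: rapid_decayP. Qed.

Lemma rdvecE l : rdvec (E l).
Proof.
move=> N; exists (wgt R l ^+ N) => k; rewrite (ipE hE) nrm_nat.
case: eqP => [->|_]; first by rewrite mul1r.
by rewrite mul0r wgtX_ge0.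
Qed.

(** This makes the commutator with the generator meaningful on rapidly decaying vectors; two orders
    go into summation. *)
Lemma rdvec_banded a x : blin a -> banded 0 (ent a) -> rdvec x -> rdvec (a x).
Proof.
move=> ha hb hx N; have [P hP] := hb N; have [B hB] := hx (N + 2)%N.
exists (2 * (P * B)) => k; have k0 : 0 < wgt R k ^+ N by rewrite exprn_gt0 // wgt_gt0.
rewrite -ler_pdivlMr // -[leRHS]mulrA.
apply: (csums_le (@blin_coord _ _ _ _ hH hE a x k ha)) => j.
rewrite ler_pdivlMr // nrmM.
rewrite [leLHS](_ : _ = (nrm (ent a k j) * wgt R k ^+ N) * (nrm (ip x (E j)) * wgt R j ^+ 2)); last first.
  by rewrite /wgt; ring.
apply: (@le_trans _ _ ((P * wgt R j ^+ N) * (nrm (ip x (E j)) * wgt R j ^+ 2))).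
  apply: ler_wpM2r; first exact: mulr_ge0 (nrm_ge0 _) (wgtX_ge0 _ _ _).
  exact: (@band_col R 0 N P _ j hP k).
rewrite -mulrA ler_wpM2l ?(band_ge0 hP) //; apply: le_trans (hB j).
by rewrite exprD -/(wgt R j) mulrCA mulrA.
Qed.

(** Order 3: one for the factor [k], two for summation. *)
Lemma number_op_cvg x : rdvec x ->
  series (fun k => k%:R *: (ip x (E k) *: E k)) @ \oo --> number_op ip E x.
Proof.
move=> hx; have [A hA] := hx 3%N; apply: (@nsum_cvg _ _ _ A) => j.
apply: le_trans (hA j); rewrite !nrmZ (nrmEk hH hE) mulr1 nrm_nat.
rewrite [leRHS](_ : _ = (1 + j%:R) * nrm (ip x (E j)) * (1 + j%:R) ^+ 2); last by ring.
rewrite ler_wpM2r ?(wgtX_ge0 R j 2) // ler_wpM2r ?nrm_ge0 //; exact: nat_le_wgt.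
Qed.

Lemma number_op_coord x k : rdvec x -> ip (number_op ip E x) (E k) = k%:R * ip x (E k).
Proof.
move=> hx; apply: csums_uniq (@coord_series _ _ _ _ hH hE _ _ k (number_op_cvg hx)) _.
rewrite (_ : (fun j => _) = fun j => if j == k then k%:R * ip x (E k) else 0).
  exact: csums_single.
apply/funext => j; rewrite !ipZl (ipE hE).
by case: eqP => [->|_]; rewrite ?mulr1 ?mulr0.
Qed.

(** * The unbounded generator *)

Section Generator.
Variable F : R -> R[i].
Hypothesis sF : smooth_circle F.
Let zF : zdecay (fourier F) := fourier_zdecay sF.

Lemma zdecay_plus : zdecay (fourier (fourier_plus F)).
Proof.
move=> N; have [e he] := zF N; exists e => n; rewrite fourier_fourier_plus //.
by case: n => n; [exact: he|rewrite nrm0 mulr0 (zbd_ge0 he)].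
Qed.

Lemma zdecay_minus : zdecay (fourier (fourier_minus F)).
Proof.
move=> N; have [e he] := zF N; exists e => n; rewrite fourier_fourier_minus //.
by case: n => n; [rewrite nrm0 mulr0 (zbd_ge0 he)|exact: he].
Qed.

(** For [j <= k] only [F_+] contributes, with the eigenvalue [j] of the number operator applied
    first; for [j > k] only [F_-], with the eigenvalue [k] of the one applied last. Together they
    form [min(k,j)]. *)
Lemma generator_coord x k : rdvec x ->
  csums (fun j => genm (fourier F) k j * ip x (E j)) (ip (delta_generator ip E F x) (E k)).
Proof.
move=> hx; rewrite /delta_generator ipDl.
have ep m := fourier_fourier_plus m zF; have em m := fourier_fourier_minus m zF.
move: (fourier_plus F) (fourier_minus F) zdecay_plus zdecay_minus ep em.
move=> Fp Fm zp zm ep em.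
have bp := blin_toeplitz zp; have bm := blin_toeplitz zm.
have hm : rdvec (toeplitz ip E Fm x).
  apply: rdvec_banded => //.
  have -> : ent (toeplitz ip E Fm) = toepm (fourier Fm).
    by apply/funext => i; apply/funext => j; rewrite ent_toeplitz.
  exact/banded_toepm.
rewrite number_op_coord //.
have c1 := @blin_coord _ _ _ _ hH hE _ (number_op ip E x) k bp.
have c2 := csumsZ (z := k%:R) (@blin_coord _ _ _ _ hH hE _ x k bm).
have := csumsD c1 c2; congr csums; apply/funext => j.
rewrite number_op_coord // (ent_toeplitz k j zp) (ent_toeplitz k j zm).
rewrite /toepm /genm ep em.
have [jk|kj] := leqP j k.
  have -> : k%:Z - j%:Z = Posz (k - j) by lia.
  by rewrite mul0r mulr0 addr0 mulrA.
have -> : k%:Z - j%:Z = Negz (j - k).-1 by lia.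
by rewrite mul0r add0r mulrCA mulrA.
Qed.

(** Since [min(k,l) = l + (k - l)] for [k < l], the generator is the Toeplitz operator of [F] after
    the number operator, plus a bounded Toeplitz operator with these coefficients. *)
Let hneg (n : int) : R[i] := if n is Negz _ then n%:~R * fourier F n else 0.

Let zneg : zdecay hneg.
Proof.
move=> N; have [e he] := zF N.+1; exists e => n; apply: le_trans (he n).
case: n => n /=; first by rewrite nrm0 mulr0 mulr_ge0 ?wgtX_ge0 ?nrm_ge0.
rewrite nrmM mulrA ler_wpM2r ?nrm_ge0 // exprSr ler_wpM2l ?wgtX_ge0 //.
rewrite NegzE mulrNz nrmN -[(n.+1)%:~R]/(n.+1%:R : R[i]) nrm_nat.
exact: nat_le_wgt n.+1.
Qed.

(** The image of [E l] under the generator, written through bounded operators so that series can be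
    pushed through them. *)
Definition generator_col l : H :=
  l%:R *: toeplitz ip E F (E l) + toeplitz ip E (synth hneg) (E l).

Lemma generator_col_coord l k : ip (generator_col l) (E k) = genm (fourier F) k l.
Proof.
rewrite /generator_col.
have es : fourier (synth hneg) = hneg by rewrite fourier_synth.
have zs : zdecay (fourier (synth hneg)) by rewrite es.
move: (synth hneg) zs es => G zs es.
have -> : ip (l%:R *: toeplitz ip E F (E l) + toeplitz ip E G (E l)) (E k) =
    l%:R * ent (toeplitz ip E F) k l + ent (toeplitz ip E G) k l by rewrite ipDl ipZl.
rewrite (ent_toeplitz k l zF) (ent_toeplitz k l zs) es /toepm /genm.
have [lk|kl] := leqP l k.
  have -> : k%:Z - l%:Z = Posz (k - l) by lia.
  by rewrite addr0 mulrC.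
have -> : k%:Z - l%:Z = Negz (l - k).-1 by lia.
rewrite /hneg mulrC [_%:~R * _]mulrC -mulrDr; congr (_ * _).
have -> : Negz (l - k).-1 = k%:Z - l%:Z by lia.
by rewrite intrD mulrNz addrC subrK.
Qed.

(** The generator is not continuous; instead, two bounded operators are passed through the
    convergent series of [number_op ip E x] and of [x]. *)
Lemma generator_series x : rdvec x ->
  series (fun l => ip x (E l) *: generator_col l) @ \oo --> delta_generator ip E F x.
Proof.
move=> hx; have [G [zG egc]] : exists G, zdecay (fourier G) /\ forall l,
    generator_col l = l%:R *: toeplitz ip E F (E l) + toeplitz ip E G (E l).
  by exists (synth hneg); split=> //; rewrite fourier_synth.
move: generator_col generator_col_coord egc => gc cc egc.
have := @generator_coord x ^~ hx; move: (delta_generator ip E F x) => y hy.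
have bF := blin_toeplitz zF; have bN := blin_toeplitz zG.
move: (toeplitz ip E F) (toeplitz ip E G) bF bN egc => TF TG bF bN egc.
pose s1 l := TF (l%:R *: (ip x (E l) *: E l)).
pose s2 l := TG (ip x (E l) *: E l).
have c1 : series s1 @ \oo --> TF (number_op ip E x).
  exact: blin_series bF (number_op_cvg hx).
have c2 : series s2 @ \oo --> TG x by exact: blin_series bN (hE.2 x).
have e l : ip x (E l) *: gc l = s1 l + s2 l.
  rewrite /s1 /s2 egc scalerDr (blin_applyZ l%:R (ip x (E l) *: E l) bF).
  rewrite (blin_applyZ (ip x (E l)) (E l) bF) (blin_applyZ (ip x (E l)) (E l) bN) !scalerA.
  by rewrite [_ * l%:R]mulrC.
have -> : series (fun l => ip x (E l) *: gc l) = series s1 + series s2.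
  apply/funext => n; rewrite /series /=.
  by under eq_bigr do rewrite e; exact: big_split.
have -> : y = TF (number_op ip E x) + TG x; last exact: cvgD.
apply: (coord_inj hE) => k; apply: csums_uniq (hy k) _.
rewrite ipDl.
have h1 := @coord_series _ _ _ _ hH hE _ _ k c1.
have h2 := @coord_series _ _ _ _ hH hE _ _ k c2.
have := csumsD h1 h2; congr csums; apply/funext => l.
by rewrite -ipDl -e ipZl cc mulrC.
Qed.

Lemma generator_comm_r a x k : blin a -> rdvec x ->
  csums (fun l => mulm (ent a) (genm (fourier F)) k l * ip x (E l))
        (ip (a (delta_generator ip E F x)) (E k)).
Proof.
move=> ha hx.
have := @coord_series _ _ _ _ hH hE _ _ k (blin_series ha (generator_series hx)).
congr csums; apply/funext => l; rewrite /= (blin_applyZ _ _ ha) ipZl mulrC; congr (_ * _).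
rewrite -(csumsE (@blin_coord _ _ _ _ hH hE a (generator_col l) k ha)).
by congr csum; apply/funext => j; rewrite generator_col_coord.
Qed.

Lemma generator_comm_l a x k : smooth_toeplitz ip E a -> rdvec x ->
  csums (fun l => mulm (genm (fourier F)) (ent a) k l * ip x (E l))
        (ip (delta_generator ip E F (a x)) (E k)).
Proof.
move=> sa hx; have ha := smooth_toeplitz_blin sa.
have hax : rdvec (a x) by apply: rdvec_banded => //; exact: smooth_toeplitz_banded.
(* The k-th coordinate of the unbounded operator is a bounded functional,
   carried by a matrix with a single nonzero row. *)
pose c i j := if i == k then genm (fourier F) k j else 0.
have hc : mdecay c.
  move=> N; have [P hP] := banded_genm zF N.
  exists (wgt R k ^+ N * (P * wgt R k ^+ (1 + N))) => i j; rewrite /c.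
  case: eqP => [->|_].
    by rewrite -mulrA ler_wpM2l ?wgtX_ge0 // mulrC; exact: band_row hP j.
  by rewrite nrm0 mulr0 !mulr_ge0 ?wgtX_ge0 ?(band_ge0 hP).
have bc := blin_matrix_op hc.
have e1 y : rdvec y -> ip (delta_generator ip E F y) (E k) = ip (matrix_op ip E c y) (E k).
  move=> hy; apply: csums_uniq (@generator_coord y k hy) _.
  have := @blin_coord _ _ _ _ hH hE _ y k bc; congr csums.
  by apply/funext => j; rewrite ent_matrix_op // /c eqxx.
rewrite e1 //; have := @blin_coord _ _ _ _ hH hE _ x k (blin_comp bc ha).
congr csums; apply/funext => l; rewrite (ent_comp hH hE) //; congr (_ * _).
by congr csum; apply/funext => j; rewrite ent_matrix_op // /c eqxx.
Qed.

Lemma generator_commutator a d x : smooth_toeplitz ip E a -> blin d ->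
  (forall k l, ent d k l = commm (genm (fourier F)) (ent a) k l) -> rdvec x ->
  d x = delta_generator ip E F (a x) - a (delta_generator ip E F x).
Proof.
move=> sa hd e hx; apply: (coord_inj hE) => k; rewrite ipBl.
apply: csums_uniq (@blin_coord _ _ _ _ hH hE d x k hd) _.
have := csumsB (@generator_comm_l a x k sa hx)
               (@generator_comm_r a x k (smooth_toeplitz_blin sa) hx).
by congr csums; apply/funext => l; rewrite e mulrBl.
Qed.

End Generator.
End SmoothToeplitz.

(** * The matrix implementing a derivation *)

Section Derivations.
Variables (R : realType) (H : completeNormedModType R[i]).
Variables (ip : {dot H for Num.conj}) (E : nat -> H).
Hypotheses (hH : is_hilbert_norm ip) (hE : is_orthonormal_basis ip E).
Implicit Types (a b : H -> H) (F : R -> R[i]) (h : int -> R[i]).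
Local Notation ent := (entry ip E).
Local Notation P k l := (matrix_unit ip E k%N l%N).
Local Notation ST := (smooth_toeplitz ip E).

Lemma mdecay_column (X : nat -> nat -> R[i]) j : banded 0 X ->
  mdecay (fun k l => if l == 0%N then X k j else 0).
Proof.
move=> hX N; have [Q hQ] := hX N; exists (Q * wgt R j ^+ (0 + N)) => k l.
case: eqP => [->|_]; last first.
  by rewrite nrm0 mulr0 mulr_ge0 ?wgtX_ge0 ?(band_ge0 hQ).
rewrite {2}/wgt addr0 expr1n mulr1 mulrC; exact: band_col hQ k.
Qed.

Lemma mdecay_unit i j : mdecay (fun k l => ((k == i) && (l == j))%:R : R[i]).
Proof.
move=> N; exists (wgt R i ^+ N * wgt R j ^+ N) => k l; rewrite nrm_nat.
case: eqP => [->|_] /=; last by rewrite mulr0 mulr_ge0 ?wgtX_ge0.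
case: eqP => [->|_]; first by rewrite mulr1.
by rewrite mulr0 mulr_ge0 ?wgtX_ge0.
Qed.

Lemma smooth_toeplitz_unit i j : ST (P i j).
Proof.
apply: smooth_toeplitz_of_decay => //; first exact: blin_matrix_unit.
have -> : ent (P i j) = fun k l => ((k == i) && (l == j))%:R.
  by apply/funext => k; apply/funext => l; rewrite ent_matrix_unit.
exact: mdecay_unit.
Qed.

(** The product has one nonzero column, taken from the banded matrix of [a], hence rapid decay. *)
Lemma smooth_toeplitz_comp_unit a l : ST a -> ST (a \o P l 0).
Proof.
move=> sa; have ha := smooth_toeplitz_blin hH hE sa.
apply: smooth_toeplitz_of_decay => //.
  by apply: blin_comp => //; exact: blin_matrix_unit.
have -> : ent (a \o P l 0) = fun i j => if j == 0%N then ent a i l else 0.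
  apply/funext => i; apply/funext => j; rewrite /entry /= /matrix_unit (ipE hE).
  case: eqP => _; first by rewrite scale1r.
  by rewrite scale0r (blin_apply0 ha) ip0l.
exact/mdecay_column/(smooth_toeplitz_banded hH hE sa).
Qed.

Lemma smooth_toeplitz_scale (t : R[i]) a : ST a -> ST (t *: a).
Proof.
move=> /(smooth_toeplitzP hH hE) [ha [h [c [hh hc e]]]].
apply/(smooth_toeplitzP hH hE); split; first exact: blinZ.
exists (fun n => t * h n), (fun k l => t * c k l); split.
- move=> N; have [B hB] := hh N; exists (nrm t * B) => n.
  by rewrite nrmM mulrCA ler_wpM2l ?nrm_ge0.
- by move=> N; have [B hB] := hc N; exists (nrm t * B); exact: mbdZ.
by move=> k l; rewrite entZ e mulrDr.
Qed.

Lemma unit_comp_unit a k l : blin a -> P 0 k \o (a \o P l 0) = ent a k l *: P 0 0.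
Proof.
move=> ha; apply/funext => x; rewrite /= /matrix_unit (blin_applyZ _ _ ha) ipZl.
by rewrite mulrC -scalerA.
Qed.

Variable delta : (H -> H) -> (H -> H).
Hypothesis hd : is_derivation ip E delta.

Lemma derivation_ST a : ST a -> ST (delta a).
Proof. by case: hd => h _ _; exact: h. Qed.

Lemma derivation_blin a : ST a -> blin (delta a).
Proof. by move=> /derivation_ST /(smooth_toeplitz_blin hH hE). Qed.

Lemma derivationD a b : ST a -> ST b -> delta (a + b) = delta a + delta b.
Proof.
by case: hd => _ h _ sa sb; have := h 1 a b sa sb; rewrite !scale1r.
Qed.

Lemma derivationZ (t : R[i]) a : ST a -> delta (t *: a) = t *: delta a.
Proof.
case: hd => _ h _ sa; have s0 : ST 0 by rewrite -(scale0r a); exact: smooth_toeplitz_scale.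
have d0 : delta 0 = 0.
  have := derivationD s0 s0; rewrite addr0.
  by move/(congr1 (fun z => z - delta 0)); rewrite subrr addrK => <-.
by have := h t a 0 sa s0; rewrite !addr0 d0 addr0.
Qed.

Lemma derivation_ent_comp a b k l : ST a -> ST b ->
  ent (delta (a \o b)) k l = mulm (ent a) (ent (delta b)) k l +
                             mulm (ent (delta a)) (ent b) k l.
Proof.
case: hd => _ _ h sa sb; rewrite h // entD !(ent_comp hH hE) //.
  exact: derivation_blin.
exact: smooth_toeplitz_blin sa.
Qed.

Definition implementer j l : R[i] := ent (delta (P l 0)) j 0.

Lemma mulm_unit_row (X : nat -> nat -> R[i]) k l : mulm (ent (P 0 k)) X 0 l = X k l.
Proof.
apply: csumsE; rewrite (_ : (fun j => _) = fun j => if j == k then X k l else 0).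
  exact: csums_single.
apply/funext => j; rewrite (ent_matrix_unit hE) eqxx /=.
by case: eqP => [->|_]; rewrite ?mul1r ?mul0r.
Qed.

Lemma mulm_unit_col (X : nat -> nat -> R[i]) k l : mulm X (ent (P l 0)) k 0 = X k l.
Proof.
apply: csumsE; rewrite (_ : (fun j => _) = fun j => if j == l then X k l else 0).
  exact: csums_single.
apply/funext => j; rewrite (ent_matrix_unit hE) eqxx andbT.
by case: eqP => [->|_]; rewrite ?mulr1 ?mulr0.
Qed.

(** [P_00] is idempotent, so Leibniz' rule equates the entry with twice itself. *)
Lemma derivation_unit00 : ent (delta (P 0 0)) 0 0 = 0.
Proof.
have := derivation_ent_comp 0 0 (smooth_toeplitz_unit 0 0) (smooth_toeplitz_unit 0 0).
have -> : P 0 0 \o P 0 0 = P 0 0.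
  apply/funext => x; rewrite /= /matrix_unit ipZl (ipE hE) eqxx mulr1 //.
rewrite mulm_unit_row mulm_unit_col => /eqP.
by rewrite -subr_eq subrr eq_sym => /eqP.
Qed.

(** Leibniz' rule on [P_0k P_j0], a multiple of [P_00]. Row [k] of the implementer is thus minus a
    row of the bounded operator [delta (P_0k)], which makes products with it converge. *)
Lemma implementer_row k j : ent (delta (P 0 k)) 0 j = - implementer k j.
Proof.
have := derivation_ent_comp 0 0 (smooth_toeplitz_unit 0 k) (smooth_toeplitz_unit j 0).
rewrite mulm_unit_row mulm_unit_col.
have -> : P 0 k \o P j 0 = (j == k)%:R *: P 0 0.
  apply/funext => x; rewrite /= /matrix_unit ipZl (ipE hE).
  by rewrite mulrC -scalerA.
rewrite derivationZ ?entZ; last exact: smooth_toeplitz_unit.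
rewrite derivation_unit00 mulr0 => /eqP; rewrite eq_sym addr_eq0 => /eqP e.
by rewrite /implementer e opprK.
Qed.

(* Leibniz' rule on P_{0k} a P_{l0} = a_{kl} P_{00} expresses the entry of
   delta a at (k, l) through the entries of a alone. *)
Lemma derivation_entE a k l : ST a ->
  csums (fun j => implementer k j * ent a j l) (mulm implementer (ent a) k l) /\
  ent (delta a) k l = commm implementer (ent a) k l.
Proof.
move=> sa; have ha := smooth_toeplitz_blin hH hE sa.
have sb := smooth_toeplitz_comp_unit l sa.
have := derivation_ent_comp 0 0 (smooth_toeplitz_unit 0 k) sb.
rewrite unit_comp_unit // derivationZ ?entZ; last exact: smooth_toeplitz_unit.
rewrite derivation_unit00 mulr0 mulm_unit_row derivation_ent_comp //; last exact: smooth_toeplitz_unit.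
rewrite mulm_unit_col.
have -> : mulm (ent a) (ent (delta (P l 0))) k 0 = mulm (ent a) implementer k l by [].
have c : csums (fun j => implementer k j * ent a j l)
    (- mulm (ent (delta (P 0 k))) (ent (a \o P l 0)) 0 0).
  have eb j : ent (a \o P l 0) j 0 = ent a j l.
    by rewrite /entry /= /matrix_unit (ipE hE) eqxx scale1r.
  have bk := derivation_blin (smooth_toeplitz_unit 0 k).
  have := csumsZ (z := -1) (@blin_coord _ _ _ _ hH hE _ ((a \o P l 0) (E 0)) 0 bk).
  rewrite mulN1r -(ent_comp hH hE _ _ _ bk); congr csums; apply/funext => j.
  by rewrite implementer_row -[ip _ (E j)]/(ent (a \o P l 0) j 0) eb !mulN1r mulNr opprK.
rewrite /commm -{1 3}/(mulm implementer (ent a) k l).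
have -> : mulm implementer (ent a) k l = - mulm (ent (delta (P 0 k))) (ent (a \o P l 0)) 0 0.
  exact: csumsE c.
move=> e; split=> //.
set u := mulm _ (ent (a \o _)) _ _ in e *; set v := mulm (ent a) _ _ _ in e *.
by rewrite -[RHS]addr0 e; ring.
Qed.

Definition shiftU : H -> H := unilateral_shift ip E.

Lemma ent_shiftU k l : ent shiftU k l = (k == l.+1)%:R.
Proof.
rewrite /entry; case: k => [|k]; first by rewrite (shift_coord0 hH hE).
by rewrite (shift_coordS hH hE) (ipE hE) eqSS eq_sym.
Qed.

Lemma blin_shiftU : blin shiftU.
Proof. by have [] := blin_shift_iter hH hE 1. Qed.

Lemma smooth_toeplitz_shiftU : ST shiftU.
Proof.
apply/(smooth_toeplitzP hH hE); split; first exact: blin_shiftU.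
exists (fun n => (n == 1)%:R), (fun _ _ => 0); split.
- move=> N; exists (wgt R 1 ^+ N) => n; rewrite nrm_nat.
  by case: eqP => [->|_]; rewrite ?mulr1 // mulr0 wgtX_ge0.
- by move=> N; exists 0 => k l; rewrite nrm0 mulr0.
by move=> k l; rewrite ent_shiftU addr0 /toepm; congr (_ %:R); lia.
Qed.

Lemma mulm_shiftU_l (X : nat -> nat -> R[i]) k l : mulm (ent shiftU) X k.+1 l = X k l.
Proof.
apply: csumsE; rewrite (_ : (fun j => _) = fun j => if j == k then X k l else 0).
  exact: csums_single.
apply/funext => j; rewrite ent_shiftU eqSS eq_sym.
by case: eqP => [->|_]; rewrite ?mul1r ?mul0r.
Qed.

Lemma mulm_shiftU_r (X : nat -> nat -> R[i]) k l : mulm X (ent shiftU) k l = X k l.+1.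
Proof.
apply: csumsE; rewrite (_ : (fun j => _) = fun j => if j == l.+1 then X k l.+1 else 0).
  exact: csums_single.
apply/funext => j; rewrite ent_shiftU.
by case: eqP => [->|_]; rewrite ?mulr1 ?mulr0.
Qed.

Lemma implementer_decomp : exists F g y, [/\ smooth_circle F, zdecay g, mdecay y &
  forall k l, implementer k l = genm (fourier F) k l + (toepm g k l + y k l)].
Proof.
have /(smooth_toeplitzP hH hE) [_ [b [B [hb hB eU]]]] := derivation_ST smooth_toeplitz_shiftU.
(* The entry [(k + 1, l)] of [delta U] has Toeplitz part [b_(k+1-l)], hence the shift by one. *)
pose b1 n := b (n + 1).
have hb1 : zdecay b1.
  (* Shifting the index costs the factor [2^N], written [wgt R 1 ^+ N]. *)
  move=> N; have [e he] := hb N; exists (wgt R 1 ^+ N * e) => n.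
  apply: (@le_trans _ _ (wgt R 1 ^+ N * (wgt R `|(n + 1)%R|%N ^+ N * nrm (b1 n)))); last first.
    by rewrite ler_wpM2l ?wgtX_ge0 //; exact: he.
  rewrite mulrA -exprMn ler_wpM2r ?nrm_ge0 // lerXn2r ?nnegrE ?mulr_ge0 ?wgt_ge0 //.
  have : wgt R `|n|%N <= wgt R (`|(n + 1)%R|%N + 1) by apply: wgt_le; lia.
  move/le_trans; apply; rewrite /wgt natrD; set m : R := `|(n + 1)%R|%N%:R.
  have : 0 <= m by rewrite ler0n.
  lra.
pose F := synth b1; have fF : fourier F = b1 by rewrite fourier_synth.
pose A k l := implementer k l - genm (fourier F) k l.
(* Subtracting the generator cancels the Toeplitz part of the increments and leaves the compact part
   of [delta U]. *)
have dA k l : diffm A k l = B k.+1 l.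
  have [_ e] := derivation_entE k.+1 l smooth_toeplitz_shiftU.
  move: e; rewrite /commm mulm_shiftU_l mulm_shiftU_r eU => e.
  have {}e : implementer k.+1 l.+1 = implementer k l + (toepm b k.+1 l + B k.+1 l).
    by rewrite e addrC subrK.
  rewrite /diffm /A e fF /genm minnSS -natr1 /toepm /b1.
  have -> : k.+1%:Z - l.+1%:Z + 1 = k.+1%:Z - l%:Z by lia.
  have -> : k%:Z - l%:Z + 1 = k.+1%:Z - l%:Z by lia.
  ring.
have hdA : mdecay (diffm A).
  move=> N; have [e he] := hB N; exists e => k l; rewrite dA.
  apply: le_trans (he k.+1 l); rewrite ler_wpM2r ?nrm_ge0 //.
  by rewrite ler_wpM2r ?wgtX_ge0 // wgtX_le.
(* Border decay: column 0 of the implementer is column 0 of [delta (P_00)], and its row 0 is minus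
   row 0 of the same operator. *)
have bP := smooth_toeplitz_banded hH hE (derivation_ST (smooth_toeplitz_unit 0 0)).
exists F, (diag_limit A), (diag_tail A); split.
- exact: synth_smooth.
- move=> N; have [e he] := hdA (N + 2)%N; have [Q hQ] := bP N.
  exists (Q * wgt R 0 ^+ (0 + N) + 2 * e); apply: diag_limit_bd => // k.
    rewrite /A /genm minn0 mulr0 subr0 mulrC; exact: band_col hQ k.
  rewrite /A /genm min0n mulr0 subr0 -[implementer 0 k]opprK -implementer_row nrmN mulrC.
  exact: band_row hQ k.
- by move=> N; have [e he] := hdA (N + 2)%N; exists (2 * e); exact: diag_tail_bd.
by move=> k l; rewrite -diag_decomp // /A subrKC.
Qed.

End Derivations.

(** * Uniqueness of the symbol *)

Section DerivationTheorem.
Variables (R : realType) (H : completeNormedModType R[i]).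
Variables (ip : {dot H for Num.conj}) (E : nat -> H).
Hypotheses (hH : is_hilbert_norm ip) (hE : is_orthonormal_basis ip E).
Implicit Types (a b : H -> H) (F : R -> R[i]) (f g h : int -> R[i]).
Implicit Types (c y : nat -> nat -> R[i]).
Local Notation ent := (entry ip E).
Local Notation ST := (smooth_toeplitz ip E).

Lemma zbd_le N (e e' : R) h : e <= e' -> zbd N e h -> zbd N e' h.
Proof. by move=> ee hh n; exact: le_trans (hh n) ee. Qed.

Lemma mbd_le N (e e' : R) c : e <= e' -> mbd N e c -> mbd N e' c.
Proof. by move=> ee hc k l; exact: le_trans (hc k l) ee. Qed.

Lemma common_bd N h c : zdecay h -> mdecay c -> exists e : R, zbd N e h /\ mbd N e c.
Proof.
move=> hh hc; have [e1 h1] := hh N; have [e2 h2] := hc N.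
exists (Num.max e1 e2); split.
  by apply: zbd_le h1; rewrite le_max lexx.
by apply: mbd_le h2; rewrite le_max lexx orbT.
Qed.

Lemma commm_toepm_decay g y f c : zdecay g -> mdecay y -> zdecay f -> mdecay c ->
  mdecay (commm (fun k l => toepm g k l + y k l) (fun k l => toepm f k l + c k l)).
Proof.
move=> hg hy hf hc N.
have [r [h1 h2]] := common_bd (N + 2) hg hy.
have [e [h3 h4]] := common_bd (N + 2) hf hc.
by exists (16 * (r * e)); exact: commm_toepm_bounded.
Qed.

(** The entries on a diagonal are constant, while [c] becomes arbitrarily small far out. This is the
    uniqueness of the decomposition [T(f) + c]. *)
Lemma toepm_decay_eq0 f c : mdecay c -> (forall k l, toepm f k l = c k l) ->
  forall n, f n = 0.
Proof.
move=> hc e n; have [B hB] := hc 1%N.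
have key (j : nat) : wgt R j * nrm (f n) <= B.
  have [k [l [kj lj ->]]] : exists k l, [/\ (j <= k)%N, (j <= l)%N & n = k%:Z - l%:Z].
    case: n => n; first by exists (n + j)%N, j; split; lia.
    by exists j, (n.+1 + j)%N; split; lia.
  apply: le_trans (hB k l); rewrite -e /toepm ler_wpM2r ?nrm_ge0 //.
  rewrite !expr1 -[leLHS]mulr1; apply: ler_pM; rewrite ?wgt_ge0 ?wgt_ge1 //.
  exact: wgt_le.
apply/nrm0_eq0/eqP/negP => /negP n0.
have p : 0 < nrm (f n) by rewrite lt_def n0 nrm_ge0.
have := key (Num.truncn (B / nrm (f n))).+1; rewrite -ler_pdivlMr // leNgt.
by rewrite (lt_le_trans (truncnS_gt _)) // /wgt lerDr.
Qed.

Lemma generator_ent F k l : smooth_circle F ->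
  ip (delta_generator ip E F (E l)) (E k) = genm (fourier F) k l.
Proof.
move=> sF; apply: csums_uniq (@generator_coord _ _ _ _ hH hE F sF (E l) k (rdvecE hE l)) _.
rewrite (_ : (fun j => _) = fun j => if j == l then genm (fourier F) k l else 0).
  exact: csums_single.
apply/funext => j; rewrite (ipE hE) eq_sym.
by case: eqP => [->|_]; rewrite ?mulr1 ?mulr0.
Qed.

Lemma shiftUE l : shiftU ip E (E l) = E l.+1.
Proof.
apply: (coord_inj hE) => k; rewrite -[LHS]/(ent (shiftU ip E) k l) (ent_shiftU hH hE).
by rewrite (ipE hE) eq_sym.
Qed.

(** Entry [(k + 1, l)] of the commutator of the generator with the shift is [F_(k-l)] times
    [min(k+1,l+1) - min(k,l) = 1], so [delta U] determines [F] up to rapid decay. *)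
Lemma shiftU_symbol F dF dt (delta : (H -> H) -> (H -> H)) : smooth_circle F ->
  is_delta ip E F dF -> (forall a, ST a -> smooth_compact ip E (dt a)) ->
  (forall a, ST a -> delta a = dF a + dt a) ->
  exists2 c, mdecay c & forall k l,
    ent (delta (shiftU ip E)) k.+1 l = toepm (fourier F) k l + c k l.
Proof.
move=> sF hF hc e; have sU := smooth_toeplitz_shiftU hH hE.
have [_ hx] := hF _ sU; have [c /rapid_decay2P rc ec] := hc _ sU.
exists (fun k l => c k.+1 l) => [N|k l].
  have [B hB] := rc N; exists B => k l; apply: le_trans (hB k.+1 l).
  rewrite ler_wpM2r ?nrm_ge0 // ler_wpM2r ?wgtX_ge0 //.
  exact: wgtX_le.
rewrite e // entD ec (ent_matrix_op hH hE) //; congr (_ + _).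
rewrite /entry hx; last first.
  by apply/rapid_decay_vectorP; exact: rdvecE.
have gE i j := generator_ent i j sF.
move: (delta_generator ip E F) gE => G gE.
rewrite ipBl shiftUE (shift_coordS hH hE) !gE.
rewrite /genm /toepm minnSS -natr1.
have -> : k.+1%:Z - l.+1%:Z = k%:Z - l%:Z by lia.
ring.
Qed.

(** * The decomposition and continuity *)

Section Decomposition.
Variable delta : (H -> H) -> (H -> H).
Hypothesis hd : is_derivation ip E delta.
Variables (F : R -> R[i]) (g : int -> R[i]) (y : nat -> nat -> R[i]).
Hypotheses (sF : smooth_circle F) (hg : zdecay g) (hy : mdecay y).
Hypothesis impl : forall k l,
  implementer ip E delta k l = genm (fourier F) k l + (toepm g k l + y k l).

Let gy k l := toepm g k l + y k l.

Let zF : zdecay (fourier F) := fourier_zdecay sF.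

Let bgy : banded 0 gy.
Proof. by apply: bandedD; [exact: banded_toepm|exact: banded_mdecay]. Qed.

Lemma derivation_ent_split a k l : ST a ->
  ent (delta a) k l = commm (genm (fourier F)) (ent a) k l + commm gy (ent a) k l.
Proof.
move=> sa; have [_ ->] := derivation_entE hH hE hd k l sa.
have -> : implementer ip E delta = fun k l => genm (fourier F) k l + gy k l.
  by apply/funext => i; apply/funext => j; exact: impl.
apply: commmDl (banded_genm zF) (bandedW (leq0n 1) bgy) _.
exact: smooth_toeplitz_banded.
Qed.

Definition inner_part : H -> H := toeplitz ip E (synth g) + matrix_op ip E y.

Let zg : zdecay (fourier (synth g)). Proof. by rewrite fourier_synth. Qed.

Lemma blin_inner_part : blin inner_part.
Proof. by apply: blinD; [exact: blin_toeplitz|exact: blin_matrix_op]. Qed.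

Lemma ent_inner_part : ent inner_part = gy.
Proof.
apply/funext => k; apply/funext => l.
by rewrite entD ent_toeplitz // ent_matrix_op // fourier_synth.
Qed.

Lemma smooth_toeplitz_inner_part : ST inner_part.
Proof.
apply/(smooth_toeplitzP hH hE); split; first exact: blin_inner_part.
by exists g, y; split=> // k l; rewrite ent_inner_part.
Qed.

Definition inner_derivation a : H -> H := (inner_part \o a) - (a \o inner_part).

Lemma blin_inner_derivation a : ST a -> blin (inner_derivation a).
Proof.
move=> sa; have ha := smooth_toeplitz_blin hH hE sa; have hb := blin_inner_part.
by apply: blinB; apply: blin_comp.
Qed.

Lemma ent_inner_derivation a k l : ST a ->
  ent (inner_derivation a) k l = commm gy (ent a) k l.
Proof.
move=> sa; have ha := smooth_toeplitz_blin hH hE sa.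
rewrite entB (ent_comp hH hE _ _ _ blin_inner_part) (ent_comp hH hE _ _ _ ha).
by rewrite ent_inner_part.
Qed.

Lemma inner_derivation_compact a : ST a -> smooth_compact ip E (inner_derivation a).
Proof.
move=> sa; apply: smooth_compact_of_decay => //; first exact: blin_inner_derivation.
have -> : ent (inner_derivation a) = commm gy (ent a).
  by apply/funext => k; apply/funext => l; exact: ent_inner_derivation.
have /(smooth_toeplitzP hH hE) [_ [f [c [hf hc e]]]] := sa.
have -> : ent a = fun k l => toepm f k l + c k l.
  by apply/funext => k; apply/funext => l.
exact: commm_toepm_decay.
Qed.

(** With [dF] defined by subtraction the decomposition is automatic; what remains is that the
    difference stays in the algebra and acts as the commutator on rapidly decaying vectors. *)
Lemma derivation_sub_inner : is_delta ip E F (fun a => delta a - inner_derivation a).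
Proof.
move=> a sa; have bd : blin (delta a - inner_derivation a).
  by apply: blinB; [exact: (derivation_blin hH hE hd)|exact: blin_inner_derivation].
have ed k l : ent (delta a - inner_derivation a) k l = commm (genm (fourier F)) (ent a) k l.
  by rewrite entB derivation_ent_split // ent_inner_derivation // addrK.
split; last by move=> x /rapid_decay_vectorP hx; exact: generator_commutator ed hx.
apply/(smooth_toeplitzP hH hE); split=> //.
have /(smooth_toeplitzP hH hE) [_ [f [c [hf hc e]]]] := sa.
have [h [d [hh hdd e' _]]] := commm_genm zF hf hc.
exists h, d; split=> // k l; rewrite ed -e'.
have -> // : ent a = fun k l => toepm f k l + c k l.
by apply/funext => i; apply/funext => j; exact: e.
Qed.

Lemma derivation_ball (n : nat) (r : R) : 0 < r ->
  exists n' (r' : R), 0 < r' /\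
    forall a, toeplitz_ball ip E n' r' a -> toeplitz_ball ip E n r (delta a).
Proof.
(* [synth_seminorm] costs two orders, [commm_genm] four more. *)
move=> r0; pose N := (n + 2)%N.
have [A [hA _]] := common_bd (N + 4) zF hy.
have [B [hB hB']] := common_bd (N + 2) hg hy.
have A0 := zbd_ge0 hA; have B0 := zbd_ge0 hB.
pose p2 : R := (2 * pi) ^+ n.
have p20 : 0 <= p2 by rewrite exprn_ge0 // mulr_ge0 // pi_ge0.
(* The first summand bounds the seminorms of the symbol, the next two the rapidly decaying parts due
   to the generator and to [inner_part]; the 1 makes [K] positive. *)
pose K : R := 4 * p2 * (10 * A) + 12 * A + 16 * B + 1.
have pA : 0 <= p2 * A by exact: mulr_ge0.
have K0 : 0 < K by rewrite /K; lra.
exists (N + 4)%N, (r / (5 * K)); split; first by rewrite divr_gt0 // mulr_gt0.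
move=> a [f [c [sf /rapid_decay2P hc ea hf1 hc1]]].
(* [fourier_zbd] multiplies the radius by 4; with the denominator [5 * K] this leaves
   [e * K = 4 r / 5], strictly below [r]. *)
pose e : R := 4 * (r / (5 * K)).
have e0 : 0 < e by rewrite mulr_gt0 // divr_gt0 // mulr_gt0.
have eK : e * K < r.
  have -> : e * K = 4 / 5 * r.
    by rewrite /e; field; rewrite lt0r_neq0.
  lra.
have zf := fourier_zdecay sf.
have hf : zbd (N + 4) e (fourier f).
  by apply: fourier_zbd => // k kN; apply: ltW; exact: hf1.
have hce : mbd (N + 4) e c.
  apply: mbd_le (mbd_decay_seminorm (N + 4) hc).
  apply: ltW; apply: lt_le_trans (hc1 _ _ (leqnn _) (leqnn _)) _.
  by rewrite /e ler_peMl ?ltW // ?divr_gt0 ?mulr_gt0 //; lra.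
have sa : ST a by exists f, c; split=> //; exact/rapid_decay2P.
have ent_a : ent a = fun k l => toepm (fourier f) k l + c k l.
  apply/funext => k; apply/funext => l; rewrite ea entD.
  by rewrite (ent_toeplitz hH hE) // (ent_matrix_op hH hE).
have [h [d [hh hdd ed bds]]] := commm_genm zF zf hc.
have [bh bd] := bds N A e hA hf hce.
pose d' k l := d k l + commm gy (ent a) k l.
have hdec : mdecay (commm gy (ent a)) by rewrite ent_a; exact: commm_toepm_decay.
have bd' : mbd N (12 * (A * e) + 16 * (B * e)) d'.
  apply: mbdD => //; rewrite ent_a; apply: commm_toepm_bounded => //.
    by apply: zbdW hf; rewrite leq_add2l.
  by apply: mbdW hce; rewrite leq_add2l.
exists (synth h), d'; split.
- exact: synth_smooth.
- by apply/rapid_decay2P; apply: mdecayD.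
- apply: (toeplitz_repr hH hE) => //; first exact: (derivation_blin hH hE hd).
    exact: mdecayD.
  by move=> k l; rewrite derivation_ent_split // ent_a ed -addrA -ent_a.
- move=> k kn; have hk : zbd (k + 2) (10 * (A * e)) h.
    by apply: zbdW bh; rewrite leq_add2r.
  apply: le_lt_trans (synth_seminorm hh hk) _; apply: le_lt_trans eK.
  have pk : (2 * pi) ^+ k <= p2.
    by rewrite ler_weXn2l //; have := pi_ge2 R; lra.
  have pe : 0 <= A * e by rewrite mulr_ge0 // ltW.
  have := ler_wpM2r pe pk; rewrite /K.
  have q1 : 0 <= e * A by rewrite mulr_ge0 // ltW.
  have q2 : 0 <= e * B by rewrite mulr_ge0 // ltW.
  nra.
- move=> M M' hM hM'; have hM2 : (M <= N)%N by rewrite (leq_trans hM) // leq_addr.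
  have hM2' : (M' <= N)%N by rewrite (leq_trans hM') // leq_addr.
  apply: le_lt_trans (decay_seminorm_le hM2 hM2' bd') _; apply: le_lt_trans eK.
  have q3 : 0 <= e * (p2 * A) by rewrite mulr_ge0 // ltW.
  rewrite /K; nra.
Qed.

(** Neighbourhoods are translates of those of 0 and [delta] is linear, so the estimate at 0
    suffices. *)
Lemma derivation_continuous : toeplitz_continuous ip E delta.
Proof.
move=> a sa S [[n r] /= r0 hS].
have [n' [r' [r'0 hb]]] := derivation_ball n r0.
exists (n', r') => //= b hba; apply: hS => /=.
have sba : ST (b - a) by case: hba => f [c [h1 h2 h3 _ _]]; exists f, c.
have -> : delta b - delta a = delta (b - a); last exact: hb.
by have := derivationD hd sba sa; rewrite subrK => ->; rewrite addrK.
Qed.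

End Decomposition.
End DerivationTheorem.

Theorem theorem5p6 (R : realType) (H : completeNormedModType R[i])
    (ip : {dot H for Num.conj}) (E : nat -> H)
    (hH : is_hilbert_norm ip) (hE : is_orthonormal_basis ip E)
    (delta : (H -> H) -> (H -> H)) (hdelta : is_derivation ip E delta) :
  toeplitz_continuous ip E delta /\
  exists! F : R -> R[i], smooth_circle F /\
    exists dF dt : (H -> H) -> (H -> H),
      [/\ is_delta ip E F dF,
          is_inner ip E dt,
          forall a, smooth_toeplitz ip E a -> smooth_compact ip E (dt a)
        & forall a, smooth_toeplitz ip E a -> delta a = dF a + dt a].
Proof.
have [F [g [y [sF hg hy impl]]]] := implementer_decomp hH hE hdelta.
split; first exact: (derivation_continuous hH hE hdelta sF hg hy impl).
have dsub := derivation_sub_inner hH hE hdelta sF hg hy impl.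
have comp := inner_derivation_compact hH hE hg hy.
have dadd a : smooth_toeplitz ip E a ->
  delta a = (delta a - inner_derivation ip E g y a) + inner_derivation ip E g y a.
  by move=> _; rewrite subrK.
exists F; split.
  split=> //; exists (fun a => delta a - inner_derivation ip E g y a).
  exists (inner_derivation ip E g y); split=> //.
  by exists (inner_part ip E g y); [exact: smooth_toeplitz_inner_part|].
move=> F2 [sF2 [dF2 [dt2 [h1 _ h2 h3]]]].
(* It suffices to compare Fourier coefficients. Both decompositions describe [delta U], so the
   Toeplitz matrix of [F - F2] is rapidly decaying and its coefficients vanish. *)
apply: fourier_inj => //; apply/funext => n.
have [c1 rc1 e1] := shiftU_symbol hH hE sF dsub comp dadd.
have [c2 rc2 e2] := shiftU_symbol hH hE sF2 h1 h2 h3.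
apply/eqP; rewrite -subr_eq0; apply/eqP.
apply: (@toepm_decay_eq0 _ (fun n => fourier F n - fourier F2 n)
  (fun k l => c2 k l + - c1 k l)) => [|k l].
  by apply: mdecayD => //; exact: mdecayN.
have := e1 k l; rewrite e2 => e; rewrite -[LHS]/(toepm (fourier F) k l - toepm (fourier F2) k l).
apply/eqP; rewrite subr_eq addrAC eq_sym subr_eq eq_sym; apply/eqP.
by rewrite -e addrC.
Qed.
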